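(* Let $(\varphi,c)\in\operatorname{Aut}(\mathbb{P}^t_k)\times\mathbb{P}^t_k$ satisfy the critical density condition. There is an affine patch $\mathbb{A}^t\subseteq\mathbb{P}^t$ (the complement of a hyperplane, with suitable affine coordinates $y_1,\dots,y_t$) such that $\{c_i\}_{i\in\mathbb{Z}}\subseteq\mathbb{A}^t$ and the infinite blowup $B$ of $\mathbb{A}^t$ at the sequence of points $\{c_i\}_{i\ge 0}$ is defined. For this $B$, the ring $R=R(\varphi,c)$ is noetherian, and $B$ is a commutative noetherian $k$-algebra which is a UFD, but $R\otimes_k B$ is not a left noetherian ring.
   Context: Let $k$ be an algebraically closed field, $t\ge 2$ an integer, $U=k[x_0,\dots,x_t]$ the commutative polynomial ring with $\deg x_i=1$, and $\mathbb{P}^t=\operatorname{Proj}U$; ''point'' means closed point. Multiplication in $U$ is written $\circ$. For a point $d$ let $\mathfrak{m}_d\subseteq U$ be its homogeneous ideal. Given $\varphi\in\operatorname{Aut}(\mathbb{P}^t)$, let $\phi$ be a graded $k$-algebra automorphism of $U$ with $\mathfrak{m}_{\varphi(d)}=\phi^{-1}(\mathfrak{m}_d)$ for all points $d$ ($\phi$ is unique up to a nonzero scalar multiple, which does not affect the isomorphism class of the algebras below). The (left) Zhang twist $S=S(\varphi)$ is the graded $k$-algebra with the same underlying graded vector space as $U$ and multiplication $fg=\phi^n(f)\circ g$ for $f\in U_m$, $g\in U_n$. For a point $c$, $R(\varphi,c)$ is the $k$-subalgebra of $S(\varphi)$ generated by the codimension-one subspace $(\mathfrak{m}_c)_1=\{f\in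 U_1 : f(c)=0\}$ of $S_1=U_1$. Put $c_i=\varphi^{-i}(c)$ for $i\in\mathbb{Z}$. An infinite set $\mathcal{C}$ of closed points of a variety $X$ is critically dense in $X$ if every proper Zariski-closed subset of $X$ contains only finitely many points of $\mathcal{C}$. The critical density condition on $(\varphi,c)$: $c$ has infinite order under $\varphi$ (the $c_i$ are distinct) and $\{c_i\}_{i\in\mathbb{Z}}$ is critically dense in $\mathbb{P}^t$. Infinite blowup: let $A=k[y_1,\dots,y_t]$ be the coordinate ring of $\mathbb{A}^t$ and let $d_i=(a_{i1},\dots,a_{it})$, $i\ge 0$, be a sequence of points of $\mathbb{A}^t$ with $a_{i1}\ne a_{j1}$ for $i\ne j$. The infinite blowup of $\mathbb{A}^t$ at the sequence $\{d_i\}$ is the ring $B=A[\{(y_j-a_{ij})(y_1-a_{i1})^{-1}\mid 2\le j\le t,\ i\ge 0\}]\subseteq k(y_1,\dots,y_t)$ (or its spectrum). *)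

(* Defs.v *)
From HB Require Import structures.
From mathcomp Require Import all_boot all_order all_algebra.
From mathcomp Require Import generic_quotient fraction.
From mathcomp Require Import boolp.
From mathcomp Require Import mpoly.

Set Implicit Arguments.
Unset Strict Implicit.
Unset Printing Implicit Defensive.

Import GRing.Theory.
Local Open Scope ring_scope.
Local Open Scope quotient_scope.


Definition is_left_ideal (R : pzRingType) (I : R -> Prop) : Prop :=
  [/\ I 0, forall x y, I x -> I y -> I (x + y) & forall a x, I x -> I (a * x)].

Definition left_noetherian (R : pzRingType) : Prop :=
  forall I : nat -> R -> Prop,
    (forall n, is_left_ideal (I n)) ->
    (forall n x, I n x -> I n.+1 x) ->
    exists N, forall n x, (N <= n)%N -> I n x -> I N x.

(* R^c is the opposite ring, so this is the condition on both sides. *)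
Definition noetherian (R : pzRingType) : Prop :=
  left_noetherian R /\ left_noetherian R^c.

Section UFD.
Variable R : comNzRingType.

Definition is_unit (x : R) : Prop := exists y, x * y = 1.

Definition irreducible (x : R) : Prop :=
  [/\ x <> 0, ~ is_unit x
    & forall a b, x = a * b -> is_unit a \/ is_unit b].

Definition associated (x y : R) : Prop := exists2 u, is_unit u & x = u * y.

Definition is_UFD : Prop :=
  [/\ forall x y : R, x * y = 0 -> x = 0 \/ y = 0,
      forall x : R, x <> 0 -> ~ is_unit x ->
        exists2 s : seq R, {in s, forall p, irreducible p}
                         & x = \prod_(p <- s) p
    & forall s s' : seq R,
        {in s, forall p, irreducible p} -> {in s', forall p, irreducible p} ->
        \prod_(p <- s) p = \prod_(p <- s') p ->
        exists s'' : seq R,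
          [/\ perm_eq s'' s', size s = size s''
            & forall i, (i < size s)%N -> associated s`_i s''`_i]].

End UFD.


Section Subalgebra.
Variables (k : fieldType) (A : algType k).

Definition is_subalg (P : A -> Prop) : Prop :=
  [/\ P 1, forall (a : k) x y, P x -> P y -> P (a *: x + y)
    & forall x y, P x -> P y -> P (x * y)].

Variable X : A -> Prop.

Definition in_subalg : {pred A} :=
  [pred x | `[< forall P, is_subalg P -> (forall y, X y -> P y) -> P x >]].

Lemma in_subalg_closed : subalg_closed in_subalg.
Proof.
split=> [|a x y /asboolP hx /asboolP hy|x y /asboolP hx /asboolP hy].
- by apply/asboolP=> P [].
- by apply/asboolP=> P sP XP; have [_ Pl _] := sP; apply: Pl; [apply: hx|apply: hy].
- by apply/asboolP=> P sP XP; have [_ _ Pm] := sP; apply: Pm; [apply: hx|apply: hy].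
Qed.

HB.instance Definition _ :=
  GRing.isSubalgClosed.Build k A in_subalg in_subalg_closed.

Record gen_subalg := GenSubalg { gen_val : A; gen_valP : gen_val \in in_subalg }.

HB.instance Definition _ := [isSub for gen_val].
HB.instance Definition _ := [Choice of gen_subalg by <:].
HB.instance Definition _ := [SubChoice_isSubAlgebra of gen_subalg by <:].

End Subalgebra.

Section ComSubalgebra.
Variables (k : fieldType) (A : comAlgType k) (X : A -> Prop).
HB.instance Definition _ :=
  [SubNzRing_isSubComNzRing of gen_subalg X by <:].
End ComSubalgebra.


Section Tensor.
Variables (k : fieldType) (A B : algType k).

Definition is_bilinear (V : lmodType k) (f : A -> B -> V) : Prop :=
  (forall b, linear (f^~ b)) /\ (forall a, linear (f a)).

(* A list s stands for the formal sum of the a (x) b for (a, b) in s. *)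
Definition tsum (V : lmodType k) (f : A -> B -> V) (s : seq (A * B)) : V :=
  \sum_(x <- s) f x.1 x.2.

(* Two formal sums are equal in A (x) B iff no bilinear map separates them;
   the universal property is proved in tensorP below. *)
Definition tens_eq (s s' : seq (A * B)) : bool :=
  `[< forall (V : lmodType k) (f : A -> B -> V),
        is_bilinear f -> tsum f s = tsum f s' >].

Lemma tens_eq_refl : reflexive tens_eq.
Proof. by move=> s; apply/asboolP. Qed.

Lemma tens_eq_sym s s' : tens_eq s s' = tens_eq s' s.
Proof.
by apply/idP/idP=> /asboolP h; apply/asboolP=> V f fb; rewrite h.
Qed.

Lemma tens_eq_trans : transitive tens_eq.
Proof.
move=> s2 s1 s3 /asboolP h /asboolP h'.
by apply/asboolP=> V f fb; rewrite h // h'.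
Qed.

Canonical tens_equiv := EquivRel tens_eq tens_eq_refl tens_eq_sym tens_eq_trans.

Definition tensor := {eq_quot tens_equiv}.
HB.instance Definition _ : EqQuotient _ tens_equiv tensor :=
  EqQuotient.on tensor.
HB.instance Definition _ := Choice.on tensor.

Lemma tensor_eqP (s s' : seq (A * B)) :
  (\pi_tensor s = \pi_tensor s') <->
  (forall (V : lmodType k) (f : A -> B -> V),
     is_bilinear f -> tsum f s = tsum f s').
Proof.
split=> [/eqP|h]; first by rewrite eqmodE => /asboolP.
by apply/eqP; rewrite eqmodE; apply/asboolP.
Qed.

Definition tens_of (s : seq (A * B)) : tensor := \pi_tensor s.

Definition pure (a : A) (b : B) : tensor := tens_of [:: (a, b)].

Definition tadd (x y : tensor) : tensor := tens_of (repr x ++ repr y).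
Definition topp (x : tensor) : tensor :=
  tens_of [seq (- u.1, u.2) | u <- repr x].
Definition tscale (c : k) (x : tensor) : tensor :=
  tens_of [seq (c *: u.1, u.2) | u <- repr x].
Definition tmul (x y : tensor) : tensor :=
  tens_of [seq (u.1 * v.1, u.2 * v.2) | u <- repr x, v <- repr y].

Section Bilinear.
Variables (V : lmodType k) (f : A -> B -> V) (fb : is_bilinear f).

Lemma bilZl c a b : f (c *: a) b = c *: f a b.
Proof.
have fl := fb.1 b.
have f0 : f 0 b = 0.
  by have /eqP := fl 1 0 0; rewrite !scale1r addr0 -subr_eq0 opprD addNKr oppr_eq0 => /eqP.
by have := fl c a 0; rewrite addr0 f0 addr0.
Qed.

Lemma bilDl a a' b : f (a + a') b = f a b + f a' b.
Proof. by have := fb.1 b 1 a a'; rewrite !scale1r. Qed.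

Lemma bilNl a b : f (- a) b = - f a b.
Proof. by rewrite -[- a]scaleN1r bilZl scaleN1r. Qed.

Lemma tsum_cat s s' : tsum f (s ++ s') = tsum f s + tsum f s'.
Proof. by rewrite /tsum big_cat. Qed.

Lemma tsum_opp s : tsum f [seq (- u.1, u.2) | u <- s] = - tsum f s.
Proof.
by rewrite /tsum big_map (big_morph _ (@opprD _) (@oppr0 _)); apply: eq_bigr => u _;
   rewrite bilNl.
Qed.

Lemma tsum_scale c s : tsum f [seq (c *: u.1, u.2) | u <- s] = c *: tsum f s.
Proof.
by rewrite /tsum big_map scaler_sumr; apply: eq_bigr => u _; rewrite bilZl.
Qed.

Lemma tsum_mul s s' :
  tsum f [seq (u.1 * v.1, u.2 * v.2) | u <- s, v <- s'] =
  \sum_(u <- s) \sum_(v <- s') f (u.1 * v.1) (u.2 * v.2).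
Proof. by rewrite /tsum big_allpairs_dep. Qed.

Lemma bil_mull (s' : seq (A * B)) :
  is_bilinear (fun a b => \sum_(v <- s') f (a * v.1) (b * v.2)).
Proof.
split=> [b c a a'|a c b b']; rewrite scaler_sumr -big_split; apply: eq_bigr => v _ /=.
- by rewrite mulrDl -scalerAl (fb.1 _).
- by rewrite mulrDl -scalerAl (fb.2 _).
Qed.

Lemma bil_mulr (s : seq (A * B)) :
  is_bilinear (fun a b => \sum_(u <- s) f (u.1 * a) (u.2 * b)).
Proof.
split=> [b c a a'|a c b b']; rewrite scaler_sumr -big_split; apply: eq_bigr => v _ /=.
- by rewrite mulrDr -scalerAr (fb.1 _).
- by rewrite mulrDr -scalerAr (fb.2 _).
Qed.

Lemma tsum_repr s : tsum f (repr (tens_of s)) = tsum f s.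
Proof.
have /tensor_eqP : \pi_tensor (repr (tens_of s)) = \pi_tensor s by rewrite reprK.
exact.
Qed.

End Bilinear.

Lemma tens_ofK (x : tensor) : tens_of (repr x) = x.
Proof. exact: reprK. Qed.

Lemma tens_ext (x y : tensor) :
  (forall (V : lmodType k) (f : A -> B -> V),
     is_bilinear f -> tsum f (repr x) = tsum f (repr y)) -> x = y.
Proof. by move=> h; rewrite -[x]reprK -[y]reprK; apply/tensor_eqP. Qed.

Lemma tsum_add V f (fb : @is_bilinear V f) x y :
  tsum f (repr (tadd x y)) = tsum f (repr x) + tsum f (repr y).
Proof. by rewrite tsum_repr // tsum_cat. Qed.

Lemma tsum_tmul V f (fb : @is_bilinear V f) x y :
  tsum f (repr (tmul x y)) =
  \sum_(u <- repr x) \sum_(v <- repr y) f (u.1 * v.1) (u.2 * v.2).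
Proof. by rewrite tsum_repr // tsum_mul. Qed.

Lemma tsum_tmulr V f (fb : @is_bilinear V f) x y :
  tsum f (repr (tmul x y)) =
  tsum (fun a b => tsum (fun a' b' => f (a * a') (b * b')) (repr y)) (repr x).
Proof. by rewrite tsum_tmul. Qed.

Lemma tsum_tmull V f (fb : @is_bilinear V f) x y :
  tsum f (repr (tmul x y)) =
  tsum (fun a' b' => tsum (fun a b => f (a * a') (b * b')) (repr x)) (repr y).
Proof. by rewrite tsum_tmul // exchange_big. Qed.

Lemma bil_1 V f (fb : @is_bilinear V f) a b :
  is_bilinear (fun a' b' => f (a * a') (b * b')).
Proof.
have [h1 h2] := bil_mulr fb [:: (a, b)].
by split=> [b' c x y|a' c x y]; [have := h1 b' c x y|have := h2 a' c x y];
   rewrite !big_seq1.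
Qed.

Lemma bil_2 V f (fb : @is_bilinear V f) a b :
  is_bilinear (fun a' b' => f (a' * a) (b' * b)).
Proof.
have [h1 h2] := bil_mull fb [:: (a, b)].
by split=> [b' c x y|a' c x y]; [have := h1 b' c x y|have := h2 a' c x y];
   rewrite !big_seq1.
Qed.

Fact taddA : associative tadd.
Proof. by move=> x y z; apply: tens_ext => V f fb; rewrite !tsum_add // addrA. Qed.
Fact taddC : commutative tadd.
Proof. by move=> x y; apply: tens_ext => V f fb; rewrite !tsum_add // addrC. Qed.
Fact tadd0 : left_id (tens_of [::]) tadd.
Proof.
move=> x; apply: tens_ext => V f fb; rewrite tsum_add // tsum_repr //.
by rewrite /tsum big_nil add0r.
Qed.
Fact taddN : left_inverse (tens_of [::]) topp tadd.
Proof.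
move=> x; apply: tens_ext => V f fb; rewrite tsum_add // !tsum_repr // tsum_opp //.
by rewrite addNr /tsum big_nil.
Qed.

HB.instance Definition _ := GRing.isZmodule.Build tensor taddA taddC tadd0 taddN.

Fact tmulA : associative tmul.
Proof.
move=> x y z; apply: tens_ext => V f fb.
rewrite tsum_tmulr // [RHS]tsum_tmull //.
under [RHS]eq_bigr => w _.
  rewrite -/(tsum (fun a b => f (a * w.1) (b * w.2)) (repr (tmul x y))).
  rewrite (tsum_tmul (bil_2 fb _ _)).
over.
rewrite /= exchange_big; apply: eq_bigr => u _ /=.
rewrite (tsum_tmul (bil_1 fb _ _)) exchange_big.
by apply: eq_bigr => v _; apply: eq_bigr => w _; rewrite /= !mulrA.
Qed.

Fact tmul1 : left_id (pure 1 1) tmul.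
Proof.
move=> x; apply: tens_ext => V f fb; rewrite tsum_tmull //; apply: eq_bigr => v _.
by rewrite /= (tsum_repr (bil_2 fb _ _)) /tsum big_seq1 /= !mul1r.
Qed.
Fact tmulr1 : right_id (pure 1 1) tmul.
Proof.
move=> x; apply: tens_ext => V f fb; rewrite tsum_tmulr //; apply: eq_bigr => v _.
by rewrite /= (tsum_repr (bil_1 fb _ _)) /tsum big_seq1 /= !mulr1.
Qed.
Fact tmulDl : left_distributive tmul +%R.
Proof.
move=> x y z; apply: tens_ext => V f fb.
by rewrite tsum_tmulr // !tsum_add // ?tsum_tmulr //; apply: bil_mull.
Qed.
Fact tmulDr : right_distributive tmul +%R.
Proof.
move=> x y z; apply: tens_ext => V f fb.
by rewrite tsum_tmull // !tsum_add // ?tsum_tmull //; apply: bil_mulr.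
Qed.

HB.instance Definition _ :=
  GRing.Zmodule_isPzRing.Build tensor tmulA tmul1 tmulr1 tmulDl tmulDr.

Fact tscaleA a b x : tscale a (tscale b x) = tscale (a * b) x.
Proof.
apply: tens_ext => V f fb.
by do 3![rewrite tsum_repr // tsum_scale //]; rewrite scalerA.
Qed.
Fact tscale1 : left_id 1 tscale.
Proof.
by move=> x; apply: tens_ext => V f fb; rewrite tsum_repr // tsum_scale // scale1r.
Qed.
Fact tscaleDr : right_distributive tscale +%R.
Proof.
move=> c x y; apply: tens_ext => V f fb.
rewrite tsum_repr // tsum_scale // !tsum_add // !tsum_repr // !tsum_scale //.
by rewrite scalerDr.
Qed.
Fact tscaleDl x : {morph tscale^~ x : a b / a + b}.
Proof.
move=> a b; apply: tens_ext => V f fb.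
by rewrite tsum_repr // tsum_scale // tsum_add // !tsum_repr // !tsum_scale // scalerDl.
Qed.

HB.instance Definition _ :=
  GRing.Zmodule_isLmodule.Build k tensor tscaleA tscale1 tscaleDr tscaleDl.

Lemma pure_bilinear : is_bilinear pure.
Proof.
split=> [b c a a'|a c b b']; apply: tens_ext => V f fb;
  rewrite tsum_repr // tsum_add // tsum_repr // tsum_scale // !tsum_repr //;
  by rewrite /tsum !big_seq1 /= ?(fb.1 _) ?(fb.2 _).
Qed.

Lemma pureM a b a' b' : pure a b * pure a' b' = pure (a * a') (b * b').
Proof.
apply: tens_ext => V f fb.
rewrite tsum_tmulr // [LHS]tsum_repr; last exact: bil_mull.
rewrite [LHS]big_seq1 /= /pure (tsum_repr (bil_1 fb _ _)) tsum_repr //.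
by rewrite /tsum !big_seq1.
Qed.

Lemma tensor_scalerAl (c : k) (x y : tensor) : c *: (x * y) = (c *: x) * y.
Proof.
apply: tens_ext => V f fb.
rewrite tsum_repr // tsum_scale // [RHS]tsum_tmulr // [RHS]tsum_repr; last exact: bil_mull.
by rewrite tsum_scale ?tsum_tmulr //; apply: bil_mull.
Qed.

Lemma tensor_scalerAr (c : k) (x y : tensor) : c *: (x * y) = x * (c *: y).
Proof.
apply: tens_ext => V f fb.
rewrite tsum_repr // tsum_scale // [RHS]tsum_tmull // [RHS]tsum_repr; last exact: bil_mulr.
by rewrite tsum_scale ?tsum_tmull //; apply: bil_mulr.
Qed.

Lemma tensorE (x : tensor) : x = \sum_(u <- repr x) pure u.1 u.2.
Proof.
rewrite -[LHS]reprK; elim: (repr x) => [|[a b] s IHs].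
  by rewrite big_nil.
rewrite big_cons -IHs; apply: tens_ext => V f fb.
by rewrite tsum_add // !tsum_repr // -tsum_cat.
Qed.

Lemma tensorP (V : lmodType k) (f : A -> B -> V) : is_bilinear f ->
  exists2 g : {linear tensor -> V}, (forall a b, g (pure a b) = f a b)
    & forall h : {linear tensor -> V}, (forall a b, h (pure a b) = f a b) -> h =1 g.
Proof.
move=> fb; pose g0 (x : tensor) := tsum f (repr x).
have g0l : linear g0.
  by move=> c x y; rewrite /g0 tsum_add // tsum_repr // tsum_scale.
pose g1 := GRing.isLinear.Build k tensor V *:%R g0 g0l.
pose g : {linear tensor -> V} := HB.pack g0 g1.
have gE a b : g (pure a b) = f a b.
  by rewrite /= /g0 tsum_repr // /tsum big_seq1.
exists g => // h hE x; rewrite [x]tensorE (raddf_sum h) (raddf_sum g).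
apply: eq_bigr => u _; exact: (etrans (hE _ _) (esym (gE _ _))).
Qed.

End Tensor.


Section Projective.
Variables (k : closedFieldType) (t : nat).

Local Notation U := {mpoly k[t.+1]}.

(* A closed point of P^t is a line through the origin of k^(t+1). *)
Record point := Point {
  line : {vspace 'rV[k]_t.+1};
  line_dim : \dim line == 1%N
}.
HB.instance Definition _ := [isSub for line].
HB.instance Definition _ := [Choice of point by <:].

(* Meaningful for homogeneous f. *)
Definition vanishes (f : U) (d : point) : Prop :=
  forall v, v \in line d -> f.@[fun i => v 0 i] = 0.

(* The homogeneous ideal m_d: f lies in it iff its homogeneous components do. *)
Definition pt_ideal (d : point) (f : U) : Prop :=
  forall n, vanishes (pihomog mdeg n f) d.

Definition zariski_closed (Z : point -> Prop) : Prop :=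
  exists F : U -> Prop,
    (forall f, F f -> exists n, f \is n.-homog) /\
    (forall d, Z d <-> forall f, F f -> vanishes f d).

(* A map of points is regular if, locally for the Zariski topology, it is given
   by homogeneous polynomials of the same degree without common zero. *)
Definition regular (g : point -> point) : Prop :=
  forall d, exists (Z : point -> Prop) (e : nat) (G : 'I_t.+1 -> U),
    [/\ zariski_closed Z, ~ Z d, forall i, G i \is e.-homog
      & forall d', ~ Z d' ->
          (exists i, ~ vanishes (G i) d') /\
          (forall v, v \in line d' ->
             \row_i (G i).@[fun j => v 0 j] \in line (g d'))].

Record autP := AutP {
  aut_fun :> point -> point;
  aut_inv : point -> point;
  aut_funK : cancel aut_fun aut_inv;
  aut_invK : cancel aut_inv aut_fun;
  aut_reg : regular aut_fun;
  aut_inv_reg : regular aut_inv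
}.

(* c_i = phi^(-i)(c). *)
Definition orbit_pt (phi : autP) (c : point) (i : int) : point :=
  match i with
  | Posz n => iter n (aut_inv phi) c
  | Negz n => iter n.+1 phi c
  end.

Definition finite_pts (C : point -> Prop) : Prop :=
  exists s : seq point, forall d, C d -> d \in s.

Definition critically_dense (C : point -> Prop) : Prop :=
  ~ finite_pts C /\
  forall Z, zariski_closed Z -> (exists d, ~ Z d) ->
    finite_pts (fun d => C d /\ Z d).

Definition critical_density (phi : autP) (c : point) : Prop :=
  injective (orbit_pt phi c) /\
  critically_dense (fun d => exists i, d = orbit_pt phi c i).

(* Affine patches. The columns of an invertible matrix M are linear forms
   l_0, ..., l_t forming a basis of U_1. The patch is the complement of the
   hyperplane l_0 = 0, with affine coordinates y_j = l_j / l_0, 1 <= j <= t;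
   below, y_j is indexed by j - 1 in 'I_t. *)
Definition in_patch (M : 'M[k]_t.+1) (d : point) : Prop :=
  exists2 v, v \in line d & (v *m M) 0 ord0 != 0.

Definition patch_coord (M : 'M[k]_t.+1) (d : point) (j : 'I_t) : k :=
  let v := vpick (line d) in (v *m M) 0 (lift ord0 j) / (v *m M) 0 ord0.

End Projective.


Record graded_aut (k : fieldType) (n : nat) := GradedAut {
  gaut_fun :> {lrmorphism {mpoly k[n]} -> {mpoly k[n]}};
  gaut_bij : bijective gaut_fun;
  gaut_homog : forall d f, f \is d.-homog -> gaut_fun f \is d.-homog
}.

Section Twist.
Variables (k : fieldType) (n : nat).

Local Notation U := {mpoly k[n]}.

Definition zhang_twist (phi : graded_aut k n) : Type := U.

Variable phi : graded_aut k n.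

Local Notation twist := (zhang_twist phi).

HB.instance Definition _ := GRing.Lmodule.on twist.

(* Bilinear extension of f g = phi^d (f) o g for g homogeneous of degree d. *)
Definition twist_mul (f g : twist) : twist :=
  \sum_(d < msize (g : U)) (iter d phi f : U) * pihomog mdeg d (g : U).

Lemma iter_gautD d (f g : U) : iter d phi (f + g) = iter d phi f + iter d phi g.
Proof. by elim: d => //= d ->; rewrite raddfD. Qed.
Lemma iter_gautZ d c (f : U) : iter d phi (c *: f) = c *: iter d phi f.
Proof. by elim: d => //= d ->; rewrite linearZ. Qed.
Lemma iter_gautM d (f g : U) : iter d phi (f * g) = iter d phi f * iter d phi g.
Proof. by elim: d => //= d ->; rewrite rmorphM. Qed.
Lemma iter_gaut0 d : iter d phi (0 : U) = 0.
Proof. by elim: d => //= d ->; rewrite raddf0. Qed.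
Lemma iter_gaut1 d : iter d phi (1 : U) = 1.
Proof. by elim: d => //= d ->; rewrite rmorph1. Qed.
Lemma iter_gaut_homog d e (f : U) : f \is e.-homog -> iter d phi f \is e.-homog.
Proof. by move=> fh; elim: d => //= d; apply: gaut_homog. Qed.

Lemma pihomog_ge d (g : U) : (msize g <= d)%N -> pihomog mdeg d g = 0.
Proof.
move=> le; rewrite pihomogE big_seq_cond big1 // => m /andP[mg /eqP md].
by have := msize_mdeg_lt mg; rewrite md ltnNge le.
Qed.

Lemma twist_mulE N (f g : U) : (msize g <= N)%N ->
  twist_mul f g = \sum_(d < N) iter d phi f * pihomog mdeg d g.
Proof.
move=> le; rewrite /twist_mul.
rewrite (big_ord_widen _ (fun d => iter d phi f * pihomog mdeg d g) le).
rewrite [RHS](bigID (fun d : 'I_N => (d < msize g)%N)) /= [X in _ = _ + X]big1 ?addr0 //.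
by move=> d; rewrite -leqNgt => h; rewrite pihomog_ge // mulr0.
Qed.

Lemma twist_mul_homog d (f g : U) :
  g \is d.-homog -> twist_mul f g = iter d phi f * g.
Proof.
move=> gh; rewrite (@twist_mulE (maxn (msize g) d.+1)) ?leq_maxl //.
have ltd : (d < maxn (msize g) d.+1)%N by rewrite leq_max leqnn orbT.
rewrite (bigD1 (Ordinal ltd)) //= pihomog_dE // big1 ?addr0 // => e ne.
by rewrite (@pihomog_ne0 _ _ _ d e g) ?mulr0 // eq_sym.
Qed.

Fact twist_mulDl : left_distributive twist_mul +%R.
Proof.
move=> f f' g; rewrite /twist_mul -big_split; apply: eq_bigr => d _ /=.
by rewrite iter_gautD mulrDl.
Qed.

Fact twist_mulDr : right_distributive twist_mul +%R.
Proof.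
move=> f g g'; pose N := maxn (msize (g : U)) (msize (g' : U)).
rewrite !(@twist_mulE N) ?leq_maxl ?leq_maxr ?msizeD_le // -big_split.
by apply: eq_bigr => d _ /=; rewrite pihomogD mulrDr.
Qed.

Fact twist_mulZl c (f g : twist) : c *: twist_mul f g = twist_mul (c *: f) g.
Proof.
rewrite /twist_mul scaler_sumr; apply: eq_bigr => d _.
by rewrite iter_gautZ scalerAl.
Qed.

Lemma twist_mul0 (f : twist) : twist_mul f 0 = 0.
Proof. by apply: (addrI (twist_mul f 0)); rewrite -twist_mulDr !addr0. Qed.

Lemma twist_mul0l (f : twist) : twist_mul 0 f = 0.
Proof. by apply: (addrI (twist_mul 0 f)); rewrite -twist_mulDl !addr0. Qed.

Lemma twist_ind (P : U -> Prop) : P 0 -> (forall f g, P f -> P g -> P (f + g)) ->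
  (forall d f, f \is d.-homog -> P f) -> forall f, P f.
Proof.
move=> P0 PD Ph f; rewrite (@pihomog_partitionE _ _ mdeg (msize f) f) //.
by elim/big_rec: _ => // d g _; apply: PD; apply: (Ph d); apply: pihomogP.
Qed.

Fact twist_mulZr c (f g : twist) : c *: twist_mul f g = twist_mul f (c *: g).
Proof.
move: g; apply: twist_ind => [|g h Hg Hh|d g gh].
- by rewrite twist_mul0 scaler0 twist_mul0.
- by rewrite twist_mulDr !scalerDr Hg Hh twist_mulDr.
- by rewrite !(@twist_mul_homog d) ?dhomogZ // scalerAr.
Qed.

Fact twist_mulA : associative twist_mul.
Proof.
move=> f g h; move: h; apply: twist_ind => [|h h' H H'|e h hh].
- by rewrite !twist_mul0.
- by rewrite !twist_mulDr H H'.
move: g; apply: twist_ind => [|g g' H H'|d g gh].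
- by rewrite twist_mul0 twist_mul0l twist_mul0.
- by rewrite twist_mulDr !twist_mulDl twist_mulDr H H'.
rewrite (@twist_mul_homog e g h) // (@twist_mul_homog e _ h) //.
rewrite (@twist_mul_homog d f g) // (@twist_mul_homog (d + e)).
  by rewrite iter_gautM -iterD addnC mulrA.
by rewrite dhomogM ?iter_gaut_homog.
Qed.

Fact twist_mul1l : left_id (1 : U) twist_mul.
Proof.
apply: twist_ind => [|g h Hg Hh|d g gh]; first exact: twist_mul0.
- by rewrite twist_mulDr Hg Hh.
- by rewrite (@twist_mul_homog d) // iter_gaut1 mul1r.
Qed.

Fact twist_mul1r : right_id (1 : U) twist_mul.
Proof. by move=> f; rewrite (@twist_mul_homog 0) ?dhomog1 //= mulr1. Qed.

HB.instance Definition _ := GRing.Zmodule_isNzRing.Build twist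
  twist_mulA twist_mul1l twist_mul1r twist_mulDl twist_mulDr (oner_neq0 U).
HB.instance Definition _ := GRing.Lmodule_isLalgebra.Build k twist twist_mulZl.
HB.instance Definition _ := GRing.Lalgebra_isAlgebra.Build k twist twist_mulZr.

End Twist.

(* m_(phi(d)) = Phi^-1(m_d) for all closed points d. *)
Definition induces (k : closedFieldType) (t : nat)
    (Phi : graded_aut k t.+1) (phi : autP k t) : Prop :=
  forall (d : point k t) f, pt_ideal (phi d) f <-> pt_ideal d (Phi f).

(* The subalgebra of S(phi) generated by (m_c)_1. *)
Definition Ralg (k : closedFieldType) (t : nat)
    (Phi : graded_aut k t.+1) (c : point k t) : algType k :=
  gen_subalg (fun f : zhang_twist Phi =>
    (f : {mpoly k[t.+1]}) \is 1.-homog /\ vanishes f c).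


Section RatFun.
Variables (k : fieldType) (t : nat).

(* k(y_1, ..., y_t); MathComp gives {fraction _} no k-algebra structure. *)
Definition ratfun : Type := {fraction {mpoly k[t]}}.
HB.instance Definition _ := GRing.Field.on ratfun.

Definition ratfun_scale (c : k) (x : ratfun) : ratfun :=
  (tofrac (c%:MP : {mpoly k[t]}) : ratfun) * x.

Fact ratfun_scaleA a b x : ratfun_scale a (ratfun_scale b x) = ratfun_scale (a * b) x.
Proof. by rewrite /ratfun_scale mulrA mpolyCM rmorphM. Qed.
Fact ratfun_scale1 : left_id 1 ratfun_scale.
Proof. by move=> x; rewrite /ratfun_scale rmorph1 mul1r. Qed.
Fact ratfun_scaleDr : right_distributive ratfun_scale +%R.
Proof. by move=> a x y; rewrite /ratfun_scale mulrDr. Qed.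
Fact ratfun_scaleDl x : {morph ratfun_scale^~ x : a b / a + b}.
Proof. by move=> a b; rewrite /ratfun_scale mpolyCD rmorphD mulrDl. Qed.
HB.instance Definition _ := GRing.Zmodule_isLmodule.Build k ratfun
  ratfun_scaleA ratfun_scale1 ratfun_scaleDr ratfun_scaleDl.
Fact ratfun_scaleAl (a : k) (x y : ratfun) : a *: (x * y) = (a *: x) * y.
Proof. exact: mulrA. Qed.
HB.instance Definition _ := GRing.Lmodule_isLalgebra.Build k ratfun ratfun_scaleAl.
HB.instance Definition _ := GRing.Lalgebra_isComAlgebra.Build k ratfun.

Variable a : nat -> 'I_t -> k.

(* y_j - a_ij *)
Definition blowup_lin (i : nat) (j : 'I_t) : ratfun :=
  tofrac ('X_j - (a i j)%:MP : {mpoly k[t]}).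

(* The coordinate y_1 is the one of index l : 'I_t with l = 0. *)
Definition blowup_defined : Prop :=
  forall (l : 'I_t) (i j : nat), l = 0%N :> nat -> i <> j -> a i l <> a j l.

Definition blowup_gens (x : ratfun) : Prop :=
  (exists p : {mpoly k[t]}, x = tofrac p) \/
  (exists (l j : 'I_t) (i : nat),
     [/\ l = 0%N :> nat, (0 < j)%N & x = blowup_lin i j / blowup_lin i l]).

Definition infinite_blowup : comAlgType k := gen_subalg blowup_gens.

End RatFun.

(* Main.v *)
(** The automorphism acts on linear forms, so over an algebraically closed field
    it has an eigenform [l0] and an eigenform [l1] modulo [l0].  Critical density
    keeps the orbit off the invariant hyperplane [l0 = 0], and [l1 / l0] takes
    distinct values on the orbit because the automorphism acts on it by an affine map.

    [R_n] consists of the forms of degree [n] vanishing at [c_0, ..., c_(n-1)].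
    Leading forms of one-sided ideals of [R] form graded modules [I] with
    [(m_(c_n))_1 I_n <= I_(n+1)] (for right ideals, after untwisting and reversing
    the orbit).  An ascending chain of these generates eventually a fixed ideal
    [(f_1, ..., f_r)] of [U]; writing an element of degree [m] as [\sum_j h_j f_j], Koszul
    syzygies allow one to make all [h_j] vanish at every [c_i], [i < m], outside the
    finite set of common zeros of the [f_j], because for [m] large the points impose
    independent conditions even on forms of degree [m - e].  The values of the [h_j]
    at those finitely many points are the only obstruction, and it lives in a
    fixed finite-dimensional space.

    In [B] the elements [p_i = y_1 - a_(i1)] are prime with polynomial residue rings,
    and any nonzero element is comaximal to all but finitely many of them.  Hence
    chains of ideals are controlled by finitely generated subalgebras, and Nagata's
    lemma transfers unique factorisation from [k[y_1, ..., y_t]] to [B].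

    Evaluation at the tautological point of the patch gives a left ideal of
    [R (x) B] that is not finitely generated: a generator of degree [n + 1] is needed
    for each [n], since, specialised at a point of the [n]-th exceptional
    divisor, products of elements of lower degree vanish to second order at [c_n]. *)

From HB Require Import structures.
Require Import Defs.
From mathcomp Require Import all_boot all_order all_algebra ring zify.
From mathcomp Require Import generic_quotient fraction boolp mpoly.

Set Implicit Arguments.
Unset Strict Implicit.
Unset Printing Implicit Defensive.

Import GRing.Theory.
Local Open Scope ring_scope.

(** * Noetherian rings *)

Lemma chain_le (T : Type) (I : nat -> T -> Prop) :
  (forall n x, I n x -> I n.+1 x) ->
  forall m n, (m <= n)%N -> forall x, I m x -> I n x.
Proof.
move=> incI m n /subnKC <-; elim: (n - m)%N => [|d IHd] x; first by rewrite addn0.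
by rewrite addnS => /IHd /incI.
Qed.

Lemma uniform_bound (P : nat -> nat -> Prop) (d : nat) :
  (forall i, (i < d)%N -> exists N, P i N) ->
  (forall i m n, (m <= n)%N -> P i m -> P i n) ->
  exists N, forall i, (i < d)%N -> P i N.
Proof.
move=> exN upP; elim: d exN => [|d IHd] exN; first by exists 0%N.
have [|N HN] := IHd; first by move=> i lid; apply: exN; apply: ltnW.
have [N' HN'] := exN d (ltnSn d).
exists (maxn N N') => i; rewrite ltnS leq_eqVlt => /predU1P[->|lid].
  exact: upP (leq_maxr _ _) HN'.
exact: upP (leq_maxl _ _) (HN i lid).
Qed.

Lemma is_left_idealN (R : pzRingType) (I : R -> Prop) x :
  is_left_ideal I -> I x -> I (- x).
Proof. by move=> [_ _ IM] Ix; rewrite -mulN1r; apply: IM. Qed.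

Lemma left_noetherian_converse (R : comPzRingType) :
  left_noetherian R -> left_noetherian R^c.
Proof.
move=> noethR I idI incI; apply: noethR incI => n.
by have [I0 ID IM] := idI n; split=> // a x Ix; rewrite mulrC; apply: IM.
Qed.

Lemma left_noetherian_surj (R S : nzRingType) (f : {rmorphism R -> S}) :
  (forall y, exists x, f x = y) -> left_noetherian R -> left_noetherian S.
Proof.
move=> surjf noethR I idI incI.
have [n|n x|N HN] := noethR (fun n x => I n (f x)).
- have [I0 ID IM] := idI n; split=> [|x y|a x]; first by rewrite rmorph0.
    by rewrite rmorphD; apply: ID.
  by rewrite rmorphM; apply: IM.
- exact: incI.
by exists N => n y leNn; have [x <-] := surjf y; apply: HN.
Qed.

Lemma left_noetherian_field (k : fieldType) : left_noetherian k.
Proof.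
move=> I idI incI.
have full n x : I n x -> x <> 0 -> forall y, I n y.
  move=> Ix /eqP nx0 y; have [_ _ IM] := idI n.
  by rewrite -[y](divfK nx0); apply: IM.
have [[N [x Ix nx0]]|no] := pselect (exists N, exists2 x, I N x & x <> 0).
  by exists N => n y _ _; apply: full Ix nx0 y.
exists 0%N => n x _ Ix; have [I0 _ _] := idI 0%N.
have [->//|/eqP nx0] := eqVneq x 0; by case: no; exists n, x.
Qed.

(* [lc n d] collects the leading coefficients in degree [d]; it grows with
   both [n] and [d], so its diagonal stabilises. *)
Theorem hilbert_basis (R : comNzRingType) :
  left_noetherian R -> left_noetherian {poly R}.
Proof.
move=> noethR I idI incI.
pose lc n d (a : R) := exists2 p, I n p & (size p <= d.+1)%N /\ p`_d = a.
have id_lc n d : is_left_ideal (lc n d).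
  have [I0 ID IM] := idI n; split.
  - by exists 0; rewrite // size_poly0 coef0.
  - move=> a b [p Ip [sp <-]] [q Iq [sq <-]]; exists (p + q); first exact: ID.
    rewrite coefD; split=> //; apply: leq_trans (size_polyD _ _) _.
    by rewrite geq_max sp sq.
  - move=> c a [p Ip [sp <-]]; exists (c%:P * p); first exact: IM.
    rewrite coefCM; split=> //; rewrite mul_polyC.
    exact: leq_trans (size_scale_leq _ _) sp.
have inc_n d n a : lc n d a -> lc n.+1 d a.
  by move=> [p /incI Ip Hp]; exists p.
have inc_d n d a : lc n d a -> lc n d.+1 a.
  have [_ _ IM] := idI n.
  move=> [p Ip [sp <-]]; exists ('X * p); first exact: IM.
  rewrite coefXM /=; split=> //; apply: leq_trans (size_polyMleq _ _) _.
  by rewrite size_polyX.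
have [N0 HN0] : exists N, forall n a, (N <= n)%N -> lc n n a -> lc N N a.
  by apply: noethR => // n a /inc_n /inc_d.
have [N1 HN1] : exists N1, forall d, (d < N0)%N ->
    forall n a, (N1 <= n)%N -> lc n d a -> lc N1 d a.
  apply: uniform_bound => [d _|d m n lemn HN r a lenr Hr].
    by apply: noethR => // n a; apply: inc_n.
  by apply: (chain_le (inc_n d) lemn); apply: HN Hr; apply: leq_trans lenr.
pose N := maxn N0 N1; exists N => n p leNn.
(* In degree at least [N0] the coefficient is pushed to the diagonal index [maxn n d], where
   stabilisation brings it back to [N0]; the finitely many lower degrees are covered by [N1]. *)
have Hlc d a : lc n d a -> lc N d a.
  case: (ltnP d N0) => [ltd|led] Ha.
    apply: (chain_le (inc_n d) (leq_maxr _ _)); apply: HN1 Ha => //.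
    exact: leq_trans (leq_maxr _ _) leNn.
  apply: (chain_le (inc_n d) (leq_maxl _ _)).
  apply: (chain_le (inc_d N0) led).
  apply: (HN0 (maxn n d)); first by rewrite leq_max led orbT.
  apply: (chain_le (inc_n _) (leq_maxl _ _)).
  exact: (chain_le (inc_d n) (leq_maxr _ _)).
have IN : forall q, I N q -> I n q by apply: (chain_le incI leNn).
have [ [I0 _ _] [_ ID _] ] := (idI N, idI N); have [_ IDn _] := idI n.
elim: {p}(size p) {-2}p (leqnn (size p)) => [|d IHd] p sp Ip.
  by move: sp; rewrite leqn0 size_poly_eq0 => /eqP ->.
have [|q Iq [sq eq_pq]] := Hlc d p`_d; first by exists p.
rewrite -[p](subrK q); apply: (ID) => //; apply: IHd; last first.
  by apply: IDn => //; apply: is_left_idealN (idI n) _; apply: IN.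
apply/leq_sizeP => j; rewrite leq_eqVlt => /predU1P[<-|ltdj].
  by rewrite coefB eq_pq subrr.
by rewrite coefB !nth_default ?subrr // (leq_trans _ ltdj).
Qed.

(** Surjectivity of this evaluation passes the noetherian property to one more variable;
    factoriality will also use that [muni] inverts it. *)
Lemma mmulti_surj (R : comNzRingType) n (q : {mpoly R[n.+1]}) :
  exists p : {poly {mpoly R[n]}}, (map_poly (@mwiden n R) p).['X_ord_max] = q.
Proof.
pose E p := (map_poly (@mwiden n R) p).['X_ord_max].
have ED p p' : E (p + p') = E p + E p' by rewrite /E rmorphD hornerD.
have EM p p' : E (p * p') = E p * E p' by rewrite /E rmorphM hornerM.
have EC c : E (c%:MP)%:P = c%:MP by rewrite /E map_polyC hornerC /= mwidenC.
suff [p] : exists p, E p = q by exists p.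
elim/mpolyind: q => [|c m q _ _ [p Hp]].
  by exists 0; rewrite /E rmorph0 horner0.
have [p' Hp'] : exists p, E p = 'X_[m].
  rewrite mpolyXE_id; elim/big_rec: _ => [|i x _ [p2 <-]].
    by exists 1; rewrite /E rmorph1 hornerC.
  suff [p1 <-] : exists p, E p = 'X_i.
    exists (p1 ^+ m i * p2); rewrite EM; congr (_ * _).
    elim: (m i) => [|j IHj]; first by rewrite /E rmorph1 hornerC.
    by rewrite !exprS EM IHj.
  have [j ->|->] := unliftP ord_max i.
    exists ('X_j)%:P; rewrite /E map_polyC hornerC /= mwidenX mnmwiden1.
    by congr 'X_ _; apply: val_inj; rewrite /= /bump leqNgt ltn_ord.
  by exists 'X; rewrite /E map_polyX hornerX.
exists ((c%:MP)%:P * p' + p).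
by rewrite ED EM EC Hp' Hp mul_mpolyC.
Qed.

Theorem left_noetherian_mpoly (k : fieldType) n : left_noetherian {mpoly k[n]}.
Proof.
elim: n => [|n IHn].
  have surj (q : {mpoly k[0]}) : exists x, @mpolyC 0 k x = q.
    by exists (q@_0%MM); rewrite -nvar0_mpolyC.
  apply: (@left_noetherian_surj k {mpoly k[0]} (@mpolyC 0 k)) => //.
  exact: left_noetherian_field.
have cmw : commr_rmorph (@mwiden n k) ('X_ord_max : {mpoly k[n.+1]}).
  by move=> x; apply: mulrC.
apply: (@left_noetherian_surj _ _ (horner_morph cmw)) (hilbert_basis IHn) => q.
exact: mmulti_surj.
Qed.

(** * Finite generation and ascending chains of subspaces *)

Definition lin_span (R : pzRingType) (s : seq R) (x : R) : Prop :=
  exists h : nat -> R, x = \sum_(i < size s) h i * s`_i.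

Lemma lin_span_cons (R : pzRingType) (s : seq R) y x :
  lin_span (y :: s) x <-> exists a z, lin_span s z /\ x = a * y + z.
Proof.
split=> [[h ->]|[a [z [[h ->] ->]]]].
  exists (h 0%N), (\sum_(i < size s) h i.+1 * s`_i); split; last by rewrite big_ord_recl.
  by exists (fun i => h i.+1).
exists (fun i => if i is j.+1 then h j else a); by rewrite big_ord_recl.
Qed.

Lemma is_left_ideal_span (R : pzRingType) (s : seq R) : is_left_ideal (lin_span s).
Proof.
split=> [|x y [h ->] [h' ->]|a x [h ->]].
- by exists (fun _ => 0); rewrite big1 // => i _; rewrite mul0r.
- exists (fun i => h i + h' i); rewrite -big_split; apply: eq_bigr => i _ /=.
  by rewrite mulrDl.
- exists (fun i => a * h i); rewrite big_distrr; apply: eq_bigr => i _ /=.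
  by rewrite mulrA.
Qed.

(** Otherwise choice would extend a list of elements of [X] forever, each new one outside the span
    of its predecessors. The generators are found in [X] itself, not merely in the ideal it
    generates. *)
Lemma noetherian_fg (R : pzRingType) (X : R -> Prop) : left_noetherian R ->
  exists2 s : seq R, (forall x, x \in s -> X x) & forall x, X x -> lin_span s x.
Proof.
move=> noethR; apply: contrapT => nofg.
have next (s : {s : seq R | forall x, x \in s -> X x}) :
    {x | X x /\ ~ lin_span (sval s) x}.
  apply: cid; case: s => s sX /=; apply: contrapT => H; apply: nofg.
  by exists s => // x Xx; apply: contrapT => Hx; apply: H; exists x.
have consX (s : {s : seq R | forall x, x \in s -> X x}) :
    forall x, x \in sval (next s) :: sval s -> X x.
  by move=> x; rewrite inE => /predU1P[->|]; [case: (svalP (next s))|apply: (svalP s)].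
have nilX x : x \in [::] -> X x by rewrite in_nil.
pose e n := iter n (fun s => exist _ _ (consX s)) (exist _ [::] nilX).
have [n|n x|N HN] := noethR (fun n => lin_span (sval (e n))).
- exact: is_left_ideal_span.
- by move=> Hx; apply/lin_span_cons; exists 0, x; rewrite mul0r add0r.
have [_ []] := svalP (next (e N)); apply: (HN N.+1) => //.
apply/lin_span_cons; exists 1, 0; rewrite mul1r addr0.
by have [] := is_left_ideal_span (sval (e N)).
Qed.

Definition is_subspace (k : fieldType) (V : lmodType k) (E : V -> Prop) : Prop :=
  E 0 /\ forall a x y, E x -> E y -> E (a *: x + y).

(** A subspace of maximal dimension among those contained in some [E n] absorbs every later vector,
    since adjoining one cannot raise the dimension. *)
Lemma subspace_acc (k : fieldType) (V : vectType k) (E : nat -> V -> Prop) :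
  (forall n, is_subspace (E n)) -> (forall n x, E n x -> E n.+1 x) ->
  exists N, forall n x, (N <= n)%N -> E n x -> E N x.
Proof.
move=> subE incE.
pose Q d := exists n, exists2 X : {vspace V}, \dim X = d & {in X, forall x, E n x}.
have Q0 : exists d, `[< Q d >].
  exists 0%N; apply/asboolP; exists 0%N, 0%VS; first by rewrite dimv0.
  by move=> x; rewrite memv0 => /eqP ->; have [] := subE 0%N.
have leQ d : `[< Q d >] -> (d <= \dim {:V})%N.
  by move=> /asboolP [n [X <- _]]; apply: dimvS; apply: subvf.
case: (ex_maxnP Q0 leQ) => d /asboolP [N [X dX EX]] maxd.
exists N => n x leNn Ex; apply: (EX).
have XxE : {in (X + <[x]>)%VS, forall y, E n y}.
  move=> y /memv_addP [u Xu [w /vlineP [a ->] ->]]; rewrite addrC.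
  by have [_] := subE n; apply => //; apply: (chain_le incE leNn) (EX u Xu).
have : (\dim (X + <[x]>) <= d)%N by apply: maxd; apply/asboolP; exists n, (X + <[x]>)%VS.
rewrite -dX => led; have /eqP -> : (X == X + <[x]>)%VS by rewrite eqEdim addvSl led.
exact: (subvP (addvSr _ _)) (memv_line x).
Qed.

(** * Factorial rings *)

Section Factorial.
Variable R : comNzRingType.
Implicit Types (x y p u : R) (s : seq R).

Definition divides x y := exists z, y = x * z.

Definition no_zero_div := forall x y, x * y = 0 -> x = 0 \/ y = 0.

Definition prime_elt p :=
  [/\ p <> 0, ~ is_unit p & forall x y, divides p (x * y) -> divides p x \/ divides p y].

Definition factored x :=
  exists u s, [/\ is_unit u, {in s, forall p, prime_elt p} & x = u * \prod_(p <- s) p].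

Definition factorial_ring := forall x, x <> 0 -> factored x.

Lemma divides_mulr x y z : divides x y -> divides x (y * z).
Proof. by move=> [w ->]; exists (w * z); rewrite mulrA. Qed.

Lemma divides_mull x y z : divides x y -> divides x (z * y).
Proof. by rewrite mulrC; apply: divides_mulr. Qed.

Lemma is_unit1 : is_unit (1 : R).
Proof. by exists 1; rewrite mulr1. Qed.

Lemma is_unitM x y : is_unit x -> is_unit y -> is_unit (x * y).
Proof. by move=> [x' Hx] [y' Hy]; exists (x' * y'); rewrite mulrACA Hx Hy mulr1. Qed.

Lemma is_unit_mull x y : is_unit (x * y) -> is_unit x.
Proof. by move=> [z Hz]; exists (y * z); rewrite mulrA. Qed.

Lemma is_unit_mulr x y : is_unit (x * y) -> is_unit y.
Proof. by rewrite mulrC; apply: is_unit_mull. Qed.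

Lemma factored_unit u : is_unit u -> factored u.
Proof. by move=> Uu; exists u, [::]; split=> //; rewrite big_nil mulr1. Qed.

Lemma factored_prime p : prime_elt p -> factored p.
Proof.
move=> Pp; exists 1, [:: p]; split; [exact: is_unit1| |by rewrite big_seq1 mul1r].
by move=> q; rewrite mem_seq1 => /eqP ->.
Qed.

Lemma factoredM x y : factored x -> factored y -> factored (x * y).
Proof.
move=> [u [s [Uu Ps ->]]] [u' [s' [Uu' Ps' ->]]]; exists (u * u'), (s ++ s').
split; first exact: is_unitM.
  by move=> p; rewrite mem_cat => /orP[/Ps|/Ps'].
by rewrite big_cat mulrACA.
Qed.

Lemma factored_prod s : {in s, forall p, factored p} -> factored (\prod_(p <- s) p).
Proof.
elim: s => [|p s IHs] Fs; first by rewrite big_nil; apply/factored_unit/is_unit1.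
rewrite big_cons; apply: factoredM; first by apply: Fs; rewrite mem_head.
by apply: IHs => q qs; apply: Fs; rewrite inE qs orbT.
Qed.

Lemma prime_divides_prod p s : prime_elt p -> divides p (\prod_(q <- s) q) ->
  exists2 q, q \in s & divides p q.
Proof.
move=> [p0 pU pP]; elim: s => [|q s IHs].
  by rewrite big_nil => -[z Hz]; case: pU; exists z.
rewrite big_cons => /pP[pq|/IHs[r rs pr]]; first by exists q; rewrite ?mem_head.
by exists r; rewrite // inE rs orbT.
Qed.

Hypothesis domR : no_zero_div.

Lemma mulI_dom x y z : x <> 0 -> x * y = x * z -> y = z.
Proof.
move=> x0 /eqP; rewrite -subr_eq0 -mulrBr => /eqP /domR[//|/eqP].
by rewrite subr_eq0 => /eqP.
Qed.

Lemma mul_neq0 x y : x <> 0 -> y <> 0 -> x * y <> 0.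
Proof. by move=> x0 y0 /domR[]. Qed.

Lemma prod_prime_neq0 s : {in s, forall p, prime_elt p} -> \prod_(p <- s) p <> 0.
Proof.
elim: s => [|p s IHs] Ps; first by rewrite big_nil; apply/eqP/oner_neq0.
rewrite big_cons; apply: mul_neq0; first by case: (Ps p (mem_head _ _)).
by apply: IHs => q qs; apply: Ps; rewrite inE qs orbT.
Qed.

Lemma prime_irreducible p : prime_elt p -> irreducible p.
Proof.
move=> [p0 pU pP]; split=> // x y def_p.
have H x' y' : p = x' * y' -> divides p x' -> is_unit y'.
  move=> def_p' [z def_x']; exists z; apply: (mulI_dom p0).
  by rewrite mulr1 {2}def_p' def_x' -!mulrA [y' * z]mulrC.
have [||] := pP x y; first by exists 1; rewrite mulr1.
  by move/(H x y def_p); right.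
by rewrite mulrC in def_p; move/(H y x def_p); left.
Qed.

Lemma prime_associated p u : is_unit u -> prime_elt p -> prime_elt (u * p).
Proof.
move=> [v uv] [p0 pU pP]; have vup : v * (u * p) = p by rewrite mulrA [v * u]mulrC uv mul1r.
split=> [up0|/is_unit_mulr //|x y [z def_xy]].
  by apply: p0; rewrite -vup up0 mulr0.
have H x' : divides p x' -> divides (u * p) x'.
  by move=> [w ->]; exists (v * w); rewrite mulrACA uv mul1r.
by have [|/H|/H] := pP x y; [exists (u * z); rewrite def_xy mulrCA mulrA|left|right].
Qed.

(** Each prime of the list divides [x] or [y] and is cancelled there, until only a unit is left. *)
Lemma factored_divides x y s u : is_unit u -> {in s, forall p, prime_elt p} ->
  x * y = u * \prod_(p <- s) p -> factored x.
Proof.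
move=> Uu; elim: s x y => [|p s IHs] x y Ps.
  rewrite big_nil mulr1 => def_u; rewrite -def_u in Uu.
  exact/factored_unit/(is_unit_mull Uu).
have Ps' : {in s, forall q, prime_elt q} by move=> q qs; apply: Ps; rewrite inE qs orbT.
have Pp := Ps p (mem_head _ _); have [p0 _ pP] := Pp.
rewrite big_cons mulrCA => def_xy.
have [|[x' def_x]|[y' def_y]] := pP x y; first by exists (u * \prod_(q <- s) q).
  rewrite def_x; apply: factoredM; first exact: factored_prime.
  by apply: (IHs _ y) => //; apply: (mulI_dom p0); rewrite mulrA -def_x.
by apply: (IHs _ y') => //; apply: (mulI_dom p0); rewrite mulrCA -def_y.
Qed.

Lemma factored_divisor x y : factored (x * y) -> factored x.
Proof. by move=> [u [s [Uu Ps]]]; apply: factored_divides. Qed.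

Lemma cancel_prime_divides x y s : {in s, forall p, prime_elt p /\ ~ divides p y} ->
  divides y ((\prod_(p <- s) p) * x) -> divides y x.
Proof.
elim: s x => [|p s IHs] x Ps; first by rewrite big_nil mul1r.
rewrite big_cons -mulrA => -[z def_x].
have [[p0 _ pP] npy] := Ps p (mem_head _ _).
apply: IHs => [q qs|]; first by apply: Ps; rewrite inE qs orbT.
have [|//|[w def_z]] := pP y z; first by exists ((\prod_(q <- s) q) * x).
by exists w; apply: (mulI_dom p0); rewrite def_x def_z mulrCA.
Qed.

(** The unit [u] carries the induction: matching a prime on the left with one on the right leaves a
    unit quotient, which is absorbed into [u]. *)
Lemma prime_factorization_uniq s s' u :
  {in s, forall p, prime_elt p} -> {in s', forall p, prime_elt p} -> is_unit u ->
  \prod_(p <- s) p = u * \prod_(p <- s') p ->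
  exists s'', [/\ perm_eq s'' s', size s = size s''
    & forall i, (i < size s)%N -> associated s`_i s''`_i].
Proof.
elim: s s' u => [|p s IHs] s' u Ps Ps' Uu.
  case: s' Ps' => [|q s'] Ps'; first by exists [::].
  rewrite big_nil big_cons mulrCA => E; have [_ []] := Ps' q (mem_head _ _).
  by exists (u * \prod_(r <- s') r).
have Pp := Ps p (mem_head _ _); have [p0 pU pP] := Pp.
rewrite big_cons => def_s.
have [|[z def_u]|] := pP u (\prod_(r <- s') r).
- by exists (\prod_(r <- s) r).
- by case: pU; rewrite def_u in Uu; apply: is_unit_mull Uu.
move=> /(prime_divides_prod Pp)[q qs' [d def_q]].
have Pq := Ps' q qs'; have [_ _ /(_ _ _ def_q)[//|Ud]] := prime_irreducible Pq.
rewrite (perm_big _ (perm_to_rem qs')) big_cons /= in def_s.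
have [||||s'' [perm_s'' size_s'' ass]] := IHs (rem q s') (u * d).
- by move=> r rs; apply: Ps; rewrite inE rs orbT.
- by move=> r /mem_rem; apply: Ps'.
- exact: is_unitM.
- by apply: (mulI_dom p0); rewrite def_s {1}def_q !mulrA [p * u]mulrC.
exists (q :: s''); split; rewrite /= ?size_s'' //.
  by apply: (@perm_trans _ (q :: rem q s')); rewrite ?perm_cons // perm_sym perm_to_rem.
case=> [|i] lti /=; last by apply: ass; rewrite size_s''.
have [e de] := Ud; exists e; first by exists d; rewrite mulrC.
by rewrite def_q mulrCA [e * d]mulrC de mulr1.
Qed.

Lemma factorial_UFD : factorial_ring -> is_UFD R.
Proof.
move=> facR.
have irrP x : irreducible x -> prime_elt x.
  move=> [x0 xU xI]; have [u [[|p s] [Uu Ps def_x]]] := facR x x0.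
    by case: xU; rewrite def_x big_nil mulr1.
  have Pp := Ps p (mem_head _ _); have [_ pU _] := Pp.
  rewrite big_cons mulrCA mulrC in def_x.
  by have [Uv|//] := xI _ _ def_x; rewrite def_x; apply: prime_associated.
split=> [//|x x0 xU|s s' Is Is' E].
  have [u [[|p s] [Uu Ps def_x]]] := facR x x0.
    by case: xU; rewrite def_x big_nil mulr1.
  exists (u * p :: s); last by rewrite def_x !big_cons mulrA.
  move=> q; rewrite inE => /predU1P[->|qs]; apply: prime_irreducible.
    by apply: prime_associated => //; apply: Ps; rewrite mem_head.
  by apply: Ps; rewrite inE qs orbT.
apply: (@prime_factorization_uniq s s' 1) => [p /Is|p /Is'||]; try exact: irrP.
  exact: is_unit1.
by rewrite mul1r.
Qed.

(** Dividing out elements of [S] must stop: the principal ideals of the successive quotients ascend,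
    and where they stabilise some element of [S] would be a unit. *)
Lemma noetherian_extract (S : R -> Prop) x : left_noetherian R ->
  (forall p, S p -> ~ is_unit p) -> x <> 0 ->
  exists s y, [/\ {in s, forall p, S p}, x = (\prod_(p <- s) p) * y
    & forall p, S p -> ~ divides p y].
Proof.
move=> noethR SU x0; apply: contrapT => bad_x.
pose bad y := y <> 0 /\ ~ exists s z, [/\ {in s, forall p, S p},
  y = (\prod_(p <- s) p) * z & forall p, S p -> ~ divides p z].
have next (y : {y | bad y}) : {z : {z | bad z} | exists2 p, S p & sval y = p * sval z}.
  apply: cid; case: y => y [y0 bad_y] /=; apply: contrapT => no_z; apply: (bad_y).
  exists [::], y; split=> //; first by rewrite big_nil mul1r.
  move=> p Sp [z def_y]; apply: no_z.
  have bad_z : bad z.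
    split=> [z0|[s [w [Ss def_z Sw]]]]; first by apply: y0; rewrite def_y z0 mulr0.
    apply: (bad_y); exists (p :: s), w; split=> //.
      by move=> q; rewrite inE => /predU1P[->|/Ss].
    by rewrite big_cons -mulrA -def_z.
  by exists (exist _ z bad_z), p.
pose e n := iter n (fun w => sval (next w)) (exist bad x (conj x0 bad_x)).
have eS n : exists2 p, S p & sval (e n) = p * sval (e n.+1) := svalP (next (e n)).
have [n|n y|N HN] := noethR (fun n y => divides (sval (e n)) y).
- split=> [|y z [a ->] [b ->]|a y [b ->]].
  + by exists 0; rewrite mulr0.
  + by exists (a + b); rewrite mulrDr.
  + by exists (a * b); rewrite mulrCA.
- by move=> [a ->]; have [p _ ->] := eS n; exists (p * a); rewrite -mulrA mulrCA.
have [p Sp def_eN] := eS N; apply: (SU p Sp).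
have [|a def_eSN] := HN N.+1 (sval (e N.+1)) (leqnSn N); first by exists 1; rewrite mulr1.
have [eSN0 _] := svalP (e N.+1).
by exists a; apply: (mulI_dom eSN0); rewrite mulr1 {2}def_eSN def_eN mulrA [p * _]mulrC.
Qed.

End Factorial.

(* Nagata's lemma in a symmetric form: [A] and [B] become equal in [F] once [S] is
   inverted.  It applies to [R[x]] inside [K[x]] and to the blowup over [k[y_1, ..., y_t]]. *)
Section Nagata.
Variables (A B F : comNzRingType) (f : {rmorphism A -> F}) (g : {rmorphism B -> F}).
Variable S : B -> Prop.
Hypotheses (domF : no_zero_div F) (f_inj : injective f) (g_inj : injective g).
Hypothesis S_prime : forall s, S s -> prime_elt s.
Hypothesis S_in_A : forall s, S s ->
  exists2 s', f s' = g s & is_unit s' \/ prime_elt s'.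
Hypothesis A_to_B : forall a, exists (l : seq B) b,
  {in l, forall s, S s} /\ g (\prod_(s <- l) s) * f a = g b.
Hypothesis B_to_A : forall b, exists (l : seq B) a,
  {in l, forall s, S s} /\ g (\prod_(s <- l) s) * g b = f a.
Hypothesis S_extract : forall b, b <> 0 -> exists (l : seq B) b',
  [/\ {in l, forall s, S s}, b = (\prod_(s <- l) s) * b' & forall s, S s -> ~ divides s b'].
Hypothesis facA : factorial_ring A.

Let domB : no_zero_div B.
Proof.
by move=> x y /(congr1 g); rewrite rmorphM rmorph0 => /domF[]; rewrite -(rmorph0 g) => /g_inj; auto.
Qed.

Let prodS_A (l : seq B) : {in l, forall s, S s} -> exists2 l' : seq A,
  f (\prod_(s <- l') s) = g (\prod_(s <- l) s)
  & {in l', forall s', exists2 s, S s & f s' = g s /\ (is_unit s' \/ prime_elt s')}.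
Proof.
elim: l => [|s l IHl] Sl; first by exists [::]; rewrite ?big_nil ?rmorph1.
have [|l' El' Pl'] := IHl; first by move=> x xl; apply: Sl; rewrite inE xl orbT.
have Ss := Sl s (mem_head _ _); have [s' Es' Ps'] := S_in_A Ss.
exists (s' :: l'); first by rewrite !big_cons !rmorphM Es' El'.
by move=> x; rewrite inE => /predU1P[->|/Pl'//]; exists s.
Qed.

Let prodS_factored (l : seq B) : {in l, forall s, S s} -> factored (\prod_(s <- l) s).
Proof. by move=> Sl; apply: factored_prod => s /Sl/S_prime/factored_prime. Qed.

(** This property is multiplicative, so a prime factorisation in [A] reduces it to units and primes
    of [A]. *)
Definition nagata_good (a : A) := exists (l : seq B) b,
  [/\ {in l, forall s, S s}, factored b & g (\prod_(s <- l) s) * f a = g b].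

Let good_mul a a' : nagata_good a -> nagata_good a' -> nagata_good (a * a').
Proof.
move=> [l [b [Sl Fb Eb]]] [l' [b' [Sl' Fb' Eb']]]; exists (l ++ l'), (b * b').
split; [by move=> s; rewrite mem_cat => /orP[/Sl|/Sl']|exact: factoredM|].
by rewrite big_cat !rmorphM -Eb -Eb' mulrACA.
Qed.

(** Clearing denominators in both factors makes [b * b'] a product of elements of [S], so [b]
    divides a product of primes. This treats the units, and the primes of [A] that divide a
    counterpart of an element of [S]. *)
Let good_divisor a a' l : {in l, forall s, S s} ->
  f (a * a') = g (\prod_(s <- l) s) -> nagata_good a.
Proof.
move=> Sl E; have [la [b [Sla Eb]]] := A_to_B a; have [la' [b' [Sla' Eb']]] := A_to_B a'.
exists la, b; split=> //; apply: (factored_divisor domB (y := b')).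
have -> : b * b' = (\prod_(s <- la) s * \prod_(s <- la') s) * \prod_(s <- l) s.
  by apply: g_inj; rewrite !rmorphM -Eb -Eb' mulrACA -E rmorphM.
by do 2?[apply: factoredM]; apply: prodS_factored.
Qed.

Let good_unit u : is_unit u -> nagata_good u.
Proof.
move=> [v uv]; apply: (@good_divisor u v [::]) => //.
by rewrite uv big_nil !rmorph1.
Qed.

Let good_prime q : prime_elt q -> nagata_good q.
Proof.
move=> Pq; have [q0 qU qP] := Pq.
have [[s Ss [s' Es' [v def_s']]]|nq] :=
    pselect (exists2 s, S s & exists2 s', f s' = g s & divides q s').
  apply: (@good_divisor q v [:: s]); first by move=> x; rewrite mem_seq1 => /eqP ->.
  by rewrite big_seq1 -Es' def_s'.
have nq_prod (l : seq B) (l' : seq A) : {in l', forall s', exists2 s, S s &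
    f s' = g s /\ (is_unit s' \/ prime_elt s')} -> ~ divides q (\prod_(s <- l') s).
  move=> Pl' /(prime_divides_prod Pq)[s' /Pl'[s Ss [Es' _]] qs'].
  by apply: nq; exists s => //; exists s'.
have [l [y [Sl Ey]]] := A_to_B q.
have y0 : y <> 0.
  move=> y0; move: Ey; rewrite y0 rmorph0 => /domF[|] E.
    apply: (prod_prime_neq0 domB (s := l)); first by move=> s /Sl/S_prime.
    by apply: g_inj; rewrite E rmorph0.
  by apply: q0; apply: f_inj; rewrite E rmorph0.
(* Freed of its factors from [S], [y1] is a unit or prime: a relation [x * z = y1 * w] is carried to
   [A], where [q] is prime, and the result is brought back. *)
have [l1 [y1 [Sl1 def_y Sy1]]] := S_extract y0.
exists l, y; split=> //; rewrite def_y; apply: factoredM; first exact: prodS_factored.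
have [Uy1|nUy1] := pselect (is_unit y1); first exact: factored_unit.
apply: factored_prime; split=> // [y10|x z [w def_xz]].
  by apply: y0; rewrite def_y y10 mulr0.
have [lx [ax [Slx Ex]]] := B_to_A x; have [lz [az [Slz Ez]]] := B_to_A z.
have [lw [aw [Slw Ew]]] := B_to_A w.
have [l' El' Pl'] := prodS_A Sl; have [l1' El1' Pl1'] := prodS_A Sl1.
have [lx' Elx' Plx'] := prodS_A Slx; have [lz' Elz' Plz'] := prodS_A Slz.
have [lw' Elw' Plw'] := prodS_A Slw.
have E : (\prod_(s <- l1') s * \prod_(s <- lw') s) * (ax * az) =
    q * (\prod_(s <- l') s * \prod_(s <- lx') s * \prod_(s <- lz') s * aw).
  apply: f_inj; rewrite !rmorphM El1' Elw' El' Elx' Elz' -Ex -Ez -Ew.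
  have Exz : g x * g z = g y1 * g w by rewrite -!rmorphM def_xz.
  have Ey1 : g (\prod_(s <- l1) s) * g y1 = g (\prod_(s <- l) s) * f q.
    by rewrite -rmorphM -def_y -Ey.
  move: Exz Ey1; move: (g (\prod_(s <- l) s)) (g (\prod_(s <- l1) s)).
  move: (g (\prod_(s <- lx) s)) (g (\prod_(s <- lz) s)) (g (\prod_(s <- lw) s)).
  move: (g x) (g z) (g w) (g y1) (f q) => X Z W Y Q Px Pz Pw P P1 E1 E2.
  have -> : P1 * Pw * (Px * X * (Pz * Z)) = P1 * Pw * Px * Pz * (X * Z) by ring.
  rewrite E1; have -> : P1 * Pw * Px * Pz * (Y * W) = (P1 * Y) * (Pw * Px * Pz * W) by ring.
  by rewrite E2; ring.
(* Divisibility by [q] gives divisibility by [y1] up to factors from [S]; these are primes not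
   dividing [y1], so they cancel. *)
have H (lc : seq B) (c : B) (ac : A) : {in lc, forall s, S s} ->
    g (\prod_(s <- lc) s) * g c = f ac -> divides q ac -> divides y1 c.
  move=> Slc Ec [r def_ac]; have [lr [yr [Slr Er]]] := A_to_B r.
  apply: (cancel_prime_divides domB (s := l ++ lr ++ lc)).
    by move=> s; rewrite !mem_cat => /or3P[/Sl|/Slr|/Slc] Ss;
      (split; [apply: S_prime|apply: Sy1]).
  exists (\prod_(s <- l1) s * yr); apply: g_inj.
  rewrite !big_cat !rmorphM.
  have Ey1 : g (\prod_(s <- l1) s) * g y1 = g (\prod_(s <- l) s) * f q.
    by rewrite -rmorphM -def_y -Ey.
  move: Ey1 Ec Er; rewrite def_ac rmorphM.
  move: (g (\prod_(s <- l) s)) (g (\prod_(s <- l1) s)) (g (\prod_(s <- lr) s)).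
  move: (g (\prod_(s <- lc) s)) (f q) (f r) (g y1) (g c) (g yr).
  move=> Pc Q T Y C Z P P1 Pr E2 E3 <-.
  have -> : P * (Pr * Pc) * C = P * Pr * (Pc * C) by ring.
  rewrite E3; have -> : Y * (P1 * (Pr * T)) = (P1 * Y) * (Pr * T) by ring.
  by rewrite E2; ring.
have : divides q ((\prod_(s <- l1') s * \prod_(s <- lw') s) * (ax * az)).
  by rewrite E; eexists.
move=> /qP[/qP[]|/qP[]].
- by move/(nq_prod l1).
- by move/(nq_prod lw).
- by left; apply: (H lx x ax).
- by right; apply: (H lz z az).
Qed.

Theorem nagata : factorial_ring B.
Proof.
move=> b b0; have [l [a [Sl Ea]]] := B_to_A b.
have a0 : a <> 0.
  move=> a0; move: Ea; rewrite a0 rmorph0 => /domF[] E.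
    apply: (prod_prime_neq0 domB (s := l)); first by move=> s /Sl/S_prime.
    by apply: g_inj; rewrite E rmorph0.
  by apply: b0; apply: g_inj; rewrite E rmorph0.
have [u [s [Uu Ps def_a]]] := facA a0.
have [l' [y [Sl' Fy Ey]]] : nagata_good a.
  rewrite def_a; apply: good_mul; first exact: good_unit.
  elim: s Ps {def_a} => [|q s IHs] Ps; first by rewrite big_nil; apply/good_unit/is_unit1.
  rewrite big_cons; apply: good_mul; first by apply: good_prime; apply: Ps; rewrite mem_head.
  by apply: IHs => x xs; apply: Ps; rewrite inE xs orbT.
apply: (factored_divisor domB (y := \prod_(s <- l') s * \prod_(s <- l) s)).
suff -> : b * (\prod_(s <- l') s * \prod_(s <- l) s) = y by [].
by apply: g_inj; rewrite !rmorphM -Ey -Ea; ring.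
Qed.

End Nagata.

(** * Factoriality of polynomial rings *)

Lemma no_zero_div_idomain (R : idomainType) : no_zero_div R.
Proof. by move=> x y /eqP; rewrite mulf_eq0 => /orP[]/eqP; auto. Qed.

Lemma dividesP_poly (K : fieldType) (p q : {poly K}) : divides p q <-> p %| q.
Proof.
split=> [[r ->]|/dvdpP[r ->]]; first by rewrite dvdp_mulr.
by exists r; rewrite mulrC.
Qed.

Lemma factorial_poly_field (K : fieldType) : factorial_ring {poly K}.
Proof.
move=> p; move: {2}(size p) (leqnn (size p)) => n; elim: n p => [|n IHn] p sp /eqP p0.
  by move: p0; rewrite -size_poly_eq0 -leqn0 sp.
case: (leqP (size p) 1) => [sp1|sp1].
  apply: factored_unit; exists (p`_0)^-1%:P.
  rewrite {1}[p]size1_polyC // -polyCM mulfV //.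
  by apply: contra p0 => /eqP p00; rewrite [p]size1_polyC // p00.
have [[_ irrp]|nirr] := pselect (irreducible_poly p).
  apply: factored_prime; split; first exact/eqP.
    move=> [q pq1]; have /(congr1 (fun x : {poly K} => size x)) := pq1.
    have q0 : q != 0 by apply/eqP => q0; move/eqP: pq1; rewrite q0 mulr0 eq_sym oner_eq0.
    rewrite size_mul // size_poly1; move: sp1 q0; rewrite -size_poly_gt0.
    by case: (size p) => [|[|m]] //; case: (size q) => // m' _ _; rewrite addSn addnS.
  move=> x y /dividesP_poly pxy.
  have [co|nco] := boolP (coprimep p x).
    by right; apply/dividesP_poly; rewrite -(Gauss_dvdpr _ co).
  left; apply/dividesP_poly; have /eqp_dvdl <- := irrp _ nco (dvdp_gcdl p x).
  exact: dvdp_gcdr.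
have [q [sq1 qp nqp]] : exists q : {poly K}, [/\ size q != 1%N, q %| p & ~~ (q %= p)].
  apply: contrapT => H; apply: nirr; split=> // q sq qp.
  by apply: contrapT => nqp; apply: H; exists q; split=> //; apply/negP.
have /dvdpP[r def_p] := qp.
have [r0 q0] : r != 0 /\ q != 0.
  by apply/andP; rewrite -negb_or -mulf_eq0 -def_p.
have sE : size p = (size r + size q).-1 by rewrite def_p size_mul.
have sr1 : size r != 1%N.
  apply: contra nqp => /size_poly1P[c c0 def_r].
  by rewrite def_p def_r mul_polyC eqp_sym eqp_scale.
have [sr0 sq0] : (0 < size r)%N /\ (0 < size q)%N by rewrite !size_poly_gt0.
rewrite def_p; apply: factoredM; apply: IHn; try exact/eqP.
  rewrite -ltnS; apply: leq_trans sp; rewrite sE.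
  case: (size q) sq1 sq0 => [|[|m]] // _ _; rewrite !addnS ltnS leq_addr //.
rewrite -ltnS; apply: leq_trans sp; rewrite sE.
by case: (size r) sr1 sr0 => [|[|m]] // _ _; rewrite !addSn ltnS leq_addl.
Qed.

Lemma fracP (R : idomainType) (x : {fraction R}) :
  exists n d : R, d != 0 /\ x * tofrac d = tofrac n.
Proof.
elim/quotW: x => r; exists (\n_r), (\d_r); split; first exact: denom_ratioP.
unlock FracField.tofrac; rewrite -[LHS]FracField.pi_mul; apply/eqmodP.
rewrite /= FracField.equivfE /FracField.mulf.
by rewrite !numden_Ratio ?mulf_neq0 ?oner_neq0 ?denom_ratioP // !mulr1 mulrC.
Qed.

Section Gauss.
Variables (R : idomainType) (noethR : left_noetherian R) (facR : factorial_ring R).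

Local Notation K := {fraction R}.
Local Notation frac := (map_poly (@tofrac R)).

Lemma divides_polyC (c : R) (p : {poly R}) :
  divides c%:P p <-> forall i, divides c p`_i.
Proof.
split=> [[q ->] i|H]; first by exists q`_i; rewrite coefCM.
have /choice[q Hq] : forall i, exists z, p`_i = c * z by [].
exists (\poly_(i < size p) q i); apply/polyP => i; rewrite coefCM coef_poly.
by case: ltnP => [_|le]; [apply: Hq|rewrite mulr0 nth_default].
Qed.

(** Gauss's argument: let [i] and [j] be the least indices of coefficients of [p] and [q] not
    divisible by [c]. In the coefficient of index [i + j] of the product all other terms are
    divisible by [c], which contradicts primality of [c]. *)
Lemma prime_polyC (c : R) : prime_elt c -> prime_elt c%:P.
Proof.
move=> [c0 cU cP]; split=> [/eqP|[q /(congr1 (fun r : {poly R} => r`_0))]|p q].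
- by rewrite polyC_eq0 => /eqP.
- by rewrite coefCM coefC => E; apply: cU; exists q`_0.
apply: contraPP => /not_orP[np nq] /divides_polyC pq.
have exi (r : {poly R}) : ~ divides c%:P r -> exists i, ~~ `[< divides c r`_i >].
  move=> nr; apply: contrapT => H; apply: nr; apply/divides_polyC => i.
  by apply: contrapT => Hi; apply: H; exists i; apply/asboolP.
case: (ex_minnP (exi _ np)) => i /asboolP npi mini.
case: (ex_minnP (exi _ nq)) => j /asboolP nqj minj.
have dvdi a : (a < i)%N -> divides c p`_a.
  by move=> lai; apply: contrapT => Ha; have := mini _ (introN (asboolP _) Ha); rewrite leqNgt lai.
have dvdj a : (a < j)%N -> divides c q`_a.
  by move=> laj; apply: contrapT => Ha; have := minj _ (introN (asboolP _) Ha); rewrite leqNgt laj.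
have lti : (i < (i + j).+1)%N by rewrite ltnS leq_addr.
have := pq (i + j)%N; rewrite coefM (bigD1 (Ordinal lti)) //= addKn.
set X := \sum_(a | _) _; move=> dvdX.
have [z defX] : divides c X.
  apply: (big_ind (divides c)) => [|x y [x' ->] [y' ->]|a nai].
  - by exists 0; rewrite mulr0.
  - by exists (x' + y'); rewrite mulrDr.
  - have [lta|lta|ea] := ltngtP a i; last by case/eqP: nai; apply: val_inj.
      exact/divides_mulr/dvdi.
    apply/divides_mull/dvdj; rewrite ltn_subLR; last by rewrite -ltnS ltn_ord.
    by rewrite ltn_add2r.
have [|//|//] := cP p`_i q`_j.
have [w def_w] := dvdX; exists (w - z); rewrite mulrBr -def_w defX.
by rewrite addrK.
Qed.

Theorem gauss : factorial_ring {poly R}.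
Proof.
pose S (b : {poly R}) := exists2 c, prime_elt c & b = c%:P.
have frac_inj : injective frac.
  by apply: map_inj_poly => [x y /eqP|]; rewrite ?tofrac_eq ?tofrac0 // => /eqP.
have domRx := @no_zero_div_idomain {poly R}.
have SP b : S b -> prime_elt b by move=> [c Pc ->]; apply: prime_polyC.
(* Here [A] and [F] are both [K[x]], and [S] consists of the prime constants of [R], which become
   units over [K]. *)
apply: (@nagata {poly K} {poly R} {poly K} idfun frac S) => //.
- exact: no_zero_div_idomain.
- move=> s [c [c0 _ _] ->]; exists (tofrac c)%:P; first by rewrite /= map_polyC.
  left; exists (tofrac c)^-1%:P; rewrite -polyCM mulfV // tofrac_eq0.
  exact/eqP.
- have clear a : exists d b, d <> 0 /\ (tofrac d)%:P * a = frac b.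
    elim/poly_ind: a => [|p x [d [b [d0 Eb]]]].
      by exists 1, 0; rewrite mulr0 rmorph0; split=> //; apply/eqP/oner_neq0.
    have [n [e [e0 Ee]]] := fracP x.
    exists (d * e), (e%:P * b * 'X + (d * n)%:P); split.
      by apply/eqP; rewrite mulf_neq0 //; apply/eqP.
    have En : (tofrac n)%:P = x%:P * (tofrac e)%:P by rewrite -polyCM Ee.
    by rewrite !(rmorphD, rmorphM) /= map_polyX !map_polyC /= -Eb En; ring.
  move=> a; have [d [b [d0 Eb]]] := clear a.
  have [u [s [[v uv] Ps def_d]]] := facR d0.
  exists [seq c%:P | c <- s], (v%:P * b); split.
    by move=> _ /mapP[c cs ->]; exists c => //; apply: Ps.
  rewrite rmorphM /= -Eb map_polyC big_map -rmorph_prod map_polyC /= mulrA -polyCM -tofracM.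
  by rewrite def_d mulrA [v * u]mulrC uv mul1r.
- by move=> b; exists [::], (frac b); rewrite big_nil rmorph1 mul1r.
- move=> b b0; apply: noetherian_extract => //; first exact: hilbert_basis.
  by move=> p /SP[].
- exact: factorial_poly_field.
Qed.

End Gauss.

(** Nagata's lemma with [S] empty. *)
Lemma factorial_iso (R S : comNzRingType) (h : {rmorphism R -> S}) :
  no_zero_div S -> injective h -> (forall y, exists x, h x = y) ->
  factorial_ring R -> factorial_ring S.
Proof.
move=> domS injh surjh facR.
apply: (@nagata R S S h idfun (fun _ => False)) => //.
- by move=> a; exists [::], (h a); rewrite big_nil rmorph1 mul1r.
- by move=> b; have [a <-] := surjh b; exists [::], a; rewrite big_nil rmorph1 mul1r.
- by move=> b _; exists [::], b; rewrite big_nil mul1r.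
Qed.

Lemma mpoly_rmorph_ext (R S : comNzRingType) n (f g : {rmorphism {mpoly R[n]} -> S}) :
  (forall c, f c%:MP = g c%:MP) -> (forall i, f 'X_i = g 'X_i) -> f =1 g.
Proof.
move=> eqC eqX p; rewrite [p]mpolyE !rmorph_sum; apply: eq_bigr => m _ /=.
rewrite -mul_mpolyC mpolyXE_id !rmorphM !rmorph_prod /= eqC; congr (_ * _).
by apply: eq_bigr => i _; rewrite !rmorphXn /= eqX.
Qed.

Lemma muni_widen (R : comNzRingType) n (p : {mpoly R[n]}) : muni (mwiden p) = p%:P.
Proof.
apply: (@mpoly_rmorph_ext _ _ _ (@muni n R \o @mwiden n R) polyC) => [c|i] /=.
  by rewrite mwidenC muniC.
rewrite mwidenX mnmwiden1 /muni mmapX mmap1U; case: splitP => [j eqj|j].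
  by congr ('X_ _)%:P; apply: val_inj; rewrite /= -eqj.
by rewrite ord1 /= addn0 => /eqP; rewrite ltn_eqF.
Qed.

Lemma muniX_max (R : comNzRingType) n : muni ('X_ord_max : {mpoly R[n.+1]}) = 'X.
Proof.
rewrite /muni mmapX mmap1U; case: splitP => // j /= eqj.
by have := ltn_ord j; rewrite -eqj ltnn.
Qed.

Theorem factorial_mpoly (k : fieldType) n : factorial_ring {mpoly k[n]}.
Proof.
elim: n => [|n IHn].
  move=> p p0; apply: factored_unit; exists (p@_0%MM)^-1%:MP.
  rewrite {1}[p]nvar0_mpolyC -mpolyCM mulfV //.
  by apply/eqP => E; apply: p0; rewrite [p]nvar0_mpolyC E.
have cmw : commr_rmorph (@mwiden n k) ('X_ord_max : {mpoly k[n.+1]}).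
  by move=> x; apply: mulrC.
apply: (@factorial_iso _ _ (horner_morph cmw)); last first.
- by apply: gauss IHn; apply: left_noetherian_mpoly.
- exact: mmulti_surj.
- apply: (can_inj (g := @muni n k)); elim/poly_ind => [|p c IHp].
    by rewrite !rmorph0.
  rewrite !rmorphD !rmorphM /= IHp horner_morphX muniX_max horner_morphC.
  by rewrite muni_widen.
- exact: no_zero_div_idomain.
Qed.

(** * Forms and points *)

Lemma closed_field_avoid (k : closedFieldType) (s : seq k) : exists x, x \notin s.
Proof.
(* The factor ['X] keeps the polynomial nonconstant when [s] is empty; at every element of [s] the
   value is 1, so a root lies outside [s]. *)
have : size (\prod_(a <- s) ('X - a%:P) * 'X + 1) != 1%N.
  rewrite -cons_poly_def size_cons_poly; set p := \prod_(a <- s) _.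
  have -> : nilp p = false.
    by apply/negbTE; rewrite nil_poly monic_neq0 // monic_prod_XsubC.
  by rewrite andFb /= eqSS size_poly_eq0 monic_neq0 // monic_prod_XsubC.
move/closed_rootP => [x rx]; exists x; apply/negP => xs; move: rx.
rewrite rootE hornerD hornerMX hornerC.
have /eqP -> : (\prod_(a <- s) ('X - a%:P)).[x] == 0 by rewrite -rootE root_prod_XsubC.
by rewrite mul0r add0r oner_eq0.
Qed.

Lemma pihomog_mulr (k : fieldType) n m e (h f : {mpoly k[n]}) : f \is e.-homog ->
  pihomog mdeg m (h * f) = if (e <= m)%N then pihomog mdeg (m - e) h * f else 0.
Proof.
move=> fh; move: h; apply: twist_ind => [|g g' Hg Hg'|d g gh].
- by rewrite mul0r !pihomog0; case: ifP; rewrite ?mul0r.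
- by rewrite mulrDl !pihomogD Hg Hg'; case: ifP; rewrite ?addr0 // mulrDl.
have gfh := dhomogM gh fh.
have [Em|ne] := eqVneq (d + e)%N m.
  by rewrite -Em leq_addl addnK !pihomog_dE.
rewrite (@pihomog_ne0 _ _ _ (d + e)%N m) //; case: ifP => // le.
rewrite (@pihomog_ne0 _ _ _ d (m - e)%N) ?mul0r //.
by apply: contraNneq ne => ->; rewrite subnK.
Qed.

Lemma homog_split (k : fieldType) n d (g : {mpoly k[n]}) : g \is d.+1.-homog ->
  exists2 h : 'I_n -> {mpoly k[n]}, (forall j, h j \is d.-homog)
    & g = \sum_j h j * 'X_j.
Proof.
move=> gh; suff: forall s : seq 'X_{1..n}, {in s, forall m, mdeg m = d.+1} ->
    exists2 h : 'I_n -> {mpoly k[n]}, (forall j, h j \is d.-homog)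
      & \sum_(m <- s) g@_m *: 'X_[m] = \sum_j h j * 'X_j.
  by move=> /(_ (msupp g) (dhomog_mf gh)); rewrite -mpolyE.
elim=> [|m s IHs] sd.
  exists (fun _ => 0) => [j|]; first exact: dhomog0.
  by rewrite big_nil big1 // => j _; rewrite mul0r.
have [|h hh Eh] := IHs; first by move=> m' m's; apply: sd; rewrite inE m's orbT.
have dm := sd m (mem_head _ _).
have [i mi] : exists i, m i != 0%N.
  apply: contrapT => H; move: dm; rewrite mdegE big1 // => i _.
  by apply: contrapT => /eqP mi; apply: H; exists i.
have lem : (U_(i) <= m)%MM by rewrite lep1mP.
exists (fun j => h j + (if j == i then g@_m *: 'X_[m - U_(i)] else 0)) => [j|].
  apply: dhomogD => //; case: ifP => _; last exact: dhomog0.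
  apply: dhomogZ; rewrite dhomogX /=; apply/eqP; apply: succn_inj.
  by rewrite -dm -{2}(submK lem) mdegD mdeg1 addn1.
rewrite big_cons Eh addrC.
under [RHS]eq_bigr do rewrite mulrDl.
rewrite big_split; congr (_ + _); rewrite (bigD1 i) //= eqxx.
rewrite [X in _ = _ + X]big1 ?addr0 => [|j /negbTE ->]; last by rewrite mul0r.
by rewrite -scalerAl -mpolyXD submK.
Qed.

Lemma dhomog0C (k : fieldType) n (f : {mpoly k[n]}) : f \is 0.-homog -> exists c, f = c%:MP.
Proof.
move=> fh; exists f@_0%MM; apply/mpolyP => m; rewrite mcoeffC.
have [->|m0] := eqVneq m 0%MM; first by rewrite mulr1.
by rewrite mulr0 (dhomog_nemf_coeff fh) // mdeg_eq0.
Qed.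

Lemma dhomog_sum (k : fieldType) n d (T : Type) (s : seq T) (P : pred T) (F : T -> {mpoly k[n]}) :
  (forall i, P i -> F i \is d.-homog) -> \sum_(i <- s | P i) F i \is d.-homog.
Proof. by move=> FH; apply: rpred_sum. Qed.

Section LinearForms.
Variables (k : fieldType) (n : nat).
Implicit Types w : 'cV[k]_n.

Definition lform w : {mpoly k[n]} := \sum_i w i 0 *: 'X_i.

Lemma lform_homog w : lform w \is 1.-homog.
Proof. by apply: dhomog_sum => i _; apply: dhomogZ; rewrite dhomogX /= mdeg1. Qed.

Lemma meval_lform w (v : 'rV[k]_n) : (lform w).@[v 0] = (v *m w) 0 0.
Proof.
rewrite raddf_sum mxE; apply: eq_bigr => i _ /=.
by rewrite mevalZ mevalXU mulrC.
Qed.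

Lemma mcoeff_lform w i : (lform w)@_U_(i) = w i 0.
Proof.
rewrite raddf_sum (bigD1 i) //= mcoeffZ mcoeffXU eqxx mulr1 big1 ?addr0 // => j nji.
by rewrite mcoeffZ mcoeffXU (negbTE nji) mulr0.
Qed.

Lemma lformP (f : {mpoly k[n]}) : f \is 1.-homog -> exists w, f = lform w.
Proof.
move=> fh; exists (\col_i f@_U_(i)); apply/mpolyP => m.
have [/mdeg1P[i /eqP ->]|m1] := boolP (mdeg m == 1%N).
  by rewrite mcoeff_lform mxE.
by rewrite !(dhomog_nemf_coeff _ m1) // lform_homog.
Qed.

Lemma sep_submx m (A : 'M[k]_(m, n)) (p : 'rV[k]_n) : ~~ (p <= A)%MS ->
  exists2 w : 'cV[k]_n, A *m w = 0 & (p *m w) 0 0 != 0.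
Proof.
rewrite submxE => /rV0Pn[j pj].
exists (col j (cokermx A)); rewrite colE mulmxA ?mulmx_coker ?mul0mx //.
by rewrite -colE mxE.
Qed.

End LinearForms.

Section Points.
Variables (k : closedFieldType) (n : nat).
Local Notation U := {mpoly k[n]}.
Implicit Types (f g h l u : U) (v : nat -> 'rV[k]_n).

(** Equivalently, the vectors represent pairwise distinct points of projective space. *)
Definition separated v := forall i j, i <> j ->
  exists2 l, l \is 1.-homog & l.@[v i 0] = 0 /\ l.@[v j 0] <> 0.

Definition generic v := forall d f, f \is d.-homog -> f <> 0 ->
  exists N, forall i, (N <= i)%N -> f.@[v i 0] <> 0.

Lemma separated_shift v m : separated v -> separated (fun i => v (m + i)%N).
Proof. by move=> sep i j nij; apply: sep => /addnI. Qed.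

Section Separated.
Variables (v : nat -> 'rV[k]_n) (sep_v : separated v).

Lemma nonvanishing i : exists2 l, l \is 1.-homog & l.@[v i 0] <> 0.
Proof. by have [|l lh [_ li]] := @sep_v i.+1 i; [move/eqP; rewrite gtn_eqF|exists l]. Qed.

Lemma sep_prod (s : seq nat) i : i \notin s ->
  exists2 f, f \is (size s).-homog & f.@[v i 0] <> 0 /\ {in s, forall j, f.@[v j 0] = 0}.
Proof.
elim: s => [|j s IHs] /=.
  by exists 1; rewrite ?dhomog1 // meval1; split=> //; apply/eqP/oner_neq0.
rewrite inE negb_or => /andP[/eqP nij /IHs[f fh [fi fs]]].
have [|l lh [lj li]] := @sep_v j i; first by move=> eji; apply: nij.
exists (l * f); first by rewrite -add1n dhomogM.
split=> [|j']; first by rewrite mevalM; apply/eqP; rewrite mulf_neq0 //; apply/eqP.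
by rewrite inE mevalM => /predU1P[->|/fs ->]; rewrite ?lj ?mul0r ?mulr0.
Qed.

Lemma pad_form d d' f i : (d <= d')%N -> f \is d.-homog -> f.@[v i 0] <> 0 ->
  exists2 g, g \is d'.-homog
    & g.@[v i 0] <> 0 /\ forall j, f.@[v j 0] = 0 -> g.@[v j 0] = 0.
Proof.
move=> led fh fi; have [l lh li] := nonvanishing i.
exists (f * l ^+ (d' - d)).
  by have := dhomogM fh (dhomogMn (d' - d) lh); rewrite mul1n subnKC.
split=> [|j]; last by rewrite mevalM => ->; rewrite mul0r.
by rewrite mevalM rmorphXn; apply/eqP; rewrite mulf_neq0 ?expf_neq0 //; apply/eqP.
Qed.

(** The form is corrected one point at a time, by a multiple of a form through [v m] whose
    coefficient avoids the finitely many ratios that would create a zero. *)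
Lemma avoid_form (s : seq nat) m : m \notin s ->
  exists2 l, l \is 1.-homog & l.@[v m 0] = 0 /\ {in s, forall i, l.@[v i 0] <> 0}.
Proof.
elim: s => [|i s IHs]; first by exists 0; rewrite ?dhomog0 // meval0.
rewrite inE negb_or => /andP[/eqP nmi /IHs[l lh [lm ls]]].
have [l' l'h [l'm l'i]] := sep_v nmi.
pose bad j := - (l.@[v j 0] / l'.@[v j 0]).
have [c] := closed_field_avoid (0 :: [seq bad j | j <- i :: s]).
rewrite inE negb_or => /andP[c0 cbad].
have H j : j \in i :: s -> l.@[v j 0] <> 0 \/ l'.@[v j 0] <> 0 ->
    (l + c *: l').@[v j 0] <> 0.
  move=> js ll'; rewrite mevalD mevalZ => E.
  have [l'j|l'j] := eqVneq (l'.@[v j 0]) 0.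
    by move: E; rewrite l'j mulr0 addr0 => lj; case: ll'.
  case/negP: cbad; apply/mapP; exists j => //; rewrite /bad.
  by apply: (mulIf l'j); rewrite mulNr divfK //; apply/eqP; rewrite -subr_eq0 opprK addrC E.
exists (l + c *: l'); first by rewrite dhomogD ?dhomogZ.
split; first by rewrite mevalD mevalZ lm l'm mulr0 addr0.
move=> j; rewrite inE => /predU1P[->|js]; apply: H; rewrite ?mem_head ?inE ?js ?orbT //.
  by right.
by left; apply: ls.
Qed.

(** The product of linear forms through the other [m - 1] points, padded to degree [d]. *)
Lemma sep_basic m i d : (m <= d.+1)%N -> (i < m)%N -> exists2 f, f \is d.-homog
  & f.@[v i 0] <> 0 /\ forall j, (j < m)%N -> j <> i -> f.@[v j 0] = 0.
Proof.
move=> lemd ltim; have uI := iota_uniq 0 m.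
have [|f fh [fi fs]] := @sep_prod (rem i (iota 0 m)) i; first by rewrite mem_rem_uniqF.
have iI : i \in iota 0 m by rewrite mem_iota add0n.
have [|g gh [gi gs]] := pad_form _ fh fi (d' := d).
  by rewrite size_rem // size_iota -ltnS prednK // (leq_ltn_trans _ ltim).
exists g => //; split=> // j ltjm nji; apply/gs/fs.
by rewrite mem_rem_uniq // inE mem_iota /= add0n ltjm andbT; apply/eqP.
Qed.

(* At a point where [f j0] does not vanish, adding multiples of the Koszul syzygies
   between [f j] and [f j0] to [h] makes every [h j] with [j != j0] vanish there,
   and then [h j0] vanishes because [\sum_j h j * f j] does. *)
Lemma koszul_fix r (f h : 'I_r -> U) (nd : 'I_r -> nat) m (X : seq nat) :
  (forall j, f j \is (nd j).-homog) -> (forall j, h j \is (m - nd j).-homog) ->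
  (forall j j', (nd j + nd j' <= m)%N) ->
  {in X, forall i, exists j, (f j).@[v i 0] <> 0} ->
  {in X, forall i, (\sum_j h j * f j).@[v i 0] = 0} ->
  {in X, forall i j j', exists2 u, u \is (m - (nd j + nd j')).-homog
    & u.@[v i 0] <> 0 /\ {in X, forall i', i' <> i -> u.@[v i' 0] = 0}} ->
  exists2 h' : 'I_r -> U, (forall j, h' j \is (m - nd j).-homog)
    & \sum_j h' j * f j = \sum_j h j * f j /\
      {in X, forall i j, (h' j).@[v i 0] = 0}.
Proof.
move=> fh hh ndm f0 g0 uX; set g := \sum_j _.
(* The points are treated one by one: the multipliers [u] vanish at the other points of [X], so
   zeros already obtained are preserved. *)
suff: forall s : seq nat, {subset s <= X} ->
    exists2 h' : 'I_r -> U, (forall j, h' j \is (m - nd j).-homog)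
    & \sum_j h' j * f j = g /\ {in s, forall i j, (h' j).@[v i 0] = 0} by apply.
elim=> [|i s IHs] sX; first by exists h.
have [|h' h'h [Eg h's]] := IHs; first by move=> i' i's; apply: sX; rewrite inE i's orbT.
have iX := sX i (mem_head _ _); have [j0 fj0] := f0 i iX.
have /choice[u uP] : forall j, exists u, [/\ u \is (m - (nd j + nd j0)).-homog,
    u.@[v i 0] <> 0 & {in X, forall i', i' <> i -> u.@[v i' 0] = 0}].
  by move=> j; have [u ? []] := uX i iX j j0; exists u.
pose c j := - ((h' j).@[v i 0] / ((u j).@[v i 0] * (f j0).@[v i 0])).
pose h2 j := if j == j0 then h' j0 - \sum_(j' | j' != j0) c j' *: u j' * f j'
  else h' j + c j *: u j * f j0.
have Eg2 : \sum_j h2 j * f j = g.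
  rewrite (bigD1 j0) //= {1}/h2 eqxx mulrBl -Eg [RHS](bigD1 j0) //= -addrA; congr (_ + _).
  rewrite addrC -[RHS]addr0.
  rewrite -[X in _ = _ + X](subrr ((\sum_(j' | j' != j0) c j' *: u j' * f j') * f j0)).
  rewrite addrA; congr (_ - _); rewrite mulr_suml -big_split; apply: eq_bigr => j /negbTE nj.
  by rewrite /h2 nj /= mulrDl -!mulrA [f j0 * f j]mulrC.
have h2i : forall j, (h2 j).@[v i 0] = 0.
  have h2j j : j != j0 -> (h2 j).@[v i 0] = 0.
    move=> /negbTE nj; rewrite /h2 nj mevalD mevalM mevalZ /c mulNr mulNr.
    have [_ /eqP uj _] := uP j; move/eqP: fj0 => fj0.
    by rewrite -mulrA divfK ?subrr // mulf_neq0.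
  move=> j; have [->|/h2j//] := eqVneq j j0.
  move: (g0 i iX); rewrite -/g -Eg2 (bigD1 j0) //= mevalD mevalM raddf_sum /= big1; last first.
    by move=> j' /h2j E; rewrite mevalM E mul0r.
  by move/eqP; rewrite addr0 mulf_eq0 => /orP[/eqP//|/eqP].
exists h2.
  move=> j; rewrite /h2; case: eqP => [->|/eqP nj].
    apply: rpredB => //; apply: dhomog_sum => j' _.
    have [uh _ _] := uP j'.
    have -> : (m - nd j0 = m - (nd j' + nd j0) + nd j')%N.
      by have := ndm j' j0; lia.
    by rewrite dhomogM ?dhomogZ.
  have [uh _ _] := uP j; apply: dhomogD => //.
  have -> : (m - nd j = m - (nd j + nd j0) + nd j0)%N.
    by have := ndm j j0; lia.
  by rewrite dhomogM ?dhomogZ.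
split=> // i' i's j; have [->|/eqP ni'] := eqVneq i' i; first exact: h2i.
have i's' : i' \in s by move: i's; rewrite inE => /predU1P[].
have i'X := sX i' i's.
rewrite /h2; case: ifP => _; last first.
  have [_ _ uj] := uP j.
  by rewrite mevalD mevalM mevalZ uj // h's // mulr0 mul0r addr0.
rewrite mevalB h's // sub0r (raddf_sum (meval _)) /= big1 ?oppr0 // => j' _.
by have [_ _ uj] := uP j'; rewrite mevalM mevalZ uj // mulr0 mul0r.
Qed.
End Separated.
End Points.

(** * Interpolation below the generic degree *)

Section Interpolation.
Variables (k : closedFieldType) (n : nat) (n_ge3 : (3 <= n)%N).
Local Notation U := {mpoly k[n]}.
Implicit Types (f g h l u : U).
Variables (v : nat -> 'rV[k]_n) (sep_v : separated v) (gen_v : generic v).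

Lemma kill_two a b : exists2 l : U, l \is 1.-homog & l <> 0 /\ l.@[v a 0] = 0 /\ l.@[v b 0] = 0.
Proof.
pose A := col_mx (v a) (v b).
have [i Ai] : exists i, ~~ (row i 1%:M <= A)%MS.
  apply/existsP; rewrite -[[exists _, _]]negbK negb_exists; apply/negP => /forallP H.
  have /mxrankS : (1%:M <= A)%MS by apply/row_subP => i; have := H i; rewrite negbK.
  rewrite mxrank1; apply/negP; rewrite -ltnNge.
  exact: leq_ltn_trans (rank_leq_row A) n_ge3.
have [w Aw iw] := sep_submx Ai; exists (lform w); first exact: lform_homog.
move: Aw; rewrite mul_col_mx -(col_mx0) => /eq_col_mx[Ea Eb].
split; last by rewrite !meval_lform Ea Eb !mxE.
by move=> l0; move: iw; rewrite -meval_lform l0 meval0 eqxx.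
Qed.

Lemma kill_pair b c p : ~~ (v p <= col_mx (v b) (v c))%MS ->
  exists2 l : U, l \is 1.-homog & [/\ l.@[v b 0] = 0, l.@[v c 0] = 0 & l.@[v p 0] <> 0].
Proof.
move=> /sep_submx[w Aw pw]; exists (lform w); first exact: lform_homog.
move: Aw; rewrite mul_col_mx -(col_mx0) => /eq_col_mx[Ea Eb].
by split; rewrite meval_lform ?Ea ?Eb; [rewrite mxE|rewrite mxE|apply/eqP].
Qed.

(* Given three non-collinear points, any further point misses one of two of the sides. *)
Lemma triple a : exists c, (a.+1 < c)%N /\ forall p, p <> a -> p <> a.+1 -> p <> c ->
  exists x y l, [/\ x \in [:: a; a.+1; c], y \in [:: a; a.+1; c], x <> y, l \is 1.-homog
    & [/\ l.@[v x 0] = 0, l.@[v y 0] = 0 & l.@[v p 0] <> 0]].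
Proof.
have [l lh [l0 [la lb]]] := kill_two a a.+1; have [N HN] := gen_v lh l0.
(* By genericity [c] lies off a hyperplane through the first two points, so the three points are not
   collinear. *)
pose c := maxn N a.+2; exists c; split=> [|p pa pb pc]; first by rewrite leq_maxr.
have lc : l.@[v c 0] <> 0 by apply: HN; rewrite leq_maxl.
have [lp|/eqP lp] := eqVneq (l.@[v p 0]) 0; last first.
  exists a, a.+1, l; rewrite !inE !eqxx ?orbT; split=> //.
have [|l' l'h [l'b l'c l'p]] := @kill_pair a.+1 c p; last first.
  exists a.+1, c, l'; rewrite !inE !eqxx ?orbT; split=> //.
  by move/eqP; rewrite ltn_eqF // leq_maxr.
(* If [p] also lay on the side through [a.+1] and [c], evaluating [l] would remove the component
   along [v c] and make [p] proportional to [v a.+1]. *)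
apply/negP => /submxP[D]; rewrite -[D]hsubmxK mul_row_col.
have Dl (d : 'M[k]_1) (x : 'rV[k]_n) : d *m x = d 0 0 *: x.
  by rewrite {1}[d]mx11_scalar mul_scalar_mx.
rewrite !Dl; set z := _ 0 0; set w := _ 0 0 => def_p.
have evp (g : U) : g \is 1.-homog -> g.@[v p 0] = z * g.@[v a.+1 0] + w * g.@[v c 0].
  move=> /lformP[m ->]; rewrite !meval_lform def_p mulmxDl -!scalemxAl.
  by rewrite [LHS]mxE; congr (_ + _); rewrite [LHS]mxE.
have [l' l'h [l'b l'p]] := sep_v (not_eq_sym pb).
apply: l'p; rewrite evp // l'b mulr0 add0r.
move/eqP: lp; rewrite evp // lb mulr0 add0r mulf_eq0 => /orP[/eqP->|/eqP//].
by rewrite mul0r.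
Qed.

(** Each step on [e] gains one degree. The new points [N, ..., c] cost one linear form each, but if
    [i] is among them it is left out, and otherwise one side of the triple kills two of them at
    once. The index [i] is arbitrary so that the forms can be multiplied further. *)
Lemma sep_forms e : exists N, (e <= N)%N /\ forall i,
  exists2 f : U, f \is (N - e).-homog
    & f.@[v i 0] <> 0 /\ forall j, (j < N)%N -> j <> i -> f.@[v j 0] = 0.
Proof.
elim: e => [|e [N [leN HN]]].
  exists 0%N; split=> // i; exists 1; first exact: dhomog1.
  by rewrite meval1; split=> //; apply/eqP/oner_neq0.
have [c [ltc Hc]] := triple N; exists c.+1; split; first by lia.
pose s := iota N (c.+1 - N).
have sI : uniq s by apply: iota_uniq.
have inS j : (j \in s) = (N <= j)%N && (j <= c)%N by rewrite mem_iota; lia.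
have sz : size s = (c.+1 - N)%N by rewrite size_iota.
move=> i; have [f fh [fi fN]] := HN i.
have glue (g : U) d : g \is d.-homog -> (N - e + d = c - e)%N -> g.@[v i 0] <> 0 ->
    (forall j, j \in s -> j <> i -> g.@[v j 0] = 0) ->
    exists2 f : U, f \is (c.+1 - e.+1).-homog
    & f.@[v i 0] <> 0 /\ forall j, (j < c.+1)%N -> j <> i -> f.@[v j 0] = 0.
  move=> gh Ed gi gs; exists (f * g); first by rewrite subSS -Ed dhomogM.
  split=> [|j ltj ji]; first by rewrite mevalM; apply/eqP; rewrite mulf_neq0 //; apply/eqP.
  rewrite mevalM; case: (ltnP j N) => [lt|le]; first by rewrite fN ?mul0r.
  by rewrite gs ?mulr0 // inS le.
have [iS|niS] := boolP (i \in s).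
  have [|g gh [gi gs]] := sep_prod sep_v (s := rem i s) (i := i).
    by rewrite mem_rem_uniqF.
  apply: (glue g _ gh) => //.
    by rewrite size_rem // sz; move: iS; rewrite inS; lia.
  by move=> j js ji; apply: gs; rewrite mem_rem_uniq // inE js andbT; apply/eqP.
have [||| x [y [l [xin yin xy lh [lx ly li]]]]] := Hc i.
- by move=> E; move: niS; rewrite inS; lia.
- by move=> E; move: niS; rewrite inS; lia.
- by move=> E; move: niS; rewrite inS; lia.
have xS : x \in s by move: xin; rewrite !inE inS => /or3P[]/eqP->; lia.
have yS : y \in s by move: yin; rewrite !inE inS => /or3P[]/eqP->; lia.
have [|g gh [gi gs]] := sep_prod sep_v (s := rem x (rem y s)) (i := i).
  by apply: contra niS => /mem_rem/mem_rem.
have xS' : x \in rem y s by rewrite mem_rem_uniq // inE xS andbT; apply/eqP.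
apply: (glue (l * g) _ (dhomogM lh gh)).
- by rewrite !size_rem // sz; move: leN ltc; clear; lia.
- by rewrite mevalM; apply/eqP; rewrite mulf_neq0 //; apply/eqP.
- move=> j js ji; rewrite mevalM.
  have [->|/eqP jx] := eqVneq j x; first by rewrite lx mul0r.
  have [->|/eqP jy] := eqVneq j y; first by rewrite ly mul0r.
  rewrite gs ?mulr0 // mem_rem_uniq ?rem_uniq // inE mem_rem_uniq // inE js andbT.
  by apply/andP; split; apply/eqP.
Qed.

(* Eventually the first [m] points impose independent conditions on forms of
   degree [m - e], a fixed amount below the generic bound [m - 1]. *)
Lemma sep_forms_eventually e : exists N, forall m d i, (N <= m)%N -> (m <= d + e)%N ->
  exists2 f : U, f \is d.-homog
    & f.@[v i 0] <> 0 /\ forall j, (j < m)%N -> j <> i -> f.@[v j 0] = 0.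
Proof.
have [N [leN HN]] := sep_forms e; exists N => m d i leNm lemd.
have [f fh [fi fN]] := HN i.
pose s := rem i (iota N (m - N)).
have sz : (size s <= m - N)%N.
  by apply: leq_trans (size_subseq (rem_subseq _ _)) _; rewrite size_iota.
have [|g gh [gi gs]] := sep_prod sep_v (s := s) (i := i); first by rewrite mem_rem_uniqF ?iota_uniq.
have fgi : (f * g).@[v i 0] <> 0 by rewrite mevalM; apply/eqP; rewrite mulf_neq0 //; apply/eqP.
have [|h hh [hi hs]] := pad_form sep_v _ (dhomogM fh gh) fgi (d' := d).
  by move: (size s) sz leN leNm lemd => z; clear; lia.
exists h => //; split=> // j ltj ji; apply: hs; rewrite mevalM.
case: (ltnP j N) => [lt|le]; first by rewrite fN ?mul0r.
rewrite gs ?mulr0 // mem_rem_uniq ?iota_uniq // inE mem_iota subnKC // le ltj !andbT.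
exact/eqP.
Qed.

End Interpolation.

(** * Forms vanishing at consecutive points *)

Section Window.
Variables (k : closedFieldType) (n : nat).
Local Notation U := {mpoly k[n]}.
Implicit Types (f g h l u : U).

(** The forms are ['X_j - b j *: 'X_a] for a nonzero coordinate [a] of [p]. Modulo them a form of
    positive degree is a multiple of a power of ['X_a], and vanishing at [p] kills that multiple. *)
Lemma point_generators (p : 'rV[k]_n) : p != 0 ->
  exists l : 'I_n -> U, [/\ forall j, l j \is 1.-homog, forall j, (l j).@[p 0] = 0 &
    forall m g, g \is m.+1.-homog -> g.@[p 0] = 0 ->
    exists2 h : 'I_n -> U, forall j, h j \is m.-homog & g = \sum_j h j * l j].
Proof.
move=> /rV0Pn[a pa]; pose b j := p 0 j / p 0 a.
pose l j : U := 'X_j - b j *: 'X_a.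
have lh j : l j \is 1.-homog.
  by apply: rpredB; rewrite ?dhomogZ // dhomogX /= mdeg1.
have lp j : (l j).@[p 0] = 0 by rewrite mevalB mevalZ !mevalXU /b divfK ?subrr.
suff: forall d g, g \is d.+1.-homog -> exists (h : 'I_n -> U) c,
    (forall j, h j \is d.-homog) /\ g = \sum_j h j * l j + c *: 'X_a ^+ d.+1.
  move=> H; exists l; split=> // m g gh; have [h [c [hh Eg]]] := H m g gh.
  move=> gp; exists h => //; move: gp; rewrite Eg mevalD (raddf_sum (meval _)).
  rewrite big1 => [|j _]; last by rewrite /= mevalM lp mulr0.
  rewrite add0r mevalZ rmorphXn /= mevalXU => /eqP; rewrite mulf_eq0 expf_eq0 (negbTE pa) /=.
  by rewrite orbF => /eqP ->; rewrite scale0r addr0.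
elim=> [|d IHd] g gh.
  have [h hh Eg] := homog_split gh; have /choice[c Hc] := fun j => dhomog0C (hh j).
  exists h, (\sum_j c j * b j); split=> //.
  rewrite scaler_suml -big_split Eg expr1; apply: eq_bigr => j _ /=.
  by rewrite /l Hc !mul_mpolyC scalerBr scalerA subrK.
have [h hh Eg] := homog_split gh.
have [h' [c [h'h Eh']]] : exists (h' : 'I_n -> U) c, (forall j, h' j \is d.-homog) /\
    \sum_j b j *: h j = \sum_j h' j * l j + c *: 'X_a ^+ d.+1.
  by apply: IHd; apply: dhomog_sum => j _; apply: dhomogZ.
exists (fun j => h j + h' j * 'X_a), c; split.
  by move=> j; apply: dhomogD => //; rewrite -addn1 dhomogM // dhomogX /= mdeg1.
have -> : g = \sum_j h j * l j + 'X_a * \sum_j b j *: h j.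
  rewrite big_distrr -big_split Eg; apply: eq_bigr => j _ /=.
  by rewrite /l mulrBr -!mul_mpolyC; ring.
rewrite Eh' mulrDr addrA; congr (_ + _); last by rewrite -scalerAr -exprS.
rewrite big_distrr -big_split; apply: eq_bigr => j _ /=; ring.
Qed.

Section Sep.
Variables (v : nat -> 'rV[k]_n) (sep_v : separated v).

Lemma pt_neq0 i : v i != 0.
Proof.
have [l /lformP[w ->] lw] := nonvanishing sep_v i; apply/eqP => vi; apply: lw.
by rewrite meval_lform vi mul0mx mxE.
Qed.

(** This is the degree-one generation behind the algebra: [g] is first expanded in the ideal of
    [v m], then the coefficients are corrected by Koszul syzygies to vanish at the earlier
    points. *)
Lemma vanishing_product m g : g \is m.+1.-homog ->
  (forall i, (i < m.+1)%N -> g.@[v i 0] = 0) ->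
  exists l h : 'I_n -> U, [/\ forall j, l j \is 1.-homog, forall j, (l j).@[v m 0] = 0,
    forall j, h j \is m.-homog, forall j i, (i < m)%N -> (h j).@[v i 0] = 0
    & g = \sum_j h j * l j].
Proof.
move=> gh g0; have [l [lh lm lgen]] := point_generators (pt_neq0 m).
have [h hh Eg] := lgen m g gh (g0 m (ltnSn m)).
case: m => [|m] in gh g0 lm lgen hh *; first by exists l, h; split.
have hh' j : h j \is (m.+2 - 1).-homog by rewrite subn1.
have [||||h' h'h [Eh h'X]] := @koszul_fix k n v n l h (fun _ => 1%N) m.+2 (iota 0 m.+1) lh hh'.
- by [].
- move=> i; rewrite mem_iota add0n => /andP[_ lti].
  (* An earlier point is not a common zero of the [l j], because a linear form through the last
     point that misses it lies in their span. *)
  have [l' l'h [l'm l'i]] := sep_v (i := m.+1) (j := i) (ltac:(lia)).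
  have [h' _ El'] := lgen 0%N l' l'h l'm.
  apply: contrapT => H; apply: l'i; rewrite El' (raddf_sum (meval _)) big1 //= => j _.
  rewrite mevalM (_ : (l j).@[_] = 0) ?mulr0 //.
  by apply: contrapT => lj; apply: H; exists j.
- by move=> i; rewrite mem_iota add0n => /andP[_ lti]; rewrite -Eg; apply: g0; apply: leqW.
- move=> i; rewrite mem_iota add0n => /andP[_ lti] _ _.
  (* The multipliers have degree [m] for [m + 1] points, exactly the bound of [sep_basic]. *)
  have [u uh [ui uj]] := @sep_basic k n v sep_v m.+1 i m (leqnn _) lti.
  exists u; first by rewrite subn2.
  by split=> // j; rewrite mem_iota add0n => /andP[_]; apply: uj.
exists l, h'; split=> //; last by rewrite Eh.
by move=> j i lti; apply: h'X; rewrite mem_iota.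
Qed.

End Sep.
End Window.

(** * Modules over a sequence of points *)

Lemma subspaceB (k : fieldType) (V : lmodType k) (E : V -> Prop) x y :
  is_subspace E -> E x -> E y -> E (x - y).
Proof. by move=> [_ EL] Ex Ey; rewrite addrC -scaleN1r; apply: EL. Qed.

Lemma subspace_sum (k : fieldType) (V : lmodType k) (E : V -> Prop) (T : Type)
    (s : seq T) (P : pred T) F :
  is_subspace E -> (forall i, P i -> E (F i)) -> E (\sum_(i <- s | P i) F i).
Proof.
move=> [E0 EL] EF; elim/big_rec: _ => // i x Pi Ex.
by rewrite -[F i]scale1r; apply: EL => //; apply: EF.
Qed.

Lemma subspace_acc_homog (k : fieldType) n m (E : nat -> {mpoly k[n.+1]} -> Prop) :
  (forall s, is_subspace (E s)) -> (forall s f, E s f -> E s.+1 f) ->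
  (forall s f, E s f -> f \is m.-homog) ->
  exists N, forall s f, (N <= s)%N -> E s f -> E N f.
Proof.
move=> subE incE homE.
pose E' s (p : dhomog n.+1 k m) := E s (mpoly_of_dhomog p).
have [s|s p|N HN] := @subspace_acc k (dhomog n.+1 k m) E'.
- by have [E0 EL] := subE s; split=> [|a x y]; [apply: E0|apply: EL].
- exact: incE.
by exists N => s f leNs Ef; apply: (HN s (DHomog (homE s f Ef))).
Qed.

Section OrbitModules.
Variables (k : closedFieldType) (n : nat) (n_ge2 : (2 <= n)%N).
Local Notation U := {mpoly k[n.+1]}.
Implicit Types (f g h l u : U).

(* Graded left ideals of [R] are of this kind, and so are graded right ideals
   once the twist is undone and the orbit is reversed. *)
Definition orbit_module (v : nat -> 'rV[k]_n.+1) (I : nat -> U -> Prop) : Prop :=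
  [/\ forall m, is_subspace (I m), forall m f, I m f -> f \is m.-homog,
      forall m f i, (i < m)%N -> I m f -> f.@[v i 0] = 0
    & forall m f l, l \is 1.-homog -> l.@[v m 0] = 0 -> I m f -> I m.+1 (l * f)].

Variables (v : nat -> 'rV[k]_n.+1) (sep_v : separated v) (gen_v : generic v).

(** Peeling off the last point of the window with [vanishing_product], applied to the sequence
    shifted by [m], writes [h] as a sum of products that enter [I] one linear form at a time. *)
Lemma orbit_module_window I : orbit_module v I -> forall d m f h, I m f ->
  h \is d.-homog -> (forall i, (m <= i < m + d)%N -> h.@[v i 0] = 0) -> I (m + d)%N (h * f).
Proof.
move=> [subI _ _ mulI] d m f h If; elim: d h => [|d IHd] h hh h0.
  have [c ->] := dhomog0C hh; rewrite addn0 mul_mpolyC -[_ *: _]addr0.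
  by have [I0 IL] := subI m; apply: IL.
have [|l [h' [lh lm h'h h'0 ->]]] := vanishing_product (separated_shift m sep_v) hh.
  by move=> i lti; apply: h0; rewrite leq_addr ltn_add2l.
rewrite mulr_suml addnS; apply: subspace_sum => // j _.
rewrite mulrAC mulrC; apply: mulI => //; apply: IHd => // i /andP[lemi ltid].
by rewrite -(subnKC lemi); apply: h'0; rewrite ltn_subLR.
Qed.

Section Obstruction.
Variables (r : nat) (f : 'I_r -> U) (nd : 'I_r -> nat) (NT : nat) (lam : nat -> nat -> k).

(* The possible values at the first [NT] points, normalised by [lam], of coefficients
   [h] such that [\sum_j h j * f j] lies in [I m] and [h] vanishes at the remaining points. *)
Definition obstruction (I : nat -> U -> Prop) (m : nat) (M : 'M[k]_(r, NT)) : Prop :=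
  exists h : 'I_r -> U, [/\ forall j, h j \is (m - nd j).-homog,
    forall j i, (NT <= i < m)%N -> (h j).@[v i 0] = 0,
    forall j (i : 'I_NT), (h j).@[v i 0] = lam m i * M j i
    & I m (\sum_j h j * f j)].

Lemma obstruction_subspace I m : orbit_module v I -> is_subspace (obstruction I m).
Proof.
move=> [subI _ _ _]; split.
  exists (fun _ => 0); split=> [j|j i _|j i|]; rewrite ?dhomog0 ?meval0 ?mxE ?mulr0 //.
  by rewrite big1 => [|j _]; [have [] := subI m|rewrite mul0r].
move=> a M M' [h [hh h0 hM Ih]] [h' [h'h h'0 h'M Ih']].
exists (fun j => a *: h j + h' j); split=> [j|j i Hi|j i|].
- by rewrite dhomogD ?dhomogZ.
- by rewrite mevalD mevalZ h0 // h'0 // mulr0 addr0.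
- by rewrite mevalD mevalZ hM h'M !mxE; ring.
have -> : \sum_j (a *: h j + h' j) * f j = a *: (\sum_j h j * f j) + \sum_j h' j * f j.
  by rewrite scaler_sumr -big_split; apply: eq_bigr => j _; rewrite mulrDl scalerAl.
by have [_ IL] := subI m; apply: IL.
Qed.

End Obstruction.

(** In high degree, an element is determined modulo the fixed module [I s0] by the values of its
    coefficients at the first [NT] points. These values form an ascending family of subspaces of one
    space of matrices. *)
Theorem orbit_module_acc (I : nat -> nat -> U -> Prop) :
  (forall s, orbit_module v (I s)) -> (forall s m f, I s m f -> I s.+1 m f) ->
  exists N, forall s m f, (N <= s)%N -> I s m f -> I N m f.
Proof.
move=> modI incI.
have incI' m s s' f : (s <= s')%N -> I s m f -> I s' m f.
  by move=> le; apply: (chain_le (fun s f => @incI s m f) le).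
pose X f := exists s m, I s m f.
have [F FX spanF] := noetherian_fg X (@left_noetherian_mpoly k n.+1).
have [all0|not0] := pselect (forall f, f \in F -> f = 0).
  exists 0%N => s m f _ If; have [h ->] := spanF f (ex_intro _ s (ex_intro _ m If)).
  rewrite big1 => [|i _]; first by have [/(_ m)[]] := modI 0%N.
  by rewrite (all0 F`_i) ?mulr0 // mem_nth.
pose r := size F; pose f (j : 'I_r) := F`_j.
have /choice[sn Hsn] : forall j, exists sn : nat * nat, I sn.1 sn.2 (f j).
  by move=> j; have [|s [m Ifj]] := FX (f j); [apply: mem_nth|exists (s, m)].
pose nd j := (sn j).2; pose s0 := \max_j (sn j).1; pose e := \max_j nd j.
have If j : I s0 (nd j) (f j) by apply: incI' (Hsn j); apply: leq_bigmax.
have fh j : f j \is (nd j).-homog by have [_ H _ _] := modI s0; apply: H.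
have nde j : (nd j <= e)%N by apply: (leq_bigmax (F := nd)).
(* One nonzero generator already avoids all but finitely many points. *)
have [NT HNT] : exists NT, forall i, (NT <= i)%N -> exists j, (f j).@[v i 0] <> 0.
  have [g gF g0] : exists2 g, g \in F & g <> 0.
    by apply: contrapT => H; apply: not0 => g gF; apply: contrapT => g0; apply: H; exists g.
  have ltg : (index g F < r)%N by rewrite index_mem.
  have Eg : f (Ordinal ltg) = g by rewrite /f nth_index.
  have [|NT HNT] := gen_v (fh (Ordinal ltg)); first by rewrite Eg.
  by exists NT => i /HNT Hi; exists (Ordinal ltg).
(* The Koszul multipliers have degree [m - (nd j + nd j')], hence at least [m - (e + e)]. *)
have [N1 HN1] := @sep_forms_eventually k n.+1 n_ge2 v sep_v gen_v (e + e).
pose m0 := (N1 + NT + e + e)%N.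
(* From degree [m0] on, [l m] passes through [v m] and misses the first [NT] points. Multiplying by
   it raises the degree of a representation, and [lam] absorbs its values, so the normalised matrix
   does not change. *)
have /choice[l Hl] : forall m, exists l, [/\ l \is 1.-homog, l.@[v m 0] = 0
    & (m0 <= m)%N -> {in iota 0 NT, forall i, l.@[v i 0] <> 0}].
  move=> m; have [le|lt] := leqP m0 m; last by exists 0; rewrite dhomog0 meval0.
  have [|l lh [lm li]] := avoid_form sep_v (s := iota 0 NT) (m := m); last by exists l.
  by rewrite mem_iota; move: le; rewrite /m0; clear; lia.
pose lam m i := \prod_(m0 <= m' < m) (l m').@[v i 0].
have lam_neq0 m i : (i < NT)%N -> lam m i != 0.
  move=> lti; rewrite /lam prodf_seq_neq0; apply/allP => m' /=.
  rewrite mem_index_iota => /andP[le _].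
  by apply/eqP; have [_ _ /(_ le i)] := Hl m'; apply; rewrite mem_iota.
pose E s m := @obstruction r f nd NT lam (I s) m.
have subE s m : is_subspace (E s m) by apply: obstruction_subspace.
have incEs s m M : E s m M -> E s.+1 m M.
  by move=> [h [hh h0 hM Ih]]; exists h; split=> //; apply: incI.
have incEm s m M : (m0 <= m)%N -> E s m M -> E s m.+1 M.
  move=> le [h [hh h0 hM Ih]]; have [lh lm _] := Hl m.
  exists (fun j => l m * h j); split=> [j|j i Hi|j i|].
  - have := dhomogM lh (hh j); rewrite add1n -subSn // (leq_trans (nde j)) //.
    by move: le; rewrite /m0; clear; lia.
  - rewrite mevalM; have [->|nim] := eqVneq i m; first by rewrite lm mul0r.
    by rewrite h0 ?mulr0 //; move: Hi nim; clear; lia.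
  - by rewrite mevalM hM /lam big_nat_recr //=; ring.
  have -> : \sum_j l m * h j * f j = l m * \sum_j h j * f j.
    by rewrite big_distrr; apply: eq_bigr => j _ /=; rewrite mulrA.
  by have [_ _ _ H] := modI s; apply: H.
(* The obstruction spaces grow with both the stage and the degree, so it suffices to stabilise them
   along a diagonal. *)
have [s|s M /incEs|a0' Ha0'] := @subspace_acc k _ (fun s => E s (m0 + s)%N).
- exact: subE.
- by rewrite addnS; apply: incEm; apply: leq_addr.
pose a0 := maxn a0' s0.
have incEs' s s' m M : (s <= s')%N -> E s m M -> E s' m M.
  by move=> le; apply: (chain_le (fun s M => @incEs s m M) le).
have incEm' s m m' M : (m0 <= m)%N -> (m <= m')%N -> E s m M -> E s m' M.
  move=> le /subnKC <-; elim: (m' - m)%N => [|d IHd]; first by rewrite addn0.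
  by move=> /IHd; rewrite addnS; apply: incEm; apply: leq_trans le (leq_addr _ _).
have stable s m M : (a0 <= s)%N -> (m0 + a0 <= m)%N -> E s m M -> E a0 m M.
  move=> les lem HM; pose s' := maxn s (m - m0).
  have HM' : E s' (m0 + s')%N M.
    apply: (incEm' _ m); [by move: lem; clear; lia|by rewrite /s'; move: lem; clear; lia|].
    by apply: incEs' HM; apply: leq_maxl.
  have HM2 : E a0' (m0 + a0')%N M.
    by apply: Ha0' HM'; rewrite leq_max (leq_trans _ les) ?leq_maxl.
  apply: (incEs' a0'); first exact: leq_maxl.
  apply: incEm' HM2; first exact: leq_addr.
  by apply: leq_trans lem; rewrite leq_add2l leq_maxl.
(* Homogeneous components of the coefficients still represent [g]; from index [NT] on the [f j] have
   no common zero among the points, so [koszul_fix] applies there. *)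
have coeffs s m g : (m0 <= m)%N -> I s m g -> exists2 h : 'I_r -> U,
    (forall j, h j \is (m - nd j).-homog) &
    g = \sum_j h j * f j /\ forall j i, (NT <= i < m)%N -> (h j).@[v i 0] = 0.
  move=> le Ig; have [homI zeroI] : g \is m.-homog /\ forall i, (i < m)%N -> g.@[v i 0] = 0.
    by have [_ H1 H2 _] := modI s; split=> [|i lti]; [apply: H1 Ig|apply: H2 Ig].
  have [h' Eg'] := spanF g (ex_intro _ s (ex_intro _ m Ig)).
  pose h (j : 'I_r) := pihomog mdeg (m - nd j) (h' j).
  have ndm j : (nd j <= m)%N.
    by apply: leq_trans (nde j) _; move: le; rewrite /m0; clear; lia.
  have Eg : g = \sum_j h j * f j.
    rewrite -[LHS](pihomog_dE homI) Eg' raddf_sum; apply: eq_bigr => j _ /=.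
    by rewrite (pihomog_mulr _ _ (fh j)) ndm.
  have hh j : h j \is (m - nd j).-homog by apply: pihomogP.
  have [||||h2 h2h [Eh2 h20]] := @koszul_fix k n.+1 v r f h nd m (iota NT (m - NT)) fh hh.
  - by move=> j j'; have := nde j; have := nde j'; move: le; rewrite /m0; clear; lia.
  - by move=> i; rewrite mem_iota => /andP[lei _]; apply: HNT.
  - move=> i; rewrite mem_iota -Eg => /andP[_ lti]; apply: zeroI.
    by move: le lti; rewrite /m0; clear; lia.
  - move=> i; rewrite mem_iota => Hi j j'.
    have [||u uh [ui u0]] := HN1 m (m - (nd j + nd j'))%N i.
    + by move: le; rewrite /m0; clear; lia.
    + by have := nde j; have := nde j'; move: le; rewrite /m0; clear; lia.
    exists u => //; split=> // i'; rewrite mem_iota => Hi'; apply: u0.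
    by move: Hi' le; rewrite /m0; clear; lia.
  exists h2 => //; split=> [|j i Hi]; first by rewrite Eh2.
  by apply: h20; rewrite mem_iota; move: Hi; clear; lia.
have high s m g : (a0 <= s)%N -> (m0 + a0 <= m)%N -> I s m g -> I a0 m g.
  move=> les lem Ig; have le : (m0 <= m)%N by apply: leq_trans lem; apply: leq_addr.
  have [h hh [Eg h0]] := coeffs s m g le Ig.
  pose M : 'M[k]_(r, NT) := \matrix_(j, i) ((h j).@[v i 0] / lam m i).
  have [|h1 [h1h h10 h1M Ih1]] := stable s m M les lem.
    exists h; split=> // [j i|]; last by rewrite -Eg.
    by rewrite mxE mulrCA divff ?mulr1 // lam_neq0.
  rewrite -[g](subrK (\sum_j h1 j * f j)) addrC -[_ - _]scale1r addrC.
  have [/(_ m)[_ IL] _ _ _] := modI a0; apply: IL => //.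
  (* The coefficients of the difference vanish at every [v i] with [i < m], so [orbit_module_window]
     puts each term in [I s0]. *)
  rewrite Eg -sumrB; apply: incI' (leq_maxr a0' s0) _.
  have [subI _ _ _] := modI s0; apply: subspace_sum => // j _.
  rewrite -mulrBl.
  have ndm : (nd j <= m)%N.
    by apply: leq_trans (nde j) _; move: le; rewrite /m0; clear; lia.
  rewrite -[m in I _ m](subnKC ndm); apply: (orbit_module_window (modI s0) (If j)).
    by apply: dhomogD (hh j) _; rewrite dhomogN.
  move=> i; rewrite subnKC // => /andP[_ lti]; rewrite mevalB.
  case: (ltnP i NT) => [ltiN|leiN]; last by rewrite h0 ?h10 ?subrr ?leiN.
  have := h1M j (Ordinal ltiN); rewrite /= mxE /= mulrCA divff ?mulr1 ?lam_neq0 // => ->.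
  by rewrite subrr.
(* Only finitely many degrees remain, each with a finite-dimensional space of forms. *)
have [N2 HN2] : exists N2, forall m, (m < m0 + a0)%N ->
    forall s g, (N2 <= s)%N -> I s m g -> I N2 m g.
  apply: uniform_bound => [m _|m s s' le Hs s2 g les2 Ig].
    apply: (subspace_acc_homog (m := m)) => s; last by have [_ H _ _] := modI s; apply: H.
      by have [H _ _ _] := modI s.
    exact: incI.
  exact: incI' le (Hs _ _ (leq_trans le les2) Ig).
exists (maxn a0 N2) => s m g; rewrite geq_max => /andP[le1 le2] Ig.
case: (ltnP m (m0 + a0)) => [lt|le].
  by apply: (incI' m N2 _ g (leq_maxr _ _)); apply: HN2 lt _ _ le2 Ig.
by apply: (incI' m a0 _ g (leq_maxl _ _)); apply: high le1 le Ig.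
Qed.

End OrbitModules.

(** * The orbit of a point *)

Lemma poly_nonroot (k : closedFieldType) (p : {poly k}) : p != 0 -> exists x, p.[x] != 0.
Proof.
move=> p0; have [r Ep] := closed_field_poly_normal p.
have [x xr] := closed_field_avoid r; exists x.
by rewrite Ep hornerZ mulf_neq0 ?lead_coef_eq0 // -rootE root_prod_XsubC.
Qed.

(** Some coefficient of [f] as a polynomial in the last variable is nonzero at a point by induction;
    the last coordinate is then chosen off the roots. *)
Lemma mpoly_nonroot (k : closedFieldType) n (f : {mpoly k[n]}) : f <> 0 ->
  exists v : 'rV[k]_n, f.@[v 0] <> 0.
Proof.
elim: n f => [|n IHn] f f0.
  exists 0; rewrite [f]nvar0_mpolyC mevalC => E.
  by apply: f0; rewrite [f]nvar0_mpolyC E mpolyC0.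
have [i fi] : exists i, (muni f)`_i <> 0.
  apply: contrapT => H; apply: f0.
  have cmw : commr_rmorph (@mwiden n k) ('X_ord_max : {mpoly k[n.+1]}).
    by move=> x; apply: mulrC.
  have /(_ f) : horner_morph cmw \o @muni n k =1 idfun.
    apply: mpoly_rmorph_ext => [c|j] /=.
      by rewrite muniC horner_morphC /= mwidenC.
    have [j' ->|->] := unliftP ord_max j; last by rewrite muniX_max horner_morphX.
    have -> : 'X_(lift ord_max j') = mwiden ('X_j' : {mpoly k[n]}).
      rewrite mwidenX mnmwiden1; congr 'X_ _; apply: val_inj.
      by rewrite /= /bump leqNgt ltn_ord.
    by rewrite muni_widen horner_morphC.
  move=> /= <-; have -> : muni f = 0; last by rewrite rmorph0.
  by apply/polyP => i; rewrite coef0; apply: contrapT => fi; apply: H; exists i.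
have [v vi] := IHn _ fi.
have [|x xi] := @poly_nonroot k (map_poly (meval (v 0)) (muni f)).
  by apply/eqP => /polyP/(_ i); rewrite coef_map coef0.
pose w : 'rV[k]_n.+1 := \row_i (if unlift ord_max i is Some j then v 0 j else x).
exists w; apply/eqP; suff <- : (map_poly (meval (v 0)) (muni f)).[x] = f.@[w 0] by [].
have cmw : commr_rmorph (meval (v 0)) x by move=> y; apply: mulrC.
apply: (@mpoly_rmorph_ext _ _ _ (horner_morph cmw \o @muni n k) (meval (w 0))) => [c|j] /=.
  by rewrite muniC horner_morphC /= !mevalC.
rewrite mevalXU mxE; case: unliftP => [j' ->|->]; last by rewrite muniX_max horner_morphX.
have -> : 'X_(lift ord_max j') = mwiden ('X_j' : {mpoly k[n]}).
  rewrite mwidenX mnmwiden1; congr 'X_ _; apply: val_inj.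
  by rewrite /= /bump leqNgt ltn_ord.
by rewrite muni_widen horner_morphC /= mevalXU.
Qed.

Lemma meval_scale (k : fieldType) n d (f : {mpoly k[n]}) a (v : 'rV[k]_n) :
  f \is d.-homog -> f.@[(a *: v) 0] = a ^+ d * f.@[v 0].
Proof.
move=> fh; rewrite !mevalE mulr_sumr big_seq [RHS]big_seq; apply: eq_bigr => m mf.
rewrite mulrCA; congr (_ * _).
have -> : d = mdeg m := esym (dhomog_mf fh mf); rewrite mdegE -prodrXr -big_split.
by apply: eq_bigr => i _; rewrite mxE exprMn.
Qed.

(** By Cayley-Hamilton, applying the factors [A - z] of the characteristic polynomial in turn
    carries [w] into [V]; the last vector still outside [V] is the one sought. *)
Lemma eigen_modulo (k : closedFieldType) m p (A : 'M[k]_m.+1)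
    (V : 'M[k]_(p, m.+1)) (w : 'rV[k]_m.+1) :
  ~~ (w <= V)%MS -> exists (v : 'rV[k]_m.+1) a, ~~ (v <= V)%MS /\ (v *m A - a *: v <= V)%MS.
Proof.
have [r Er] := closed_field_poly_normal (char_poly A).
have : (w *m horner_mx A (\prod_(z <- r) ('X - z%:P)) <= V)%MS.
  have := Cayley_Hamilton A; rewrite Er (monicP (char_poly_monic A)) scale1r => ->.
  by rewrite mulmx0 sub0mx.
elim: r {Er} w => [|z r IHr] w; first by rewrite big_nil rmorph1 mulmx1 => ->.
rewrite big_cons rmorphM /= mulmxA => Hw nw.
have [le|nle] := boolP (w *m horner_mx A ('X - z%:P) <= V)%MS.
  exists w, z; split=> //; move: le.
  by rewrite rmorphB /= horner_mx_X horner_mx_C mulmxBr mul_mx_scalar.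
exact: IHr Hw nle.
Qed.

(** * The matrix of a graded automorphism and its action on points *)

Section Automorphism.
Variables (k : closedFieldType) (t : nat) (Phi : graded_aut k t.+1).
Local Notation U := {mpoly k[t.+1]}.
Implicit Types (f g : U) (d : point k t).

(** Column [j] lists the coefficients of [Phi 'X_j], so that pulling back forms by [Phi] is right
    multiplication on row vectors. *)
Definition aut_mx : 'M[k]_t.+1 := \matrix_(i, j) (Phi 'X_j)@_U_(i).

Lemma aut_homog e f : f \is e.-homog -> Phi f \is e.-homog.
Proof. exact: gaut_homog. Qed.

Lemma meval_aut f (v : 'rV[k]_t.+1) : (Phi f).@[v 0] = f.@[(v *m aut_mx) 0].
Proof.
apply: (@mpoly_rmorph_ext _ _ _ (meval (v 0) \o Phi) (meval ((v *m aut_mx) 0))) => [c|j] /=.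
  by rewrite -[c%:MP]alg_mpolyC linearZ rmorph1 /= alg_mpolyC !mevalC.
have [w Ew] : exists w, Phi 'X_j = lform w.
  by apply: lformP; apply: aut_homog; rewrite dhomogX /= mdeg1.
rewrite mevalXU Ew meval_lform !mxE; apply: eq_bigr => i _.
by rewrite mxE Ew mcoeff_lform.
Qed.

Lemma aut_mx_unit : aut_mx \in unitmx.
Proof.
rewrite -row_free_unit; apply: inj_row_free => v vL.
have [g Kg gK] := gaut_bij Phi.
(* Surjectivity of [Phi] expresses the coordinates of every multiple of a kernel vector [v] as the
   same values at 0; comparing the multiples 1 and 0 gives [v = 0]. *)
have X0 j (a : k) : (a *: v) 0 j = (g 'X_j).@[(0 : 'rV[k]_t.+1) 0].
  by have := meval_aut (g 'X_j) (a *: v); rewrite gK mevalXU -scalemxAl vL scaler0.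
apply/rowP => j; have := X0 j 1; rewrite scale1r => ->.
by rewrite -(X0 j 0) scale0r.
Qed.

Lemma aut_surj_homog e f : f \is e.-homog -> exists2 g, g \is e.-homog & Phi g = f.
Proof.
move=> fh; have [h _ hK] := gaut_bij Phi; exists (pihomog mdeg e (h f)); first exact: pihomogP.
have Phi_pi g : Phi (pihomog mdeg e g) = pihomog mdeg e (Phi g).
  move: g; apply: twist_ind => [|g g' Hg Hg'|d' g gh].
  - by rewrite pihomog0 !rmorph0 pihomog0.
  - by rewrite pihomogD !rmorphD pihomogD /= Hg Hg'.
  have [<-|ne] := eqVneq d' e; first by rewrite !pihomog_dE ?aut_homog.
  by rewrite (pihomog_ne0 ne gh) rmorph0 (pihomog_ne0 ne (aut_homog gh)).
by rewrite Phi_pi hK pihomog_dE.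
Qed.

Lemma iter_aut_surj_homog b e f : f \is e.-homog -> exists2 g, g \is e.-homog & iter b Phi g = f.
Proof.
elim: b f => [|b IHb] f fh; first by exists f.
have [g gh <-] := aut_surj_homog fh; have [g' g'h <-] := IHb g gh.
by exists g'.
Qed.

Lemma line_pick d : line d = <[vpick (line d)]>%VS /\ vpick (line d) != 0.
Proof.
have /eqP d1 := line_dim d.
have v0 : vpick (line d) != 0 by rewrite vpick0 -dimv_eq0 d1.
split=> //; apply/esym/eqP; rewrite eqEdim -memvE memv_pick /= dim_vline v0.
by rewrite d1.
Qed.

Lemma line_gen d : exists u, [/\ u \in line d, u != 0 & line d = <[u]>%VS].
Proof. by have [E u0] := line_pick d; exists (vpick (line d)); rewrite memv_pick. Qed.

Lemma line_vline d v : v \in line d -> v != 0 -> line d = <[v]>%VS.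
Proof.
move=> vd v0; have /eqP d1 := line_dim d.
by apply/esym/eqP; rewrite eqEdim -memvE vd dim_vline v0 d1.
Qed.

Lemma vanishesP d v e f : v \in line d -> v != 0 -> f \is e.-homog ->
  vanishes f d <-> f.@[v 0] = 0.
Proof.
move=> vd v0 fh; split=> [/(_ v vd)//|fv u].
rewrite (line_vline vd v0) => /vlineP[a ->]; have := meval_scale a v fh.
by rewrite fv mulr0.
Qed.

Lemma pt_ideal_homog d e f : f \is e.-homog -> pt_ideal d f <-> vanishes f d.
Proof.
move=> fh; split=> [/(_ e)|fd e'].
  by rewrite pihomog_dE.
have [<-|ne] := eqVneq e e'; first by rewrite pihomog_dE.
by rewrite (pihomog_ne0 ne fh) => v _; rewrite meval0.
Qed.

Variables (phi : autP k t) (ind : induces Phi phi).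

(** The condition on ideals is tested on the forms [u 0 a *: 'X_b - u 0 b *: 'X_a], which cut out
    the line of [phi d]. *)
Lemma line_aut d v : v \in line d -> v *m aut_mx \in line (phi d).
Proof.
move=> vd; have [u [ud u0 ->]] := line_gen (phi d).
apply/vlineP; have /rV0Pn[a ua] := u0.
exists ((v *m aut_mx) 0 a / u 0 a); apply/rowP => b; rewrite [RHS]mxE.
apply: (mulIf ua); rewrite mulrAC divfK // [RHS]mulrC.
have lh : u 0 a *: 'X_b - u 0 b *: 'X_a \is 1.-homog :> bool.
  by apply: rpredB; rewrite dhomogZ // dhomogX /= mdeg1.
have : vanishes (u 0 a *: 'X_b - u 0 b *: 'X_a) (phi d).
  apply/(vanishesP ud u0 lh).
  by rewrite mevalB !mevalZ !mevalXU mulrC subrr.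
move/(pt_ideal_homog _ lh)/ind/(pt_ideal_homog _ (aut_homog lh))/(_ v vd).
rewrite -/((Phi _).@[v 0]) meval_aut mevalB !mevalZ !mevalXU => /eqP.
by rewrite subr_eq0 => /eqP <-; rewrite mulrC.
Qed.

Variable c : point k t.

(** A coherent choice of representatives of the [c_i]: [aut_mx] maps each vector to its predecessor
    exactly, not only up to a scalar. *)
Definition orbit_vec (i : int) : 'rV[k]_t.+1 := vpick (line c) *m (aut_mx ^ (- i)).

Lemma orbit_vecS i : orbit_vec (i + 1) *m aut_mx = orbit_vec i.
Proof.
rewrite /orbit_vec -mulmxA opprD exprzDr ?aut_mx_unit //.
by rewrite -!mulmxE -mulmxA [_ ^ (- 1) *m _]mulVmx ?aut_mx_unit // mulmx1.
Qed.

Lemma orbit_vec_neq0 i : orbit_vec i != 0.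
Proof.
have [_ v0] := line_pick c; apply: contra v0 => /eqP E.
have U' : aut_mx ^ (- i) \in unitmx by rewrite unitrXz ?aut_mx_unit.
by rewrite -[vpick _](mulmxK U') -/(orbit_vec i) E mul0mx.
Qed.

Lemma orbit_vec_line i : orbit_vec i \in line (orbit_pt phi c i).
Proof.
have v0 : orbit_vec 0 = vpick (line c) by rewrite /orbit_vec oppr0 expr0z mulmx1.
case: i => n.
  elim: n => [|n IHn]; first by rewrite v0 memv_pick.
  set d := orbit_pt phi c n.+1; have Ed : phi d = orbit_pt phi c n by apply: aut_invK.
  have [u [ud u0 Eline]] := line_gen d.
  have uL : u *m aut_mx \in line (orbit_pt phi c n) by rewrite -Ed line_aut.
  have uL0 : u *m aut_mx != 0.
    by apply: contra u0 => /eqP E; rewrite -[u](mulmxK aut_mx_unit) E mul0mx.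
  move: IHn; rewrite (line_vline uL uL0) => /vlineP[a].
  rewrite -orbit_vecS -[n%:Z + 1]PoszD addn1 scalemxAl => /(congr1 (fun x => x *m invmx aut_mx)).
  rewrite !mulmxK ?aut_mx_unit // => ->; rewrite Eline; exact: memvZ (memv_line _).
elim: n => [|n IHn].
  by rewrite -orbit_vecS /= line_aut // (_ : Negz 0 + 1 = 0) // v0 memv_pick.
rewrite -orbit_vecS (_ : Negz n.+1 + 1 = Negz n); first exact: line_aut.
by rewrite !NegzE; lia.
Qed.

Lemma meval_iter_aut b f i : (iter b Phi f).@[orbit_vec (i + b%:Z) 0] = f.@[orbit_vec i 0].
Proof.
elim: b i => [|b IHb] i; first by rewrite addr0.
by rewrite iterS meval_aut (_ : i + b.+1%:Z = i + b%:Z + 1) ?orbit_vecS ?IHb // -addrA -PoszD addn1.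
Qed.

End Automorphism.

Lemma injective_leaves (T : eqType) (g : nat -> T) (s : seq T) : injective g ->
  exists N, forall i, (N <= i)%N -> g i \notin s.
Proof.
move=> injg; elim: s => [|x s [N HN]]; first by exists 0%N.
have [[j Ej]|nx] := pselect (exists j, g j = x).
  exists (maxn N j.+1) => i; rewrite geq_max => /andP[leN ltj].
  rewrite inE negb_or HN // andbT -Ej; apply/eqP => /injg Eij.
  by move: ltj; rewrite Eij ltnn.
exists N => i leN; rewrite inE negb_or HN // andbT; apply/eqP => E.
by apply: nx; exists i.
Qed.

Section Orbit.
Variables (k : closedFieldType) (t : nat) (Phi : graded_aut k t.+1).
Variables (phi : autP k t) (c : point k t).
Hypotheses (ind : induces Phi phi) (crit : critical_density phi c).
Local Notation U := {mpoly k[t.+1]}.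
Local Notation w := (orbit_vec Phi c).

Lemma orbit_avoids (g : nat -> int) e (f : U) : injective g -> f \is e.-homog -> f <> 0 ->
  exists N, forall i, (N <= i)%N -> f.@[w (g i) 0] <> 0.
Proof.
move=> injg fh f0; have [inj_orb [_ dense]] := crit.
have [||s Hs] := dense (fun d => vanishes f d).
- exists (fun f' => f' = f); split=> [f' ->|d]; first by exists e.
  by split=> [fd f' ->|]; [|apply].
- have [v fv] := mpoly_nonroot f0.
  (* The zero vector spans no point, but [vanishes] tests it too: a form nonzero there fails to
     vanish at every point, in particular at [c]. *)
  have [v0|v0] := eqVneq v 0.
    have fv0 : ~ vanishes f c.
      move=> /(_ (0 *: orbit_vec Phi c 0)); rewrite scale0r mem0v -v0 => /(_ isT).
      exact: fv.
    by exists c.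
  have dv : \dim <[v]>%VS == 1%N by rewrite dim_vline v0.
  by exists (Point dv) => /(_ v (memv_line v)).
have inj_g : injective (fun i => orbit_pt phi c (g i)) by move=> i j /inj_orb/injg.
have [N HN] := injective_leaves s inj_g; exists N => i leN fi.
have /negP := HN i leN; apply; apply: Hs; split; first by exists (g i).
exact/(vanishesP (orbit_vec_line ind c (g i)) (orbit_vec_neq0 Phi c (g i)) fh).
Qed.

Lemma orbit_generic (g : nat -> int) : injective g -> generic (fun i => w (g i)).
Proof. by move=> injg e f fh f0; apply: orbit_avoids fh f0. Qed.

Lemma orbit_separated (g : nat -> int) : injective g -> separated (fun i => w (g i)).
Proof.
move=> injg i j nij; have [inj_orb _] := crit.
have [a [Aa aj]] : exists a : 'cV[k]_t.+1, w (g i) *m a = 0 /\ (w (g j) *m a) 0 0 != 0.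
  have [|a Aa aj] := @sep_submx _ _ _ (w (g i)) (w (g j)); last by exists a.
  apply/negP => /sub_rVP[b Eb]; apply: nij; apply/injg/inj_orb/val_inj.
  have wj0 := orbit_vec_neq0 Phi c (g j).
  have Li := line_vline (orbit_vec_line ind c (g i)) (orbit_vec_neq0 Phi c (g i)).
  have wjL : w (g j) \in line (orbit_pt phi c (g i)) by rewrite Eb memvZ // orbit_vec_line.
  by rewrite /= (line_vline wjL wj0) (line_vline (orbit_vec_line ind c (g j)) wj0).
exists (lform a); first exact: lform_homog.
by rewrite !meval_lform Aa mxE; split=> //; apply/eqP.
Qed.

End Orbit.

Lemma extend_rows (k : fieldType) p (E : 'M[k]_(2, 2 + p)) : row_free E ->
  exists2 M : 'M[k]_(2 + p), M \in unitmx & usubmx M = E.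
Proof.
move=> freeE; have rE : \rank E = 2%N by apply/eqP.
exists (block_mx (col_ebase E) 0 0 1%:M *m row_ebase E).
  rewrite unitmx_mul row_ebase_unit andbT unitmxE det_ublock det1 mulr1.
  by rewrite -unitmxE col_ebase_unit.
rewrite -mul_usub_mx /block_mx col_mxKu -[RHS]mulmx_ebase rE pid_mx_row.
by rewrite mul_mx_row mulmx1 mulmx0.
Qed.

Lemma dhomog_prod_ord (k : fieldType) n d (F : 'I_d -> {mpoly k[n]}) :
  (forall i, F i \is 1.-homog) -> \prod_i F i \is d.-homog.
Proof.
elim: d F => [|d IHd] F Fh; first by rewrite big_ord0 dhomog1.
by rewrite big_ord_recl; apply: (dhomogM (Fh ord0)); apply: IHd.
Qed.

(** * An affine patch containing the orbit *)

Section Patch.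
Variables (k : closedFieldType) (p : nat) (Phi : graded_aut k p.+3).
Variables (phi : autP k p.+2) (c : point k p.+2).
Hypotheses (ind : induces Phi phi) (crit : critical_density phi c).
Local Notation U := {mpoly k[p.+3]}.
Local Notation w := (orbit_vec Phi c).

Let generic_pos : generic (fun i => w (Posz i)).
Proof. by apply: (orbit_generic ind crit) => i j []. Qed.

Let generic_neg : generic (fun i => w (Negz i)).
Proof. by apply: (orbit_generic ind crit) => i j []. Qed.

(* [l0] is an eigenform, [l1] an eigenform modulo [l0]; thus [l0] does not
   vanish on the orbit, and on [l1 / l0] the automorphism acts by an affine map. *)
Lemma patch_exists : exists M : 'M[k]_(p.+3), [/\ M \in unitmx,
  forall i, (w i *m M) 0 ord0 != 0
  & forall i j : nat, i <> j -> (w i *m M) 0 (lift ord0 ord0) / (w i *m M) 0 ord0 <>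
     (w j *m M) 0 (lift ord0 ord0) / (w j *m M) 0 ord0].
Proof.
(* Linear forms are columns, on which [aut_mx] acts from the left; transposing allows row
   eigenvectors to be used. *)
pose A := (aut_mx Phi)^T; have UA : A \in unitmx by rewrite unitmx_tr aut_mx_unit.
have [e0 [mu [e0n e0A]]] : exists (v : 'rV[k]_p.+3) a, v != 0 /\ v *m A = a *: v.
  have [|v [a [nv]]] := eigen_modulo A (V := (0 : 'M[k]_(1, p.+3))) (w := delta_mx 0 0).
    apply/negP => /submx0null /matrixP/(_ 0 0); rewrite !mxE !eqxx => /eqP.
    by rewrite oner_eq0.
  move=> /submx0null /eqP; rewrite subr_eq0 => /eqP Ev; exists v, a; split=> //.
  by apply: contraNneq nv => ->; apply: sub0mx.
have [e1 [mu' [nu [ne1 e1A]]]] : exists (v : 'rV[k]_p.+3) a b,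
    ~~ (v <= e0)%MS /\ v *m A = a *: v + b *: e0.
  have [x nx] : exists x : 'rV[k]_p.+3, ~~ (x <= e0)%MS.
    have : ~~ (1%:M <= e0)%MS.
      apply/negP => /mxrankS; rewrite mxrank1 leqNgt.
      by rewrite (leq_ltn_trans (rank_leq_row e0)).
    by move=> /row_subPn[i Hi]; exists (row i 1%:M).
  have [v [a [nv /sub_rVP[b E]]]] := eigen_modulo A nx.
  by exists v, a, b; split=> //; rewrite -E addrC subrK.
have mu0 : mu != 0.
  apply: contra e0n => /eqP mu0; move: e0A; rewrite mu0 scale0r => E.
  by rewrite -[e0](mulmxK UA) E mul0mx.
pose E : 'M[k]_(2, 2 + p.+1) := col_mx e0 e1.
have r0 : row 0 E = e0.
  rewrite -[RHS](row_id 0 e0) -(rowKu 0 e0 e1); congr (row _ _); exact: val_inj.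
have r1 : row 1 E = e1.
  rewrite -[RHS](row_id 0 e1) -(rowKd 0 e0 e1); congr (row _ _); exact: val_inj.
have freeE : row_free E.
  apply: inj_row_free => v; rewrite mulmx_sum_row !big_ord_recl big_ord0 addr0 r0.
  rewrite (_ : lift ord0 ord0 = 1); last exact: val_inj.
  rewrite r1; set a := v 0 _; set b := v 0 _ => H.
  have b0 : b = 0.
    apply/eqP; apply: contraNT ne1 => b0; apply/sub_rVP; exists (- (a / b)).
    apply: (scalerI b0); rewrite scalerA mulrN mulrC divfK // scaleNr.
    by apply/eqP; rewrite -addr_eq0 addrC H.
  have a0 : a = 0.
    move/eqP: H; rewrite b0 scale0r addr0 scaler_eq0 (negbTE e0n) orbF.
    by move/eqP.
  apply/rowP => x; rewrite mxE; case: x => [[|[|//]] ltx].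
    by rewrite -[RHS]a0; congr (v _ _); apply: val_inj.
  by rewrite -[RHS]b0; congr (v _ _); apply: val_inj.
have [M' UM' EM'] := extend_rows freeE.
exists M'^T.
have coor i (j : 'I_2) : (w i *m M'^T) 0 (lshift p.+1 j) = (w i *m (row j E)^T) 0 0.
  rewrite -EM' mxE [RHS]mxE; apply: eq_bigr => x _; congr (_ * _).
  by rewrite [LHS]mxE [RHS]mxE [RHS]mxE usubmxEsub mxE.
pose l0 i := (w i *m e0^T) 0 0; pose l1 i := (w i *m e1^T) 0 0.
have c0 i : (w i *m M'^T) 0 ord0 = l0 i.
  by rewrite /l0 -r0 -coor; congr (_ 0 _); apply: val_inj.
have c1 i : (w i *m M'^T) 0 (lift ord0 ord0) = l1 i.
  by rewrite /l1 -r1 -coor; congr (_ 0 _); apply: val_inj.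
have l0S i : l0 i = mu * l0 (i + 1).
  rewrite /l0 -(orbit_vecS Phi c i) -mulmxA -[aut_mx Phi]trmxK -trmx_mul -/A e0A.
  by rewrite linearZ -scalemxAr mxE.
have l1S i : l1 i = mu' * l1 (i + 1) + nu * l0 (i + 1).
  rewrite /l1 -(orbit_vecS Phi c i) -mulmxA -[aut_mx Phi]trmxK -trmx_mul -/A e1A.
  by rewrite linearD !linearZ mulmxDr -!scalemxAr mxE; congr (_ + _); rewrite mxE.
have e0form : lform e0^T <> 0.
  move/eqP: e0n => e0n E0; apply: e0n; apply/rowP => i.
  by have := mcoeff_lform e0^T i; rewrite E0 mcoeff0 !mxE.
(* A zero of [l0] on the orbit would propagate to all larger indices, against genericity. *)
have l0n i : l0 i <> 0.
  move=> l0i; have up (m : nat) : l0 (i + m%:Z) = 0.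
    elim: m => [|m IHm]; first by rewrite addr0.
    move/eqP: IHm; rewrite l0S mulf_eq0 (negbTE mu0) /= => /eqP <-.
    by rewrite -addrA -PoszD addn1.
  have [N HN] := generic_pos (lform_homog e0^T) e0form.
  have [m Em] : exists m : nat, Posz (N + absz i) = i + m%:Z.
    by case: (i) => a; [exists N|exists (N + a.+1 + a.+1)%N]; rewrite ?NegzE /=; lia.
  apply: (HN (N + absz i)%N); first by rewrite leq_addr.
  by rewrite meval_lform -/(l0 _) Em up.
split=> [|i|i j nij]; first by rewrite unitmx_tr.
  by rewrite c0; apply/eqP.
rewrite !c0 !c1; pose b i := l1 i / l0 i; rewrite -!/(b _).
wlog ltij : i j nij / (i < j)%N.
  move=> H; have [||//] := ltngtP i j; first exact: H.
  by move=> ltji /esym; apply: H => // /esym.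
move=> Eb; have bS x : b x = (mu' * b (x + 1) + nu) / mu.
  by rewrite /b (l1S x) (l0S x); field; rewrite mu0; apply/eqP.
pose per := (j - i)%N; have per0 : (0 < per)%N by rewrite subn_gt0.
pose beta (m : nat) := b (j%:Z - 1 - m%:Z).
have betaP m : beta (m + per)%N = beta m.
  (* The recursion passes from [x + 1] to [x], so a coincidence propagates to smaller indices;
     [beta] reads the values downwards from [j - 1]. *)
  have : forall x : nat, b (i%:Z - x%:Z) = b (j%:Z - x%:Z).
    elim=> [|x IHx]; first by rewrite !subr0.
    rewrite bS [RHS]bS (_ : i%:Z - x.+1%:Z + 1 = i%:Z - x%:Z); last by lia.
    by rewrite (_ : j%:Z - x.+1%:Z + 1 = j%:Z - x%:Z) ?IHx; last by lia.
  move/(_ m.+1); rewrite /beta (_ : j%:Z - 1 - (m + per)%N%:Z = i%:Z - m.+1%:Z).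
    by move=> ->; congr b; lia.
  by rewrite /per; move: ltij; clear; lia.
have betaM m : beta m = beta (m %% per)%N.
  rewrite [in LHS](divn_eq m per); elim: (m %/ per)%N => [|q IHq]; first by rewrite mul0n.
  by rewrite mulSn -addnA addnC betaP.
(* Periodicity puts every orbit point of negative index on one of [per] hyperplanes, so the nonzero
   form [F] would vanish at all of them. *)
pose F : U := \prod_(r < per) (lform e1^T - beta r *: lform e0^T).
have Fh : F \is per.-homog.
  apply: dhomog_prod_ord => r; apply: dhomogD (lform_homog _) _.
  by rewrite dhomogN dhomogZ // lform_homog.
have F0 : F <> 0.
  apply/eqP; rewrite /F; apply/prodf_neq0 => r _; apply/eqP => E1.
  move/negP: ne1; apply; apply/sub_rVP; exists (beta r); apply/rowP => x.
  have /eqP := congr1 (mcoeff U_(x)) E1; rewrite mcoeffB mcoeffZ !mcoeff_lform mcoeff0.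
  by rewrite !mxE subr_eq0 => /eqP.
have [N HN] := generic_neg Fh F0; apply: (HN N (leqnn N)).
pose m := (j + N)%N; pose r := Ordinal (ltn_pmod m per0).
rewrite /F (bigD1 r) //= mevalM mevalB mevalZ !meval_lform.
have -> : Negz N = j%:Z - 1 - m%:Z by rewrite NegzE /m; lia.
rewrite -/(l0 _) -/(l1 _) -betaM /beta /b divfK ?subrr ?mul0r //.
exact/eqP.
Qed.

End Patch.

Section Coordinates.
Variables (k : closedFieldType) (t : nat) (M : 'M[k]_t.+1).

Definition affine_coord (v : 'rV[k]_t.+1) (j : 'I_t) : k :=
  (v *m M) 0 (lift ord0 j) / (v *m M) 0 ord0.

Lemma patch_coordE (d : point k t) v j : v \in line d -> v != 0 ->
  patch_coord M d j = affine_coord v j.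
Proof.
move=> vd v0; have [_ u0] := line_pick d; rewrite /patch_coord /affine_coord.
have : vpick (line d) \in line d by apply: memv_pick.
rewrite {2}(line_vline vd v0) => /vlineP[a Ea]; move: u0; rewrite Ea scaler_eq0 negb_or.
move=> /andP[a0 _]; rewrite -scalemxAl ![(a *: (v *m M)) _ _]mxE.
by rewrite invfM mulrACA divff // mul1r.
Qed.

(** Homogenisation in the linear forms given by the columns of [M]; the degree [msize p] exceeds the
    total degree of a nonzero [p] by one. *)
Definition homogenize (p : {mpoly k[t]}) : {mpoly k[t.+1]} :=
  \sum_(m <- msupp p) p@_m *: (lform (col ord0 M) ^+ (msize p - mdeg m) *
     \prod_j lform (col (lift ord0 j) M) ^+ m j).

Lemma meval_lform_col (v : 'rV[k]_t.+1) j : (lform (col j M)).@[v 0] = (v *m M) 0 j.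
Proof. by rewrite meval_lform !mxE; apply: eq_bigr => i _; rewrite mxE. Qed.

Lemma homogenize_homog p : homogenize p \is (msize p).-homog.
Proof.
rewrite /homogenize big_seq; apply: dhomog_sum => m mp; apply: dhomogZ.
have lem : (mdeg m <= msize p)%N by apply: ltnW; apply: msize_mdeg_lt.
rewrite -[X in _ \is X.-homog](subnK lem).
have := dhomogMn (msize p - mdeg m) (lform_homog (col ord0 M)); rewrite mul1n => h.
apply: (dhomogM h); rewrite mdegE; elim/big_rec2: _ => [|j y d _ IH]; first exact: dhomog1.
by apply: dhomogM => //; have := dhomogMn (m j) (lform_homog (col (lift ord0 j) M)); rewrite mul1n.
Qed.

Lemma meval_homogenize p (v : 'rV[k]_t.+1) : (v *m M) 0 ord0 != 0 ->
  (homogenize p).@[v 0] = (v *m M) 0 ord0 ^+ msize p * p.@[affine_coord v].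
Proof.
move=> l0; rewrite [p.@[_]]mevalE mulr_sumr (raddf_sum (meval _)) big_seq [RHS]big_seq.
apply: eq_bigr => m mp /=.
rewrite mevalZ mevalM rmorphXn rmorph_prod /= meval_lform_col [RHS]mulrCA; congr (_ * _).
have lem : (mdeg m <= msize p)%N by apply: ltnW; apply: msize_mdeg_lt.
rewrite -[in RHS](subnK lem) exprD -mulrA; congr (_ * _).
rewrite mdegE -prodrXr -big_split; apply: eq_bigr => j _ /=.
by rewrite rmorphXn /= meval_lform_col -exprMn /affine_coord mulrC divfK.
Qed.

Hypothesis UM : M \in unitmx.

Lemma affine_surj (y : 'rV[k]_t) : exists v : 'rV[k]_t.+1,
  (v *m M) 0 ord0 = 1 /\ forall j, affine_coord v j = y 0 j.
Proof.
pose z : 'rV[k]_t.+1 := \row_i (if unlift ord0 i is Some j then y 0 j else 1).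
have z0 : z 0 ord0 = 1 by rewrite mxE unlift_none.
exists (z *m invmx M); rewrite /affine_coord mulmxKV // z0; split=> // j.
by rewrite divr1 mxE liftK.
Qed.

Lemma affine_generic (v : nat -> 'rV[k]_t.+1) : generic v ->
  (forall i, (v i *m M) 0 ord0 != 0) -> forall p : {mpoly k[t]}, p <> 0 ->
  exists N, forall i, (N <= i)%N -> p.@[affine_coord (v i)] <> 0.
Proof.
move=> genv vM p p0.
have [|N HN] := genv _ _ (homogenize_homog p).
  move=> h0; have [y py] := mpoly_nonroot p0; have [v' [v'0 v'y]] := affine_surj y.
  apply: py; have := @meval_homogenize p v'; rewrite v'0 oner_neq0 expr1n mul1r h0 meval0.
  by move=> /(_ isT) E; rewrite -(meval_eq _ v'y) -E.
exists N => i leN pi; apply: (HN i leN).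
by rewrite meval_homogenize // pi mulr0.
Qed.

End Coordinates.

(** * The algebra R is noetherian *)

Lemma pihomogZ (k : fieldType) n m a (f : {mpoly k[n]}) :
  pihomog mdeg m (a *: f) = a *: pihomog mdeg m f.
Proof. exact: linearZ. Qed.

Section TwistComponents.
Variables (k : fieldType) (n : nat) (Phi : graded_aut k n).
Local Notation U := {mpoly k[n]}.
Implicit Types (f g h : U).

Lemma pihomog_aut e f : pihomog mdeg e (Phi f) = Phi (pihomog mdeg e f).
Proof.
move: f; apply: twist_ind => [|g g' Hg Hg'|d' g gh].
- by rewrite pihomog0 !rmorph0 pihomog0.
- by rewrite rmorphD !pihomogD rmorphD Hg Hg'.
have [<-|ne] := eqVneq d' e; first by rewrite !pihomog_dE ?gaut_homog.
by rewrite (pihomog_ne0 ne gh) rmorph0 (pihomog_ne0 ne (gaut_homog Phi gh)).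
Qed.

Lemma pihomog_iter_aut b e f : pihomog mdeg e (iter b Phi f) = iter b Phi (pihomog mdeg e f).
Proof. by elim: b => //= b IHb; rewrite pihomog_aut IHb. Qed.

Lemma pihomog_twist m f g : pihomog mdeg m (@twist_mul k n Phi f g) =
  \sum_(b < m.+1) iter b Phi (pihomog mdeg (m - b) f) * pihomog mdeg b g.
Proof.
move: g; apply: twist_ind => [|g g' Hg Hg'|e g gh].
- by rewrite twist_mul0 pihomog0 big1 // => b _; rewrite pihomog0 mulr0.
- rewrite twist_mulDr pihomogD Hg Hg' -big_split; apply: eq_bigr => b _ /=.
  by rewrite pihomogD mulrDr.
rewrite (twist_mul_homog _ _ gh) (pihomog_mulr _ _ gh).
case: leqP => [le|lt].
  rewrite (bigD1 (Ordinal (le : e < m.+1)%N)) //= (pihomog_dE gh) big1 ?addr0.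
    by rewrite pihomog_iter_aut.
  by move=> b ne; rewrite (@pihomog_ne0 _ _ _ e b g) ?mulr0 // eq_sym.
rewrite big1 // => b _; rewrite (@pihomog_ne0 _ _ _ e b g) ?mulr0 //.
by rewrite neq_ltn [(b < e)%N](leq_ltn_trans _ lt) ?orbT // -ltnS.
Qed.

End TwistComponents.

Lemma all_pihomog0 (k : fieldType) n (f : {mpoly k[n]}) :
  (forall m, pihomog mdeg m f = 0) -> f = 0.
Proof.
move=> f0; rewrite (@pihomog_partitionE _ _ mdeg (msize f) f) // big1 //.
Qed.

Section Ring.
Variables (k : closedFieldType) (t : nat) (Phi : graded_aut k t.+1).
Variables (phi : autP k t) (c : point k t) (ind : induces Phi phi).
Local Notation U := {mpoly k[t.+1]}.
Local Notation w := (orbit_vec Phi c).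
Local Notation R := (Ralg Phi c).

Definition Rval (x : R) : U := gen_val x.

Lemma RvalM x y : Rval (x * y) = @twist_mul k t.+1 Phi (Rval x) (Rval y).
Proof. by []. Qed.

Lemma RvalD x y : Rval (x + y) = Rval x + Rval y. Proof. by []. Qed.
Lemma RvalN x : Rval (- x) = - Rval x. Proof. by []. Qed.
Lemma RvalZ a x : Rval (a *: x) = a *: Rval x. Proof. by []. Qed.
Lemma Rval1 : Rval 1 = 1. Proof. by []. Qed.
Lemma Rval_inj : injective Rval. Proof. by move=> x y E; apply: val_inj. Qed.

Lemma Rval_generator (f : U) : f \is 1.-homog -> f.@[w 0 0] = 0 -> exists x, Rval x = f.
Proof.
move=> fh f0; suff fR : (f : zhang_twist Phi) \in in_subalg (fun f : zhang_twist Phi =>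
    (f : {mpoly k[t.+1]}) \is 1.-homog /\ vanishes f c) by exists (GenSubalg fR).
apply/asboolP => P _; apply; split=> //.
exact/(vanishesP (orbit_vec_line ind c 0) (orbit_vec_neq0 Phi c 0) fh).
Qed.

Lemma Rval_ind (P : U -> Prop) : P 1 -> (forall a f g, P f -> P g -> P (a *: f + g)) ->
  (forall f g, P f -> P g -> P (@twist_mul k t.+1 Phi f g)) ->
  (forall f : U, f \is 1.-homog -> f.@[w 0 0] = 0 -> P f) -> forall x, P (Rval x).
Proof.
move=> P1 PL PM Pg [f /= /asboolP]; apply; first by split.
move=> g [gh gc]; apply: Pg => //.
exact/(vanishesP (orbit_vec_line ind c 0) (orbit_vec_neq0 Phi c 0) gh).
Qed.

(** In a product, the degree [b] component of the right factor vanishes at index [i] if [i < b];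
    otherwise the twisted left factor at [i] is the untwisted one at [i - b], which vanishes by
    induction. *)
Lemma Rval_vanish x m i : (i < m)%N -> (pihomog mdeg m (Rval x)).@[w (Posz i) 0] = 0.
Proof.
move: m i; apply: (@Rval_ind (fun f => forall m i, (i < m)%N ->
  (pihomog mdeg m f).@[w (Posz i) 0] = 0)) =>
  [m i lt|a f g Hf Hg m i lt|f g Hf Hg m i lt|f fh f0 m i lt].
- by rewrite (@pihomog_ne0 _ _ _ 0 m) ?dhomog1 ?meval0 // neq_ltn (leq_ltn_trans _ lt).
- by rewrite pihomogD pihomogZ mevalD mevalZ Hf // Hg // mulr0 addr0.
- rewrite pihomog_twist (raddf_sum (meval _)) big1 //= => b _; rewrite mevalM.
  have [lti|leb] := ltnP i b; first by rewrite (Hg b) ?mulr0.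
  rewrite -(subnK leb) PoszD meval_iter_aut Hf ?mul0r //.
  by move: lt; have := ltn_ord b; move: leb; clear; lia.
- have [E|ne] := eqVneq 1%N m; last by rewrite (pihomog_ne0 ne fh) meval0.
  by rewrite -E in lt *; rewrite (pihomog_dE fh); case: i lt.
Qed.

(* [tau] is 0 for left ideals; for right ideals [tau n = n] undoes the twist. *)
Definition leading (tau : nat -> nat) (I : R -> Prop) (m : nat) (F : U) : Prop :=
  F \is m.-homog /\ exists x, [/\ I x, forall j, (m < j)%N -> pihomog mdeg j (Rval x) = 0
    & pihomog mdeg m (Rval x) = iter (tau m) Phi F].

(** Once the modules of leading forms are stable, subtracting an element of [I N] with the same
    leading form lowers the degree, and descent ends at zero. *)
Lemma leading_acc tau (v : nat -> 'rV[k]_t.+1) (I : nat -> R -> Prop) : (2 <= t)%N ->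
  separated v -> generic v ->
  (forall s, is_subspace (I s)) -> (forall s x, I s x -> I s.+1 x) ->
  (forall s, orbit_module v (leading tau (I s))) ->
  exists N, forall s x, (N <= s)%N -> I s x -> I N x.
Proof.
move=> t2 sepv genv subI incI modI.
have [|N HN] := @orbit_module_acc k t t2 v sepv genv (fun s => leading tau (I s)) modI.
  by move=> s m F [Fh [x [/incI Ix x0 Ex]]]; split=> //; exists x.
exists N => s x les Ix; have [d Hd] : exists d, forall j, (d <= j)%N -> pihomog mdeg j (Rval x) = 0.
  by exists (msize (Rval x)) => j; apply: pihomog_ge.
elim: d x Ix Hd => [|d IHd] x Ix Hd.
  have -> : x = 0 by apply: Rval_inj; apply: all_pihomog0 => m; apply: Hd.
  by have [] := subI N.
have [F Fh EF] := iter_aut_surj_homog Phi (tau d) (pihomogP mdeg d (Rval x)).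
have [|_ [y [Iy y0 Ey]]] := HN s d F les.
  by split=> //; exists x; split.
have Iy' : I s y by apply: (chain_le incI les).
rewrite -[x](subrK y) -[x - y]scale1r; have [_ IL] := subI N; apply: IL => //.
apply: IHd; first exact: subspaceB.
move=> j; rewrite leq_eqVlt => /predU1P[<-|ltj]; rewrite RvalD RvalN pihomogB.
  by rewrite Ey EF subrr.
by rewrite Hd // y0 // subrr.
Qed.

Hypotheses (t2 : (2 <= t)%N) (crit : critical_density phi c).

Lemma ideal_scale (I : R -> Prop) a x : is_left_ideal I -> I x -> I (a *: x).
Proof. by move=> [_ _ IM] Ix; rewrite -[x]mul1r scalerAl; apply: IM. Qed.

Theorem Ralg_left_noetherian : left_noetherian R.
Proof.
move=> I idI incI.
have pos_inj : injective Posz by move=> i j [].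
apply: (@leading_acc (fun _ => 0%N) (fun i => w (Posz i))) => //.
- exact: (orbit_separated ind crit pos_inj).
- exact: (orbit_generic ind crit pos_inj).
- move=> s; have [I0 ID _] := idI s; split=> // a x y Ix Iy; apply: ID => //.
  exact: ideal_scale.
move=> s; have [I0 ID IM] := idI s; split=> [m|m F []//|m F i lt [_ [x [_ _ /= <-]]]|m F l lh lm].
- split; first by split; rewrite ?dhomog0 //; exists 0; split=> // *; rewrite pihomog0.
  move=> a F G [Fh [x [Ix x0 Ex]]] [Gh [y [Iy y0 Ey]]]; split; first by rewrite dhomogD ?dhomogZ.
  exists (a *: x + y); split=> [|j ltj|].
  + by apply: ID => //; apply: ideal_scale.
  + by rewrite RvalD RvalZ pihomogD pihomogZ x0 ?y0 ?scaler0 ?addr0.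
  + by rewrite RvalD RvalZ pihomogD pihomogZ Ex Ey.
- exact: Rval_vanish.
move=> [Fh [x [Ix x0 /= Ex]]]; split; first exact: (dhomogM lh Fh).
(* Left multiplication by [y] acts on degree [m] as ordinary multiplication by the [m]-fold twist of
   [y], so [y] vanishes at [c_0] because [l] vanishes at [c_m]. *)
have [y yh Ey] := iter_aut_surj_homog Phi m lh.
have [|Y EY] := Rval_generator yh.
  by rewrite -(meval_iter_aut Phi c m) Ey add0r.
have Ypi j : pihomog mdeg j.+1 (Rval (Y * x)) = iter j Phi y * pihomog mdeg j (Rval x).
  rewrite RvalM EY pihomog_twist (bigD1 (inord j)) //= inordK // subSnn (pihomog_dE yh).
  rewrite big1 ?addr0 // => b nb; rewrite (pihomog_ne0 _ yh) ?iter_gaut0 ?mul0r //.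
  apply: contra nb => /eqP E; apply/eqP/val_inj; rewrite /= inordK //.
  by have := ltn_ord b; move: E; clear; lia.
exists (Y * x); split; first exact: IM.
  by case=> // j ltj; rewrite Ypi x0 ?mulr0.
by rewrite Ypi Ey Ex.
Qed.

(** Right multiplication by a linear [Y] twists the leading form once more. With
    [Y = iter m.+1 Phi l] the untwisted leading form is multiplied by [l], and [Y] vanishes at [c_0]
    when [l] vanishes at index [Negz m]; hence the reversed orbit. *)
Theorem Ralg_right_noetherian : left_noetherian R^c.
Proof.
move=> I idI incI.
have neg_inj : injective Negz by move=> i j [].
have scaleI s a x : I s x -> I s (a *: x : R).
  have [_ _ IM] := idI s; move=> Ix.
  have -> : a *: (x : R) = (x : R) * (a *: 1) by rewrite -scalerAr mulr1.
  exact: (IM (a *: (1 : R)) x Ix).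
apply: (@leading_acc id (fun i => w (Negz i))) => //.
- exact: (orbit_separated ind crit neg_inj).
- exact: (orbit_generic ind crit neg_inj).
- by move=> s; have [I0 ID _] := idI s; split=> // a x y Ix Iy; apply: ID => //; apply: scaleI.
move=> s; have [I0 ID IM] := idI s; split=> [m|m F []//|m F i lt [_ [x [_ _ Ex]]]|m F l lh lm].
- split; first by split; rewrite ?dhomog0 //; exists 0; split=> // *; rewrite pihomog0 ?iter_gaut0.
  move=> a F G [Fh [x [Ix x0 Ex]]] [Gh [y [Iy y0 Ey]]]; split; first by rewrite dhomogD ?dhomogZ.
  exists (a *: x + y); split=> [|j ltj|].
  + by apply: ID => //; apply: scaleI.
  + by rewrite RvalD RvalZ pihomogD pihomogZ x0 ?y0 ?scaler0 ?addr0.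
  + by rewrite RvalD RvalZ pihomogD pihomogZ Ex Ey iter_gautD iter_gautZ.
- rewrite -(meval_iter_aut Phi c m) -Ex (_ : Negz i + m%:Z = Posz (m.-1 - i)).
    by apply: Rval_vanish; move: lt; clear; lia.
  by rewrite NegzE; move: lt; clear; lia.
move=> [Fh [x [Ix x0 Ex]]]; split; first exact: (dhomogM lh Fh).
have yh : iter m.+1 Phi l \is 1.-homog by apply: iter_gaut_homog.
have [|Y EY] := Rval_generator yh.
  by rewrite (_ : 0 = Negz m + m.+1%:Z) ?meval_iter_aut // NegzE addNr.
have Ypi j : pihomog mdeg j.+1 (Rval (x * Y)) = Phi (pihomog mdeg j (Rval x)) * iter m.+1 Phi l.
  by rewrite RvalM EY (twist_mul_homog _ _ yh) (pihomog_mulr _ _ yh) /= subn1 pihomog_aut.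
exists (x * Y); split; first exact: (IM Y x Ix).
  by case=> // j ltj; rewrite Ypi x0 ?rmorph0 ?mul0r.
by rewrite Ypi Ex -iterS mulrC iter_gautM.
Qed.

End Ring.

(** * The infinite blowup *)

Lemma mpoly_subring_ind (k : fieldType) n (P : {mpoly k[n]} -> Prop) :
  (forall c, P c%:MP) -> (forall i, P 'X_i) ->
  (forall f g, P f -> P g -> P (f + g)) -> (forall f g, P f -> P g -> P (f * g)) ->
  forall f, P f.
Proof.
move=> PC PX PD PM f; rewrite [f]mpolyE.
elim/big_ind: _ => // [|m _]; first by rewrite -mpolyC0; apply: PC.
rewrite -mul_mpolyC mpolyXE_id; apply: (PM) => //.
elim/big_ind: _ => // [|i _]; first by rewrite -mpolyC1; apply: PC.
elim: (m i) => [|d IHd]; first by rewrite expr0 -mpolyC1; apply: PC.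
by rewrite exprS; apply: PM.
Qed.

Section Specialise.
Variables (k : fieldType) (p : nat).
Local Notation A := {mpoly k[p.+1]}.

Definition spec0 (c : k) : A -> A :=
  mmap (@mpolyC _ _) (fun i : 'I_p.+1 => if i == ord0 then c%:MP else 'X_i).

HB.instance Definition _ c := GRing.RMorphism.on (spec0 c).

Lemma spec0C c d : spec0 c d%:MP = d%:MP. Proof. by rewrite /spec0 mmapC. Qed.

Lemma spec0X c i : spec0 c 'X_i = if i == ord0 then c%:MP else 'X_i.
Proof. by rewrite /spec0 mmapX mmap1U. Qed.

Lemma spec0_divides c f : divides ('X_ord0 - c%:MP) (f - spec0 c f).
Proof.
elim/mpoly_subring_ind: f => [d|i|f g [f' Hf] [g' Hg]|f g [f' Hf] [g' Hg]].
- by exists 0; rewrite spec0C subrr mulr0.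
- rewrite spec0X; case: eqP => [->|_]; first by exists 1; rewrite mulr1.
  by exists 0; rewrite subrr mulr0.
- by exists (f' + g'); rewrite rmorphD /= mulrDr -Hf -Hg opprD addrACA.
- exists (f' * g + spec0 c f * g').
  by rewrite rmorphM /= mulrDr mulrA -Hf [_ * (spec0 c f * g')]mulrCA -Hg; ring.
Qed.

Lemma spec0_eq0 c f : spec0 c f = 0 <-> divides ('X_ord0 - c%:MP) f.
Proof.
split=> [f0|[g ->]]; first by have := spec0_divides c f; rewrite f0 subr0.
by rewrite rmorphM /= rmorphB /= spec0C spec0X eqxx subrr mul0r.
Qed.

Lemma prime_spec0 c : prime_elt ('X_ord0 - c%:MP : A).
Proof.
have p0 : spec0 c ('X_ord0 - c%:MP) = 0 by rewrite rmorphB /= spec0C spec0X eqxx subrr.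
split.
- move=> /(congr1 (mcoeff U_(ord0))); rewrite mcoeffB mcoeffC mcoeffXU mcoeff0 mnm1_eq0.
  by rewrite mulr0 subr0 => /eqP; rewrite oner_eq0.
- move=> [g /(congr1 (spec0 c))]; rewrite rmorphM /= p0 mul0r rmorph1 => /eqP.
  by rewrite eq_sym oner_eq0.
- move=> f g /spec0_eq0/eqP; rewrite rmorphM /= mulf_eq0.
  by move=> /orP[]/eqP/spec0_eq0; [left|right].
Qed.

End Specialise.

(** * Charts and exceptional divisors *)

Section Blowup.
Variables (k : closedFieldType) (p : nat) (a : nat -> 'I_p.+1 -> k).
Hypothesis a_distinct : forall i j, i <> j -> a i ord0 <> a j ord0.
Local Notation A := {mpoly k[p.+1]}.
Local Notation F := (ratfun k p.+1).
Local Notation B := (infinite_blowup a).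

Definition incF : A -> F := @tofrac A.
HB.instance Definition _ := GRing.RMorphism.on incF.

Lemma incF_inj : injective incF.
Proof. by move=> f g /eqP; rewrite tofrac_eq => /eqP. Qed.

Definition Bval (x : B) : F := gen_val x.
Fact Bval_is_zmod_morphism : zmod_morphism Bval. Proof. by []. Qed.
Fact Bval_is_monoid_morphism : monoid_morphism Bval. Proof. by []. Qed.
HB.instance Definition _ := GRing.isZmodMorphism.Build B F Bval Bval_is_zmod_morphism.
HB.instance Definition _ := GRing.isMonoidMorphism.Build B F Bval Bval_is_monoid_morphism.

Lemma Bval_inj : injective Bval. Proof. by move=> x y E; apply: val_inj. Qed.
Lemma BvalD x y : Bval (x + y) = Bval x + Bval y. Proof. by []. Qed.
Lemma BvalM x y : Bval (x * y) = Bval x * Bval y. Proof. by []. Qed.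
Lemma BvalB x y : Bval (x - y) = Bval x - Bval y. Proof. by []. Qed.
Lemma BvalN x : Bval (- x) = - Bval x. Proof. by []. Qed.
Lemma BvalZ c x : Bval (c *: x) = incF c%:MP * Bval x. Proof. by []. Qed.

Lemma B_generator f : blowup_gens a f -> exists x, Bval x = f.
Proof.
move=> gf; suff fB : f \in in_subalg (blowup_gens a) by exists (GenSubalg fB).
by apply/asboolP => P _; apply.
Qed.

Lemma Bval_ind (P : F -> Prop) : P 1 -> (forall c f g, P f -> P g -> P (incF c%:MP * f + g)) ->
  (forall f g, P f -> P g -> P (f * g)) ->
  (forall f, P (incF f)) ->
  (forall i j, P (blowup_lin a i j / blowup_lin a i ord0)) -> forall x, P (Bval x).
Proof.
move=> P1 PL PM PA Pz [f /= /asboolP]; apply; first by split.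
move=> g [[q ->]|[l [j [i [l0 _ ->]]]]]; first exact: PA.
by rewrite (_ : l = ord0) //; apply: val_inj.
Qed.

Lemma jB_ex : exists j : A -> B, forall f, Bval (j f) = incF f.
Proof.
have /choice[j Hj] : forall f, exists x : B, Bval x = incF f.
  by move=> f; apply: B_generator; left; exists f.
by exists j.
Qed.

Definition jB : A -> B := sval (cid jB_ex).
Lemma jBE f : Bval (jB f) = incF f. Proof. exact: (svalP (cid jB_ex)). Qed.

Fact jB_is_zmod_morphism : zmod_morphism jB.
Proof. by move=> f g; apply: Bval_inj; rewrite BvalB !jBE rmorphB. Qed.
Fact jB_is_monoid_morphism : monoid_morphism jB.
Proof.
split=> [|f g]; apply: Bval_inj; first by rewrite jBE !rmorph1.
by rewrite BvalM !jBE rmorphM.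
Qed.
HB.instance Definition _ := GRing.isZmodMorphism.Build A B jB jB_is_zmod_morphism.
HB.instance Definition _ := GRing.isMonoidMorphism.Build A B jB jB_is_monoid_morphism.

Definition pl i : A := 'X_ord0 - (a i ord0)%:MP.

Lemma pl_neq0 i : incF (pl i) != 0.
Proof.
rewrite tofrac_eq0; apply/eqP; by have [] := prime_spec0 p (a i ord0).
Qed.

Lemma zB_ex i j : exists x, Bval x = blowup_lin a i j / blowup_lin a i ord0.
Proof.
have [->|nj] := eqVneq j ord0.
  by exists 1; rewrite rmorph1 /= divff // pl_neq0.
by apply: B_generator; right; exists ord0, j, i; rewrite lt0n.
Qed.

Definition zB i j : B := sval (cid (zB_ex i j)).
Lemma zBE i j : Bval (zB i j) = blowup_lin a i j / blowup_lin a i ord0.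
Proof. exact: (svalP (cid (zB_ex i j))). Qed.

Lemma pl_zB i j : incF (pl i) * Bval (zB i j) = incF ('X_j - (a i j)%:MP).
Proof. by rewrite zBE mulrC divfK // pl_neq0. Qed.

Definition Q (L : seq nat) : A := \prod_(i <- L) pl i.

Lemma Q_cat L L' : Q (L ++ L') = Q L * Q L'. Proof. exact: big_cat. Qed.
Lemma Q_nil : Q [::] = 1. Proof. exact: big_nil. Qed.

(* The chart of the [n]-th exceptional divisor: [rho] embeds the coordinate ring of
   the blowup chart, with coordinates [y_1 - a_n1] and [(y_j - a_nj) / (y_1 - a_n1)];
   [theta] is the blowup map, so that [rho \o theta] is the inclusion [incF]. *)
Section Chart.
Variable n : nat.

Definition theta : A -> A := mmap (@mpolyC _ _)
  (fun j : 'I_p.+1 => if j == ord0 then 'X_ord0 + (a n ord0)%:MP else (a n j)%:MP + 'X_ord0 * 'X_j).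
HB.instance Definition _ := GRing.RMorphism.on theta.

Definition rho : A -> F := mmap (incF \o @mpolyC _ _)
  (fun j : 'I_p.+1 => if j == ord0 then incF (pl n) else Bval (zB n j)).
HB.instance Definition _ := GRing.RMorphism.on rho.

Lemma thetaC c : theta c%:MP = c%:MP. Proof. by rewrite /theta mmapC. Qed.
Lemma thetaX j : theta 'X_j =
  if j == ord0 then 'X_ord0 + (a n ord0)%:MP else (a n j)%:MP + 'X_ord0 * 'X_j.
Proof. by rewrite /theta mmapX mmap1U. Qed.
Lemma rhoC c : rho c%:MP = incF c%:MP. Proof. by rewrite /rho mmapC. Qed.
Lemma rhoX j : rho 'X_j = if j == ord0 then incF (pl n) else Bval (zB n j).
Proof. by rewrite /rho mmapX mmap1U. Qed.

Lemma rho_theta f : rho (theta f) = incF f.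
Proof.
apply: (mpoly_rmorph_ext (f := rho \o theta) (g := incF)) => [c|j] /=.
  by rewrite thetaC rhoC.
rewrite thetaX; case: eqP => [->|/eqP/negbTE nj].
  by rewrite rmorphD /= rhoX rhoC eqxx -rmorphD /pl subrK.
by rewrite rmorphD /= rmorphM /= !rhoX rhoC nj eqxx pl_zB -rmorphD addrC subrK.
Qed.

Lemma theta_clear b : exists N f, 'X_ord0 ^+ N * b = theta f.
Proof.
elim/mpoly_subring_ind: b => [c|i|b b' [N [f Hf]] [N' [f' Hf']]|b b' [N [f Hf]] [N' [f' Hf']]].
- by exists 0%N, c%:MP; rewrite mul1r thetaC.
- have [->|/negbTE ni] := eqVneq i ord0.
    by exists 0%N, ('X_ord0 - (a n ord0)%:MP); rewrite mul1r rmorphB /= thetaX thetaC eqxx addrK.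
  by exists 1%N, ('X_i - (a n i)%:MP); rewrite rmorphB /= thetaX thetaC ni addrC addKr.
- have EX : 'X_ord0 = theta (pl n) by rewrite rmorphB /= thetaX thetaC eqxx addrK.
  exists (N + N')%N, (pl n ^+ N' * f + pl n ^+ N * f').
  by rewrite rmorphD /= !rmorphM /= !rmorphXn /= -EX -Hf -Hf' exprD; ring.
- by exists (N + N')%N, (f * f'); rewrite rmorphM /= -Hf -Hf' exprD; ring.
Qed.

(** By [theta_clear] a kernel element times a power of ['X_ord0] comes from [theta], on whose image
    [rho] is the injective [incF]. *)
Lemma rho_inj : injective rho.
Proof.
move=> b b' /eqP; rewrite -subr_eq0 -rmorphB => /eqP E; apply/eqP; rewrite -subr_eq0.
have [N [f Ef]] := theta_clear (b - b').
have f0 : f = 0.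
  by apply: incF_inj; rewrite -rho_theta -Ef rmorphM /= E mulr0 rmorph0.
move/eqP: Ef; rewrite f0 rmorph0 /= mulf_eq0 expf_eq0 => /orP[/andP[_]|//].
by have [X0 _ _] := prime_spec0 p (0 : k); move=> /eqP; rewrite mpolyC0 subr0 in X0 *.
Qed.

Lemma rho_in_B b : exists x, Bval x = rho b.
Proof.
elim/mpoly_subring_ind: b => [c|i|b b' [x Hx] [x' Hx']|b b' [x Hx] [x' Hx']].
- by exists (jB c%:MP); rewrite jBE rhoC.
- rewrite rhoX; case: eqP => _; first by exists (jB (pl n)); rewrite jBE.
  by exists (zB n i).
- by exists (x + x'); rewrite !rmorphD /= Hx Hx'.
- by exists (x * x'); rewrite !rmorphM /= Hx Hx'.
Qed.

(** Only denominators [pl i] with [i] different from [n] have to be cleared, since the quotients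
    with index [n] already belong to the chart. *)
Lemma chart_clear x : exists L b, n \notin L /\ incF (Q L) * Bval x = rho b.
Proof.
move: x; apply: (@Bval_ind (fun x => exists L b, n \notin L /\ incF (Q L) * x = rho b)).
- by exists [::], 1; rewrite Q_nil mulr1 !rmorph1.
- move=> c f g [L [b [nL Hf]]] [L' [b' [nL' Hg]]].
  exists (L ++ L'), (c%:MP * theta (Q L') * b + theta (Q L) * b').
  rewrite mem_cat negb_or nL nL'; split=> //.
  by rewrite rmorphD /= !rmorphM /= -Hf -Hg rhoC !rho_theta Q_cat rmorphM; ring.
- move=> f g [L [b [nL Hf]]] [L' [b' [nL' Hg]]]; exists (L ++ L'), (b * b').
  rewrite mem_cat negb_or nL nL'; split=> //.
  by rewrite rmorphM /= -Hf -Hg Q_cat rmorphM; ring.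
- by move=> f; exists [::], (theta f); rewrite Q_nil rmorph1 /= mul1r rho_theta.
move=> i j; rewrite -zBE; have [->|ni] := eqVneq i n.
  have [x0|nj] := eqVneq j ord0.
    by exists [::], 1; rewrite x0 Q_nil !rmorph1 /= mul1r zBE divff // pl_neq0.
  by exists [::], 'X_j; rewrite Q_nil rmorph1 /= mul1r rhoX (negbTE nj).
exists [:: i], (theta ('X_j - (a i j)%:MP)); rewrite mem_seq1 eq_sym ni; split=> //.
by rewrite rho_theta /Q big_seq1 pl_zB.
Qed.

Lemma spec_theta f : spec0 0 (theta f) = (f.@[a n])%:MP.
Proof.
apply: (mpoly_rmorph_ext (f := spec0 0 \o theta) (g := @mpolyC _ _ \o meval (a n))) => [c|j] /=.
  by rewrite thetaC spec0C mevalC.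
rewrite thetaX mevalXU; case: eqP => [->|_].
  by rewrite rmorphD /= spec0X spec0C eqxx add0r.
by rewrite rmorphD /= rmorphM /= spec0C spec0X eqxx mul0r addr0.
Qed.

Lemma Q_eval L : n \notin L -> (Q L).@[a n] != 0.
Proof.
move=> nL; rewrite /Q rmorph_prod prodf_seq_neq0; apply/allP => i iL /=.
rewrite mevalB mevalXU mevalC subr_eq0; apply/eqP; apply: a_distinct.
by move=> E; rewrite E iL in nL.
Qed.

(** This is reduction modulo the [n]-th exceptional divisor: restrict the cleared element to
    ['X_ord0 = 0], where [Q L] is a nonzero constant, and divide by that constant. *)
Lemma chi_ex : exists chi : B -> A, forall x L b, n \notin L ->
  incF (Q L) * Bval x = rho b -> spec0 0 b = (Q L).@[a n] *: chi x.
Proof.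
suff /choice[f Hf] : forall x, exists y, forall L b, n \notin L ->
  incF (Q L) * Bval x = rho b -> spec0 0 b = (Q L).@[a n] *: y by exists f.
move=> x.
have [L0 [b0 [nL0 E0]]] := chart_clear x.
exists ((Q L0).@[a n]^-1 *: spec0 0 b0) => L b nL E.
have /rho_inj/(congr1 (spec0 0)) : rho (theta (Q L0) * b) = rho (theta (Q L) * b0).
  by rewrite !rmorphM /= !rho_theta -E -E0 mulrCA.
rewrite !rmorphM /= !spec_theta !mul_mpolyC => EE.
by rewrite scalerA mulrC -scalerA -EE scalerA mulVf ?scale1r // Q_eval.
Qed.

Definition chi : B -> A := sval (cid chi_ex).

Lemma chi_spec x L b : n \notin L -> incF (Q L) * Bval x = rho b ->
  spec0 0 b = (Q L).@[a n] *: chi x.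
Proof. exact: (svalP (cid chi_ex)). Qed.

Lemma chi_rho x b : Bval x = rho b -> chi x = spec0 0 b.
Proof.
move=> E; rewrite (@chi_spec x [::] b) ?Q_nil ?rmorph1 /= ?mul1r //.
by rewrite scale1r.
Qed.

Lemma chi_jB f : chi (jB f) = (f.@[a n])%:MP.
Proof. by rewrite (@chi_rho _ (theta f)) ?spec_theta // jBE rho_theta. Qed.

Lemma chi_zB j : j != ord0 -> chi (zB n j) = 'X_j.
Proof. by move=> nj; rewrite (@chi_rho _ 'X_j) ?spec0X ?rhoX (negbTE nj). Qed.

Lemma chi_linear c x y : chi (c *: x + y) = c *: chi x + chi y.
Proof.
have [L [b [nL E]]] := chart_clear x; have [L' [b' [nL' E']]] := chart_clear y.
have nLL : n \notin L ++ L' by rewrite mem_cat negb_or nL.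
have Qn := Q_eval nLL; apply: (scalerI Qn).
have := @chi_spec (c *: x + y) (L ++ L') (c%:MP * theta (Q L') * b + theta (Q L) * b') nLL.
rewrite BvalD BvalZ rmorphD !rmorphM /= rhoC !rho_theta -E -E' Q_cat rmorphM => <-; last by ring.
rewrite !rmorphD /= !rmorphM /= !spec_theta spec0C (chi_spec nL E) (chi_spec nL' E').
rewrite scalerDr !scalerA -mpolyCM !mul_mpolyC !scalerA; congr (_ *: _ + _); ring.
Qed.

Lemma chiM x y : chi (x * y) = chi x * chi y.
Proof.
have [L [b [nL E]]] := chart_clear x; have [L' [b' [nL' E']]] := chart_clear y.
have nLL : n \notin L ++ L' by rewrite mem_cat negb_or nL.
have Qn := Q_eval nLL; apply: (scalerI Qn).
have := @chi_spec (x * y) (L ++ L') (b * b') nLL.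
rewrite !rmorphM /= -E -E' Q_cat rmorphM => <-; last by ring.
rewrite (chi_spec nL E) (chi_spec nL' E') mevalM.
by rewrite -scalerAl -scalerAr scalerA.
Qed.

(** The exceptional divisor lies over the single point [a n], so a polynomial in the [y_j] is
    constant on it. *)
Lemma jB_residue f : divides (jB (pl n)) (jB f - jB (f.@[a n])%:MP).
Proof.
have : spec0 0 (theta (f - (f.@[a n])%:MP)) = 0.
  by rewrite spec_theta mevalB mevalC subrr mpolyC0.
move=> /spec0_eq0[g]; rewrite subr0 => /(congr1 rho).
rewrite rho_theta rmorphM /= rhoX eqxx => E; have [y Ey] := rho_in_B g.
by exists y; apply: Bval_inj; rewrite BvalB BvalM !jBE Ey -E rmorphB.
Qed.

(** The chart gives that [pl n] divides [Q L] times [x] in [B]; as [Q L] is a nonzero constant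
    modulo [pl n], it divides [x]. Thus [pl n] generates the kernel of a map to a domain, and is
    prime. *)
Lemma chi_eq0 x : chi x = 0 -> divides (jB (pl n)) x.
Proof.
move=> x0; have [L [b [nL E]]] := chart_clear x; have := chi_spec nL E.
rewrite x0 scaler0 => /spec0_eq0[b']; rewrite subr0 => Eb.
move: E; rewrite Eb rmorphM /= rhoX eqxx => E.
have [rb Erb] := rho_in_B b'; have [s Es] := jB_residue (Q L).
pose q := (Q L).@[a n]; have q0 : q != 0 := Q_eval nL.
exists (q^-1 *: (rb - s * x)); apply: Bval_inj.
have Es' : incF (Q L) - incF q%:MP = incF (pl n) * Bval s.
  by rewrite -!jBE -BvalB Es BvalM.
rewrite BvalM BvalZ jBE BvalB BvalM Erb.
have -> : incF (pl n) * (incF q^-1%:MP * (rho b' - Bval s * Bval x)) =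
   incF q^-1%:MP * (incF (pl n) * rho b' - (incF (pl n) * Bval s) * Bval x) by ring.
rewrite -E -Es'.
have -> : incF q^-1%:MP * (incF (Q L) * Bval x - (incF (Q L) - incF q%:MP) * Bval x) =
   (incF q^-1%:MP * incF q%:MP) * Bval x by ring.
by rewrite -rmorphM -mpolyCM mulVf // mpolyC1 rmorph1 /= mul1r.
Qed.

Lemma chi1 : chi 1 = 1.
Proof. by rewrite (@chi_rho _ 1) ?rmorph1. Qed.

Lemma chi0 : chi 0 = 0.
Proof. by rewrite (@chi_rho _ 0) ?rmorph0. Qed.

Lemma prime_pl : prime_elt (jB (pl n)).
Proof.
have cp : chi (jB (pl n)) = 0 by rewrite chi_jB mevalB mevalXU mevalC subrr mpolyC0.
split.
- move/(congr1 Bval); rewrite jBE rmorph0; exact/eqP/pl_neq0.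
- by move=> [y /(congr1 chi)]; rewrite chiM cp mul0r chi1 => /eqP; rewrite eq_sym oner_eq0.
- move=> x y [z /(congr1 chi)]; rewrite !chiM cp mul0r => /eqP.
  by rewrite mulf_eq0 => /orP[]/eqP/chi_eq0; [left|right].
Qed.

End Chart.
End Blowup.

(** * Noetherianity and unique factorisation of the blowup *)

Section BlowupNoetherian.
Variables (k : closedFieldType) (p : nat) (a : nat -> 'I_p.+1 -> k).
Hypothesis a_distinct : forall i j, i <> j -> a i ord0 <> a j ord0.
Hypothesis a_generic : forall f : {mpoly k[p.+1]}, f <> 0 ->
  exists N, forall i, (N <= i)%N -> f.@[a i] <> 0.
Local Notation A := {mpoly k[p.+1]}.
Local Notation F := (ratfun k p.+1).
Local Notation B := (infinite_blowup a).


Definition exc i : B := jB a (pl a i).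

Lemma no_zero_div_B : no_zero_div B.
Proof.
move=> x y /(congr1 (@Bval _ _ _)); rewrite BvalM rmorph0 => /eqP.
rewrite mulf_eq0 => /orP[]/eqP E; [left|right]; apply: Bval_inj; rewrite E rmorph0 //.
Qed.

Lemma prod_exc L : Bval (\prod_(i <- L) exc i) = incF (Q a L).
Proof. by rewrite !rmorph_prod; apply: eq_bigr => i _; rewrite /= jBE. Qed.

Lemma clear_to_A (x : B) : exists L f, incF (Q a L) * Bval x = incF f.
Proof.
move: x; apply: (@Bval_ind k p a (fun x => exists L f, incF (Q a L) * x = incF f)).
- by exists [::], 1; rewrite Q_nil mulr1 rmorph1.
- move=> c f g [L [b Hf]] [L' [b' Hg]]; exists (L ++ L'), (c%:MP * Q a L' * b + Q a L * b').
  by rewrite rmorphD !rmorphM /= -Hf -Hg Q_cat rmorphM; ring.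
- move=> f g [L [b Hf]] [L' [b' Hg]]; exists (L ++ L'), (b * b').
  by rewrite rmorphM /= -Hf -Hg Q_cat rmorphM; ring.
- by move=> f; exists [::], f; rewrite Q_nil rmorph1 mul1r.
move=> i j; exists [:: i], ('X_j - (a i j)%:MP).
by rewrite -zBE /Q big_seq1 pl_zB.
Qed.

(** The numerator of [f] is nonzero at almost all [a i], and modulo [exc i] it equals its value
    there, a unit. *)
Lemma comaximal_exc (f : B) : f <> 0 -> exists N, forall i, (N <= i)%N ->
  exists u v, 1 = f * u + exc i * v.
Proof.
move=> f0; have [L [b Eb]] := clear_to_A f.
have b0 : b <> 0.
  move=> b0; move: Eb; rewrite b0 rmorph0 => /eqP; rewrite mulf_eq0 => /orP[]/eqP E.
    move: E; rewrite rmorph_prod => /eqP; apply/negP.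
    by rewrite prodf_seq_neq0; apply/allP => i _; apply: pl_neq0.
  by apply: f0; apply: Bval_inj; rewrite E rmorph0.
have [N HN] := a_generic b0; exists N => i leN.
have /eqP bi := HN i leN; have [y Ey] := jB_residue a i b.
pose q := b.@[a i]; exists (q^-1 *: jB a (Q a L)), (- (q^-1 *: y)).
apply: Bval_inj; rewrite rmorph1 BvalD !BvalM BvalN !BvalZ.
have -> : Bval f * (incF q^-1%:MP * Bval (jB a (Q a L))) + Bval (exc i) * - (incF q^-1%:MP * Bval y)
  = incF q^-1%:MP * (incF (Q a L) * Bval f - Bval (exc i * y)) by rewrite jBE BvalM; ring.
rewrite -Ey BvalB !jBE Eb opprB addrC subrK -rmorphM -mpolyCM mulVf //.
Qed.

Lemma comaximal_prod (f : B) N L : (forall i, (N <= i)%N -> exists u v, 1 = f * u + exc i * v) ->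
  (forall i, i \in L -> (N <= i)%N) -> exists u v, 1 = f * u + \prod_(i <- L) exc i * v.
Proof.
move=> HN; elim: L => [|i L IHL] HL; first by exists 0, 1; rewrite big_nil !mulr1 mulr0 add0r.
have [|u [v E]] := IHL; first by move=> j jL; apply: HL; rewrite inE jL orbT.
have [|u' [v' E']] := HN i; first by apply: HL; rewrite mem_head.
rewrite big_cons; set X := \prod_(j <- L) _ in E *.
exists (u * (f * u' + exc i * v') + X * v * u'), (v * v').
by rewrite -[1]mulr1 {1}E E'; ring.
Qed.

Section Truncation.
Variable N : nat.
Local Notation index := ('I_p.+1 + 'I_N * 'I_p.+1)%type.

Definition trunc_gen (i : index) : B :=
  match i with inl j => jB a 'X_j | inr (i, j) => zB a i j end.

(** The image is the subalgebra generated over the polynomials by the quotients with [i < N];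
    presenting it by finitely many variables makes the basis theorem available. *)
Definition trunc : {mpoly k[#|{: index}|]} -> B :=
  mmap (jB a \o @mpolyC _ _) (fun i => trunc_gen (enum_val i)).

HB.instance Definition _ := GRing.RMorphism.on trunc.

Lemma trunc_gen_image i : exists u, trunc u = trunc_gen i.
Proof. by exists 'X_(enum_rank i); rewrite /trunc mmapX mmap1U enum_rankK. Qed.

Lemma jB_image f : exists u, trunc u = jB a f.
Proof.
elim/mpoly_subring_ind: f => [c|i|f g [u Hu] [u' Hu']|f g [u Hu] [u' Hu']].
- by exists c%:MP; rewrite /trunc mmapC.
- exact: (trunc_gen_image (inl i)).
- by exists (u + u'); rewrite !rmorphD /= Hu Hu'.
- by exists (u * u'); rewrite !rmorphM /= Hu Hu'.
Qed.

Lemma trunc_clear (x : B) : exists L u, (forall i, i \in L -> (N <= i)%N) /\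
  jB a (Q a L) * x = trunc u.
Proof.
suff [L [u [HL E]]] : exists L u, (forall i, i \in L -> (N <= i)%N) /\
    incF (Q a L) * Bval x = Bval (trunc u).
  by exists L, u; split=> //; apply: Bval_inj; rewrite BvalM jBE.
move: x; apply: (@Bval_ind k p a (fun x => exists L u, (forall i, i \in L -> (N <= i)%N) /\
  incF (Q a L) * x = Bval (trunc u))).
- by exists [::], 1; split=> //; rewrite Q_nil mulr1 !rmorph1.
- move=> c f g [L [u [HL Hf]]] [L' [u' [HL' Hg]]].
  have [v Ev] := jB_image (c%:MP * Q a L'); have [v' Ev'] := jB_image (Q a L).
  exists (L ++ L'), (v * u + v' * u'); split.
    by move=> i; rewrite mem_cat => /orP[/HL|/HL'].
  have -> : Bval (trunc (v * u + v' * u')) = Bval (trunc v) * Bval (trunc u) +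
    Bval (trunc v') * Bval (trunc u') by rewrite !rmorphD !rmorphM.
  by rewrite -Hf -Hg Ev Ev' !jBE Q_cat !rmorphM /=; ring.
- move=> f g [L [u [HL Hf]]] [L' [u' [HL' Hg]]].
  exists (L ++ L'), (u * u'); split; first by move=> i; rewrite mem_cat => /orP[/HL|/HL'].
  have -> : Bval (trunc (u * u')) = Bval (trunc u) * Bval (trunc u').
    by rewrite !rmorphM.
  by rewrite -Hf -Hg Q_cat rmorphM /=; ring.
- move=> f; have [u Eu] := jB_image f; exists [::], u.
  by rewrite Q_nil rmorph1 mul1r Eu jBE.
move=> i j; have [leN|ltN] := leqP N i.
  have [u Eu] := jB_image ('X_j - (a i j)%:MP); exists [:: i], u; split.
    by move=> i'; rewrite mem_seq1 => /eqP ->.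
  by rewrite -zBE /Q big_seq1 pl_zB Eu jBE.
have [u Eu] := trunc_gen_image (inr (Ordinal ltN, j)).
by exists [::], u; rewrite Q_nil rmorph1 mul1r Eu /= zBE.
Qed.

End Truncation.

(** Late exceptional elements are comaximal with a fixed nonzero [f] of the chain. So membership of
    [x] follows from membership of its product with them, and that product lies in a truncated
    subalgebra. *)
Theorem blowup_left_noetherian : left_noetherian B.
Proof.
move=> I idI incI.
have [[s1 [f If f0]]|no] := pselect (exists s, exists2 f, I s f & f <> 0); last first.
  exists 0%N => s x _ Ix; have [I0 _ _] := idI 0%N.
  by have [->//|/eqP x0] := eqVneq x 0; case: no; exists s, x.
have [N HN] := comaximal_exc f0.
pose J s u := I s (@trunc N u).
have [s|s u|N1 HN1] := left_noetherian_mpoly (I := J).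
- have [I0 ID IM] := idI s; split=> [|x y|x y]; rewrite /J.
  + by rewrite rmorph0.
  + by rewrite rmorphD; apply: ID.
  + by rewrite rmorphM; apply: IM.
- exact: incI.
exists (maxn s1 N1) => s x; rewrite geq_max => /andP[les1 lesN] Ix.
have [L [u [HL E]]] := trunc_clear N x.
have [v [w E1]] := comaximal_prod HN HL.
have [_ ID IM] := idI (maxn s1 N1).
rewrite -[x]mul1r E1 mulrDl; apply: ID.
  rewrite -mulrA mulrC; apply: IM; exact: (chain_le incI (leq_maxl _ _)) If.
rewrite mulrAC mulrC; apply: IM.
have -> : \prod_(i <- L) exc i * x = @trunc N u.
  by rewrite -E; congr (_ * _); rewrite rmorph_prod.
apply: (chain_le incI (leq_maxr s1 N1)); apply: (HN1 s) => //.
by rewrite /J -E; have [_ _ IMs] := idI s; apply: IMs.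
Qed.

Theorem blowup_noetherian : noetherian B.
Proof.
split; first exact: blowup_left_noetherian.
exact/left_noetherian_converse/blowup_left_noetherian.
Qed.

Theorem blowup_UFD : is_UFD B.
Proof.
apply: factorial_UFD; first exact: no_zero_div_B.
pose S (x : B) := exists i, x = exc i.
have SP x : S x -> prime_elt x by move=> [i ->]; apply: prime_pl.
(* The [pl i] are prime in both rings, and inverting them makes the rings equal because they are the
   only denominators of [B]. *)
apply: (@nagata A B F (@incF k p) (@Bval k p a) S) => //.
- move=> x y /eqP; rewrite mulf_eq0 => /orP[]/eqP; auto.
- exact: incF_inj.
- exact: Bval_inj.
- move=> _ [i ->]; exists (pl a i); first by rewrite /= jBE.
  by right; apply: prime_spec0.
- by move=> f; exists [::], (jB a f); rewrite big_nil rmorph1 mul1r /= jBE.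
- move=> x; have [L [f E]] := clear_to_A x; exists [seq exc i | i <- L], f; split.
    by move=> _ /mapP[i _ ->]; exists i.
  by rewrite big_map /= prod_exc.
- move=> x x0; apply: noetherian_extract => //.
  + exact: no_zero_div_B.
  + exact: blowup_left_noetherian.
  + by move=> y /SP[].
- exact: factorial_mpoly.
Qed.

End BlowupNoetherian.

(** * The tensor product is not noetherian *)

Section Direction.
Variables (k : fieldType) (n : nat).
Local Notation U := {mpoly k[n]}.

Definition dir_deriv (u v : 'rV[k]_n) (f : U) : k := \sum_i u 0 i * (f^`M(i)).@[v 0].

Lemma dir_deriv_linear u v c f g :
  dir_deriv u v (c *: f + g) = c * dir_deriv u v f + dir_deriv u v g.
Proof.
rewrite /dir_deriv mulr_sumr -big_split; apply: eq_bigr => i _ /=.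
by rewrite mderivD mderivZ mevalD mevalZ; ring.
Qed.

Lemma dir_deriv0 u v : dir_deriv u v 0 = 0.
Proof. by rewrite /dir_deriv big1 // => i _; rewrite mderiv0 meval0 mulr0. Qed.

Lemma dir_deriv_sum u v (T : Type) (s : seq T) (P : pred T) (G : T -> U) :
  dir_deriv u v (\sum_(i <- s | P i) G i) = \sum_(i <- s | P i) dir_deriv u v (G i).
Proof.
elim/big_rec2: _ => [|i y1 y2 _ IH]; first exact: dir_deriv0.
by rewrite -[G i]scale1r dir_deriv_linear IH mul1r scale1r.
Qed.

Lemma dir_derivM u v f g :
  dir_deriv u v (f * g) = dir_deriv u v f * g.@[v 0] + f.@[v 0] * dir_deriv u v g.
Proof.
rewrite /dir_deriv mulr_suml mulr_sumr -big_split; apply: eq_bigr => i _ /=.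
by rewrite mderivM mevalD !mevalM; ring.
Qed.

Lemma dir_deriv_lform u v w : dir_deriv u v (lform w) = (u *m w) 0 0.
Proof.
rewrite mxE; apply: eq_bigr => i _; congr (_ * _).
rewrite /lform (raddf_sum (mderiv i)) (raddf_sum (meval _)) (bigD1 i) //= big1 ?addr0 => [|j nj].
  rewrite mderivZ mevalZ mderivX mevalZ mnm1E eqxx mul1r.
  suff -> : (U_(i) - U_(i) = 0 :> 'X_{1..n})%MM by rewrite mpolyX0 meval1 mulr1.
  by apply/mnmP => j; rewrite mnmBE mnm0E subnn.
by rewrite mderivZ mevalZ mderivX mevalZ mnm1E (negbTE nj) mul0r mulr0.
Qed.

End Direction.

(** * A strictly ascending chain of left ideals *)

Section NotNoetherian.
Variables (k : closedFieldType) (p : nat) (Phi : graded_aut k p.+3).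
Variables (phi : autP k p.+2) (c : point k p.+2) (ind : induces Phi phi).
Variables (M : 'M[k]_p.+3) (a : nat -> 'I_p.+2 -> k).
Hypothesis UM : M \in unitmx.
Local Notation w := (orbit_vec Phi c).
Hypothesis w_patch : forall i : int, (w i *m M) 0 ord0 != 0.
Hypothesis a_coord : forall i j, a i j = affine_coord M (w (Posz i)) j.
Hypothesis a_distinct : forall i j, i <> j -> a i ord0 <> a j ord0.
Local Notation U := {mpoly k[p.+3]}.
Local Notation A := {mpoly k[p.+2]}.
Local Notation R := (Ralg Phi c).
Local Notation B := (infinite_blowup a).
Local Notation T := (tensor R B).

Definition taut (j : 'I_p.+3) : A := if unlift ord0 j is Some j' then 'X_j' else 1.

(** In the coordinates of [M] the tautological point is [(1, y_1, ..., y_t)]; [invmx M] converts it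
    to standard coordinates. *)
Definition generic_pt (i : 'I_p.+3) : A :=
  \sum_j taut j * (invmx M j i)%:MP.

(* Value of a form at the tautological point of the affine patch. *)
Definition ev : U -> A := mmap (@mpolyC _ _) generic_pt.
HB.instance Definition _ := GRing.RMorphism.on ev.

Lemma evC d : ev d%:MP = d%:MP. Proof. by rewrite /ev mmapC. Qed.
Lemma evX i : ev 'X_i = generic_pt i. Proof. by rewrite /ev mmapX mmap1U. Qed.

Lemma ev_lform_col j :
  ev (lform (col j M)) = taut j.
Proof.
rewrite /lform rmorph_sum /=.
transitivity (\sum_i \sum_h taut h * (invmx M h i * M i j)%:MP).
  apply: eq_bigr => i _; rewrite -mul_mpolyC rmorphM /= evC evX mxE /generic_pt.
  rewrite mulr_sumr; apply: eq_bigr => h _; by rewrite mpolyCM mulrC -mulrA.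
rewrite exchange_big /= (bigD1 j) //= [X in _ + X]big1 ?addr0 => [|h nh].
  rewrite -mulr_sumr -rmorph_sum /=; have /matrixP/(_ j j) := mulVmx UM.
  by rewrite !mxE eqxx => ->; rewrite mpolyC1 mulr1.
rewrite -mulr_sumr -rmorph_sum /=; have /matrixP/(_ h j) := mulVmx UM.
by rewrite !mxE (negbTE nh) => ->; rewrite mpolyC0 mulr0.
Qed.

Lemma meval_ev f i :
  (ev f).@[a i] = f.@[(((w (Posz i) *m M) 0 ord0)^-1 *: w (Posz i)) 0].
Proof.
set v := _ *: _; have vM j : (v *m M) 0 j = if unlift ord0 j is Some j' then a i j' else 1.
  rewrite /v -scalemxAl mxE; case: unliftP => [j' ->|->]; last by rewrite mulVf.
  by rewrite a_coord /affine_coord mulrC.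
apply: (mpoly_rmorph_ext (f := meval (a i) \o ev) (g := meval (v 0))) => [d|j] /=.
  by rewrite evC !mevalC.
rewrite evX mevalXU (raddf_sum (meval _)) /=.
have -> : v 0 j = (v *m M *m invmx M) 0 j by rewrite mulmxK.
rewrite mxE; apply: eq_bigr => h _; rewrite mevalM mevalC vM; congr (_ * _).
by rewrite /taut; case: unliftP => *; rewrite ?mevalXU ?meval1.
Qed.

Lemma meval_ev_homog e f i : f \is e.-homog ->
  (ev f).@[a i] = ((w (Posz i) *m M) 0 ord0) ^- e * f.@[w (Posz i) 0].
Proof. by move=> fh; rewrite meval_ev (meval_scale _ _ fh) exprVn. Qed.

(** A closed point of the blowup: the origin of the [n]-th exceptional divisor. *)
Definition chik n (x : B) : k := (chi a_distinct n x).@[fun _ => 0].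

Lemma chik_linear n d x y : chik n (d *: x + y) = d * chik n x + chik n y.
Proof. by rewrite /chik chi_linear mevalD mevalZ. Qed.

Lemma chikM n x y : chik n (x * y) = chik n x * chik n y.
Proof. by rewrite /chik chiM mevalM. Qed.

Lemma chik_0 n : chik n 0 = 0.
Proof. by rewrite /chik chi0 meval0. Qed.

Lemma chik_sum n (I : Type) (s : seq I) (P : pred I) (G : I -> B) :
  chik n (\sum_(i <- s | P i) G i) = \sum_(i <- s | P i) chik n (G i).
Proof.
elim/big_rec2: _ => [|i y1 y2 _ IH]; first exact: chik_0.
by rewrite -[G i]scale1r chik_linear IH mul1r scale1r.
Qed.

Lemma chik_jB n f : chik n (jB a f) = f.@[a n].
Proof. by rewrite /chik chi_jB mevalC. Qed.

Definition val_map (b : nat) (f : R) (x : B) : B := jB a (ev (pihomog mdeg b (Rval f))) * x.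

(** The vector dual to the linear form of [y_2]: the forms of the other columns of [M] vanish on it.
    Here dimension at least two enters. *)
Definition dir : 'rV[k]_p.+3 := row (lift ord0 (lift ord0 ord0)) (invmx M).

Definition der_map (n : nat) (f : R) (x : B) : k^o :=
  dir_deriv dir (w (Posz n)) (pihomog mdeg n.+1 (Rval f)) * chik n x.

Lemma jB_scale d f : jB a (d *: f) = d *: jB a f.
Proof. by apply: Bval_inj; rewrite BvalZ !jBE -mul_mpolyC rmorphM. Qed.

Lemma ev_scale d f : ev (d *: f) = d *: ev f.
Proof. by rewrite -!mul_mpolyC rmorphM /= evC. Qed.

Lemma val_map_bilinear b : is_bilinear (val_map b).
Proof.
split=> [x d f g|f d x y]; rewrite /val_map.
  by rewrite RvalD RvalZ pihomogD pihomogZ !rmorphD /= ev_scale jB_scale mulrDl scalerAl.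
by rewrite mulrDr scalerAr.
Qed.

Lemma der_map_bilinear n : is_bilinear (der_map n).
Proof.
split=> [x d f g|f d x y]; rewrite /der_map.
  by rewrite RvalD RvalZ pihomogD pihomogZ dir_deriv_linear mulrDl -mulrA.
by rewrite chik_linear mulrDr mulrCA.
Qed.

(* The kernel of evaluation along the family of truncated point modules
   parametrised by [B], cut down by vanishing to second order at [c_n] for [n >= N]. *)
Definition kernel_ideal (N : nat) (z : T) : Prop :=
  (forall b, tsum (val_map b) (repr z) = 0) /\
  (forall n, (N <= n)%N -> tsum (der_map n) (repr z) = 0).

Lemma tsum_0 (V : lmodType k) (f : R -> B -> V) : is_bilinear f -> tsum f (repr (0 : T)) = 0.
Proof. by move=> fb; rewrite (tsum_repr fb) /tsum big_nil. Qed.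

Lemma kernel_ideal_left N : is_left_ideal (kernel_ideal N).
Proof.
split=> [|x y [xv xd] [yv yd]|x z [zv zd]].
- split=> *; apply: tsum_0; [exact: val_map_bilinear|exact: der_map_bilinear].
- split=> [b|n leNn]; first by rewrite (tsum_add (val_map_bilinear b)) xv yv addr0.
  by rewrite (tsum_add (der_map_bilinear n)) xd // yd // addr0.
(* Specialising the evaluation condition at [chik n] turns it into a condition on values at [c_n],
   up to a nonzero scalar. *)
have zk n d : \sum_(v <- repr z) (pihomog mdeg d (Rval v.1)).@[w (Posz n) 0] * chik n v.2 = 0.
  have := congr1 (chik n) (zv d); rewrite chik_0 /tsum chik_sum.
  under eq_bigr => v _ do rewrite chikM chik_jB (meval_ev_homog n (pihomogP mdeg d _)) -mulrA.
  rewrite -mulr_sumr => /eqP; rewrite mulf_eq0 invr_eq0 expf_eq0 (negbTE (w_patch _)) andbF /=.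
  by move/eqP.
split=> [b|n leNn].
  rewrite (tsum_tmul (val_map_bilinear b)) big1 // => u _.
  transitivity (\sum_(d < b.+1) jB a (ev (iter d Phi (pihomog mdeg (b - d) (Rval u.1)))) * u.2 *
      tsum (val_map d) (repr z)); last by rewrite big1 // => d _; rewrite zv mulr0.
  under [RHS]eq_bigr do rewrite /tsum mulr_sumr.
  rewrite exchange_big /=; apply: eq_bigr => v _.
  rewrite /val_map RvalM pihomog_twist (rmorph_sum ev) (rmorph_sum (jB a)).
  rewrite mulr_suml; apply: eq_bigr => d _ /=.
  by rewrite !rmorphM /= mulrACA.
rewrite (tsum_tmul (der_map_bilinear n)) big1 // => u _.
transitivity (\sum_(v <- repr z) \sum_(d < n.+2) chik n u.2 *
   (dir_deriv dir (w (Posz n)) (iter d Phi (pihomog mdeg (n.+1 - d) (Rval u.1))) *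
     ((pihomog mdeg d (Rval v.1)).@[w (Posz n) 0] * chik n v.2) +
    (iter d Phi (pihomog mdeg (n.+1 - d) (Rval u.1))).@[w (Posz n) 0] *
     (dir_deriv dir (w (Posz n)) (pihomog mdeg d (Rval v.1)) * chik n v.2))).
  apply: eq_bigr => v _; rewrite /der_map RvalM pihomog_twist dir_deriv_sum chikM mulr_suml.
  by apply: eq_bigr => d _ /=; rewrite dir_derivM; ring.
rewrite exchange_big big1 //= => d _; rewrite -mulr_sumr big_split /= -!mulr_sumr zk mulr0 add0r.
(* After the Leibniz rule and [zk], the term [d = n.+1] is the hypothesis on [z]; for smaller [d]
   the left factor has positive degree [n.+1 - d] and vanishes at [c_n]. *)
have [Ed|ltd] : d = n.+1 :> nat \/ (d < n.+1)%N.
  by have := ltn_ord d; rewrite ltnS leq_eqVlt => /predU1P[]; auto.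
  by rewrite Ed -[X in _ * (_ * X)]/(tsum (der_map n) (repr z)) zd // !mulr0.
have -> : Posz n = Posz (n - d) + Posz d by rewrite -PoszD subnK.
rewrite meval_iter_aut (Rval_vanish ind) ?mul0r ?mulr0 //.
by move: ltd; clear; lia.
Qed.

Lemma tsum_pure (V : lmodType k) (f : R -> B -> V) x b : is_bilinear f ->
  tsum f (repr (pure x b : T)) = f x b.
Proof. by move=> fb; rewrite (tsum_repr fb) /tsum big_seq1. Qed.

Lemma left_multiplier N (l : U) : l \is 1.-homog -> l.@[w (Posz N) 0] = 0 ->
  exists Y : R, forall G : R, Rval G \is N.-homog -> Rval (Y * G) = l * Rval G.
Proof.
move=> lh lN; have [y yh Ey] := iter_aut_surj_homog Phi N lh.
have [|Y EY] := Rval_generator (c := c) ind yh.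
  by rewrite -(meval_iter_aut Phi c N) Ey add0r.
by exists Y => G Gh; rewrite RvalM EY (twist_mul_homog _ _ Gh) Ey.
Qed.

(** The homogenisation of [y_j - a i j] on the patch of [M]. *)
Definition coord_form i j : U := lform (col (lift ord0 j) M) - a i j *: lform (col ord0 M).

Lemma coord_form_homog i j : coord_form i j \is 1.-homog.
Proof. by apply: dhomogD (lform_homog _) _; rewrite dhomogN dhomogZ // lform_homog. Qed.

Lemma meval_coord_form i j n :
  (coord_form i j).@[w (Posz n) 0] = (a n j - a i j) * (w (Posz n) *m M) 0 ord0.
Proof.
rewrite mevalB mevalZ !meval_lform_col mulrBl; congr (_ - _).
by rewrite a_coord /affine_coord divfK.
Qed.

Lemma ev_coord_form i j : ev (coord_form i j) = 'X_j - (a i j)%:MP.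
Proof.
rewrite rmorphB /= ev_scale !ev_lform_col /taut liftK unlift_none.
by rewrite -mul_mpolyC mulr1.
Qed.

(** The product of the forms [coord_form i ord0] for [i < N]; distinctness of the first coordinates
    keeps it nonzero at later points. *)
Lemma orbit_product N : exists G : R, [/\ Rval G \is N.-homog
  & forall n, (N <= n)%N -> (Rval G).@[w (Posz n) 0] <> 0].
Proof.
elim: N => [|N [G [Gh Gn]]].
  by exists 1; rewrite Rval1 dhomog1; split=> // n _; rewrite meval1; apply/eqP/oner_neq0.
have [|Y HY] := left_multiplier (coord_form_homog N ord0) (N := N).
  by rewrite meval_coord_form subrr mul0r.
exists (Y * G); rewrite HY //; split; first exact: (dhomogM (coord_form_homog N ord0) Gh).
move=> n ltNn; rewrite mevalM meval_coord_form; apply/eqP.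
rewrite !mulf_neq0 ?w_patch //; last by apply/eqP/Gn/ltnW.
rewrite subr_eq0; apply/eqP/a_distinct => E; by rewrite E ltnn in ltNn.
Qed.

Theorem tensor_not_left_noetherian : ~ left_noetherian T.
Proof.
move=> /(_ kernel_ideal kernel_ideal_left)[|N HN].
  by move=> N z [zv zd]; split=> // n ltNn; apply: zd; apply: ltnW.
pose j : 'I_p.+2 := lift ord0 ord0.
have [G [Gh Gn]] := orbit_product N.
have [|Yj HYj] := left_multiplier (coord_form_homog N j) (N := N).
  by rewrite meval_coord_form subrr mul0r.
have [|Y0 HY0] := left_multiplier (coord_form_homog N ord0) (N := N).
  by rewrite meval_coord_form subrr mul0r.
(* Evaluation gives [(y_j - a N j) - (y_1 - a N ord0) * zB a N j] times a common factor, which is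
   zero by the relation defining [zB]. *)
pose z : T := pure (Yj * G) 1 + pure (Y0 * G) (- zB a N j).
have tz (V : lmodType k) (f : R -> B -> V) : is_bilinear f ->
    tsum f (repr z) = f (Yj * G) 1 + f (Y0 * G) (- zB a N j).
  by move=> fb; rewrite (tsum_add fb) !tsum_pure.
have jh := dhomogM (coord_form_homog N j) Gh.
have oh := dhomogM (coord_form_homog N ord0) Gh.
have zv b : tsum (val_map b) (repr z) = 0.
  rewrite (tz _ _ (val_map_bilinear b)) /val_map HYj // HY0 //.
  have [<-|nb] := eqVneq (1 + N)%N b; last first.
    by rewrite (pihomog_ne0 nb jh) (pihomog_ne0 nb oh) !rmorph0 !mul0r addr0.
  rewrite (pihomog_dE jh) (pihomog_dE oh) mulr1 mulrN !rmorphM /= !ev_coord_form.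
  apply/eqP; rewrite subr_eq0; apply/eqP/Bval_inj; rewrite !BvalM !jBE -pl_zB.
  by rewrite /pl; ring.
(* The left tensor factors of [z] have degree [N + 1], and [der_map n] sees only degree [n + 1]. *)
have zd n : n <> N -> tsum (der_map n) (repr z) = 0.
  move=> nN; rewrite (tz _ _ (der_map_bilinear n)) /der_map HYj // HY0 //.
  have ne : (1 + N)%N != n.+1 by apply/eqP => -[]; apply: not_eq_sym.
  by rewrite (pihomog_ne0 ne jh) (pihomog_ne0 ne oh) dir_deriv0 !mul0r addr0.
have [|_ /(_ N (leqnn N))] := HN N.+1 z (leqnSn N).
  by split=> // n ltNn; apply: zd => E; rewrite E ltnn in ltNn.
rewrite (tz _ _ (der_map_bilinear N)) /der_map HYj // HY0 // (pihomog_dE jh) (pihomog_dE oh).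
have c1 : chik N 1 = 1 by rewrite /chik chi1 meval1.
have cz : chik N (- zB a N j) = 0.
  by rewrite -scaleN1r -[_ *: _]addr0 chik_linear chik_0 /chik chi_zB // mevalXU mulr0 addr0.
(* The second term dies since [zB a N j] is zero at the chosen point; the first leaves the
   derivative of a linear form, equal to 1, times the nonzero value of [G] at [c_N]. *)
rewrite c1 cz mulr1 mulr0 addr0 dir_derivM meval_coord_form subrr !mul0r addr0.
have -> : dir_deriv dir (w (Posz N)) (coord_form N j) = 1.
  rewrite /coord_form addrC -scaleNr dir_deriv_linear !dir_deriv_lform.
  have dM i : (dir *m col i M) 0 0 = (lift ord0 j == i)%:R.
    by rewrite /dir -row_mul colE mulmxA mulVmx // mul1mx !mxE eqxx andbT.
  by rewrite !dM eqxx /= mulr0 add0r.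
by rewrite mul1r; apply: Gn.
Qed.

End NotNoetherian.

Theorem theorem7p4 (k : closedFieldType) (t : nat) (t_ge2 : (2 <= t)%N)
    (phi : autP k t) (Phi : graded_aut k t.+1) (c : point k t) :
  induces Phi phi ->
  critical_density phi c ->
  exists M : 'M[k]_t.+1,
    [/\ M \in unitmx,
        forall i : int, in_patch M (orbit_pt phi c i),
        blowup_defined (fun i => patch_coord M (orbit_pt phi c (Posz i)))
      & let B := infinite_blowup (fun i => patch_coord M (orbit_pt phi c (Posz i))) in
        [/\ noetherian (Ralg Phi c),
            noetherian B,
            is_UFD B
          & ~ left_noetherian (tensor (Ralg Phi c) B)]].
Proof.
move=> ind crit; case: t t_ge2 phi Phi c ind crit => [|[|p]] // _ phi Phi c ind crit.
have [M [UM wM dist]] := patch_exists ind crit; exists M.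
set a := fun i : nat => patch_coord M (orbit_pt phi c (Posz i)).
have a_coord i j : a i j = affine_coord M (orbit_vec Phi c (Posz i)) j.
  exact: patch_coordE (orbit_vec_line ind c (Posz i)) (orbit_vec_neq0 Phi c (Posz i)).
have a_distinct i j : i <> j -> a i ord0 <> a j ord0.
  by rewrite !a_coord; apply: dist.
have a_generic (f : {mpoly k[p.+2]}) : f <> 0 ->
    exists N, forall i, (N <= i)%N -> f.@[a i] <> 0.
  have Posz_inj : injective Posz by move=> i j [].
  have gen_w := orbit_generic ind crit Posz_inj.
  move=> /(affine_generic UM gen_w (fun i => wM (Posz i)))[N HN].
  by exists N => i leNi; rewrite (meval_eq _ (a_coord i)); apply: HN.
split=> // [i|l i j l0 nij|].
- by exists (orbit_vec Phi c i); [apply: orbit_vec_line|apply: wM].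
- by rewrite (_ : l = ord0); [apply: a_distinct|apply: val_inj].
split.
- split; first exact: (Ralg_left_noetherian ind _ crit).
  exact: (Ralg_right_noetherian ind _ crit).
- exact: blowup_noetherian.
- exact: blowup_UFD.
- exact: (tensor_not_left_noetherian ind UM wM a_coord a_distinct).
Qed.
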